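(* Let $\mathbf{k}$ be a commutative ring, $k\ge1$, $R=\mathbf{k}[x_1,\dots,x_k]/(x_1\cdots x_k)$ and $\mathcal{B}^{\circ}=\mathrm{End}_R\big(\bigoplus_{m=1}^kR/(x_1\cdots x_m)\big)$. For every $i=2,\dots,k$ define a $\mathcal{B}^{\circ}$-module $\overline{P}_i$ by the exact sequence $$0\to P_{[1,i-1]}\xrightarrow{\alpha\{[1,i-1],[i]\}}P_{[1,i]}\to\overline{P}_i\to0,$$ and let $\overline{P}_1=P_{[1]}$. Then $$\mathrm{Ext}^m_{\mathcal{B}^{\circ}}(\overline{P}_i,\overline{P}_i)\simeq\begin{cases}R/(x_i)&m=0,\\0&m\ne0,\end{cases}$$ and there is a semiorthogonal decomposition $$\mathrm{Perf}(\mathcal{B}^{\circ})=\langle\langle\overline{P}_k\rangle,\dots,\langle\overline{P}_2\rangle,\langle\overline{P}_1\rangle\rangle,$$ where $\langle\overline{P}_i\rangle\simeq\mathrm{Perf}(R/(x_i))$.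
   Context: Modules are left modules. $P_{[1,m]}=\mathcal{B}^{\circ}e_m$, where $e_m$ is the idempotent of the summand $R/(x_{[1,m]})$, $x_{[1,m]}=x_1\cdots x_m$ (so $[1]=[1,1]$); thus $\mathrm{Hom}_{\mathcal{B}^{\circ}}(P_{[1,l]},P_{[1,m]})=\mathrm{Hom}_R(R/(x_{[1,m]}),R/(x_{[1,l]}))$. $\alpha\{[1,i-1],[i]\}:P_{[1,i-1]}\to P_{[1,i]}$ is the morphism corresponding to the natural projection $R/(x_{[1,i]})\to R/(x_{[1,i-1]})$ (it is injective). $\mathrm{Perf}(A)$ is the category of bounded complexes of finitely generated projective $A$-modules; $\langle P\rangle$ is the triangulated subcategory (closed under direct summands) generated by $P$. $\langle\mathcal{C}_1,\dots,\mathcal{C}_m\rangle$ is a semiorthogonal decomposition if the $\mathcal{C}_i$ generate and $\mathrm{Hom}^\bullet(\mathcal{C}_b,\mathcal{C}_a)=0$ for $a<b$. *)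

(* Defs.v *)
From HB Require Import structures.
From mathcomp Require Import all_boot all_order all_algebra.
From mathcomp Require Import generic_quotient ring.
From mathcomp.multinomials Require Import mpoly.
From mathcomp.classical Require Import boolp.

Set Implicit Arguments.
Unset Strict Implicit.
Unset Printing Implicit Defensive.

Import GRing.Theory.

Local Open Scope ring_scope.
Local Open Scope quotient_scope.

Section Cokernel.
Variables (A : pzRingType) (U M : lmodType A) (f : {linear U -> M}).

Definition coker_rel : rel M := fun x y => `[< exists u, x - y = f u >].

Lemma coker_rel_equiv : equiv_class_of coker_rel.
Proof.
split=> [x|x y|y x z].
- by apply/asboolP; exists 0; rewrite subrr linear0.
- by apply/asboolP/asboolP => -[u uE]; exists (- u); rewrite (linearN f) -uE opprB.
- move=> /asboolP[u uE] /asboolP[v vE]; apply/asboolP; exists (u + v).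
  by rewrite (linearD f) -uE -vE addrA subrK.
Qed.

Canonical coker_equiv := EquivRelPack coker_rel_equiv.

Definition coker := {eq_quot coker_equiv}.
HB.instance Definition _ := EqQuotient.on coker.
HB.instance Definition _ := Choice.on coker.

Definition coker_pi (x : M) : coker := \pi_coker x.

Lemma coker_eqP x y : coker_pi x = coker_pi y <-> exists u, x - y = f u.
Proof.
rewrite /coker_pi; split=> [/eqP|h]; last by apply/eqP; rewrite eqmodE; apply/asboolP.
by rewrite eqmodE => /asboolP.
Qed.

Lemma coker_reprK x : coker_pi (repr x) = x.
Proof. exact: reprK. Qed.

Lemma coker_surj (x : coker) : exists y, x = coker_pi y.
Proof. by exists (repr x); rewrite coker_reprK. Qed.

Definition coker_opp (x : coker) : coker := coker_pi (- repr x).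
Definition coker_add (x y : coker) : coker := coker_pi (repr x + repr y).
Definition coker_scale (a : A) (x : coker) : coker := coker_pi (a *: repr x).

Lemma coker_repr x : exists u, repr (coker_pi x) - x = f u.
Proof. by apply/coker_eqP; rewrite coker_reprK. Qed.

Lemma coker_oppE x : coker_opp (coker_pi x) = coker_pi (- x).
Proof.
have [u uE] := coker_repr x; apply/coker_eqP; exists (- u).
by rewrite (linearN f) -uE opprK opprB addrC.
Qed.

Lemma coker_addE x y : coker_add (coker_pi x) (coker_pi y) = coker_pi (x + y).
Proof.
have [u uE] := coker_repr x; have [v vE] := coker_repr y.
by apply/coker_eqP; exists (u + v); rewrite (linearD f) -uE -vE opprD addrACA.
Qed.

Lemma coker_scaleE a x : coker_scale a (coker_pi x) = coker_pi (a *: x).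
Proof.
have [u uE] := coker_repr x; apply/coker_eqP; exists (a *: u).
by rewrite linearZ_LR -uE scalerBr.
Qed.

Lemma coker_addA : associative coker_add.
Proof.
move=> x y z; have [[{}x ->] [{}y ->] [{}z ->]] :=
  And3 (coker_surj x) (coker_surj y) (coker_surj z).
by rewrite !coker_addE addrA.
Qed.
Lemma coker_addC : commutative coker_add.
Proof.
move=> x y; have [[{}x ->] [{}y ->]] := conj (coker_surj x) (coker_surj y).
by rewrite !coker_addE addrC.
Qed.
Lemma coker_add0 : left_id (coker_pi 0) coker_add.
Proof. by move=> x; have [{}x ->] := coker_surj x; rewrite coker_addE add0r. Qed.
Lemma coker_addN : left_inverse (coker_pi 0) coker_opp coker_add.
Proof.
by move=> x; have [{}x ->] := coker_surj x; rewrite coker_oppE coker_addE addNr.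
Qed.

HB.instance Definition _ := GRing.isZmodule.Build coker
  coker_addA coker_addC coker_add0 coker_addN.

Lemma coker_scaleA a b x :
  coker_scale a (coker_scale b x) = coker_scale (a * b) x.
Proof. by have [{}x ->] := coker_surj x; rewrite !coker_scaleE scalerA. Qed.
Lemma coker_scale1 : left_id 1 coker_scale.
Proof. by move=> x; have [{}x ->] := coker_surj x; rewrite coker_scaleE scale1r. Qed.
Lemma coker_scaleDr : right_distributive coker_scale +%R.
Proof.
move=> a x y; have [[{}x ->] [{}y ->]] := conj (coker_surj x) (coker_surj y).
by rewrite [_ + _]coker_addE !coker_scaleE [RHS]coker_addE scalerDr.
Qed.
Lemma coker_scaleDl x : {morph coker_scale^~ x : a b / a + b}.
Proof.
move=> a b; have [{}x ->] := coker_surj x.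
by rewrite !coker_scaleE [RHS]coker_addE scalerDl.
Qed.

HB.instance Definition _ := GRing.Zmodule_isLmodule.Build A coker
  coker_scaleA coker_scale1 coker_scaleDr coker_scaleDl.

Lemma coker_pi_is_linear : linear coker_pi.
Proof. by move=> a x y; rewrite -coker_addE -coker_scaleE. Qed.
HB.instance Definition _ :=
  GRing.isLinear.Build A M coker _ coker_pi coker_pi_is_linear.

End Cokernel.

Section PrincipalQuotient.
Variables (R : comPzRingType) (a : R).

Definition mulby (x : R^o) : R^o := x * a.
Lemma mulby_is_linear : linear mulby.
Proof. by move=> r x y; rewrite /mulby mulrDl; congr (_ + _); exact/esym/mulrA. Qed.
HB.instance Definition _ :=
  GRing.isLinear.Build R R^o R^o _ mulby mulby_is_linear.

Definition qring := coker mulby.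
HB.instance Definition _ := GRing.Lmodule.on qring.

Definition qpi (x : R) : qring := coker_pi mulby x.
Definition qrepr (x : qring) : R := repr x.
Definition qmul (x y : qring) : qring := qpi (qrepr x * qrepr y).

Lemma qreprK x : qpi (qrepr x) = x.
Proof. exact: coker_reprK. Qed.

Lemma qpi_eqP x y : qpi x = qpi y <-> exists u, x - y = u * a.
Proof. exact: coker_eqP. Qed.

Lemma qpi_surj (x : qring) : exists y, x = qpi y.
Proof. by exists (qrepr x); rewrite qreprK. Qed.

Lemma qpiD x y : qpi (x + y) = qpi x + qpi y.
Proof. exact: (linearD (coker_pi mulby)). Qed.

Lemma qpiZ r x : qpi (r * x) = r *: qpi x.
Proof. exact: (linearZ_LR (coker_pi mulby)). Qed.

Lemma qmulE x y : qmul (qpi x) (qpi y) = qpi (x * y).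
Proof.
have [u uE] : exists u, qrepr (qpi x) - x = u * a by apply/qpi_eqP; rewrite qreprK.
have [v vE] : exists v, qrepr (qpi y) - y = v * a by apply/qpi_eqP; rewrite qreprK.
apply/qpi_eqP; exists (u * qrepr (qpi y) + x * v).
rewrite mulrDl -[x * v * a]mulrA -vE mulrAC -uE.
by rewrite mulrBl mulrBr addrA subrK.
Qed.

Lemma qmulA : associative qmul.
Proof.
move=> x y z; have [[{}x ->] [{}y ->] [{}z ->]] :=
  And3 (qpi_surj x) (qpi_surj y) (qpi_surj z).
by rewrite !qmulE mulrA.
Qed.
Lemma qmulC : commutative qmul.
Proof.
move=> x y; have [[{}x ->] [{}y ->]] := conj (qpi_surj x) (qpi_surj y).
by rewrite !qmulE mulrC.
Qed.
Lemma qmul1 : left_id (qpi 1) qmul.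
Proof. by move=> x; have [{}x ->] := qpi_surj x; rewrite qmulE mul1r. Qed.
Lemma qmulDl : left_distributive qmul +%R.
Proof.
move=> x y z; have [[{}x ->] [{}y ->] [{}z ->]] :=
  And3 (qpi_surj x) (qpi_surj y) (qpi_surj z).
by rewrite -qpiD !qmulE -qpiD mulrDl.
Qed.

HB.instance Definition _ := GRing.Zmodule_isComPzRing.Build qring
  qmulA qmulC qmul1 qmulDl.

End PrincipalQuotient.

(* The natural projection R/(a) -> R/(b); well defined when b divides a. *)
Definition qproj (R : comPzRingType) (a b : R) (x : qring a) : qring b :=
  qpi b (qrepr x).

Lemma qprojE (R : comPzRingType) (a b c x : R) :
  a = c * b -> qproj b (qpi a x) = qpi b x.
Proof.
move=> aE; have [u uE] : exists u, qrepr (qpi a x) - x = u * a.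
  by apply/qpi_eqP; rewrite qreprK.
by apply/qpi_eqP; exists (u * c); rewrite uE aE mulrA.
Qed.

Lemma qproj_is_linear (R : comPzRingType) (a b c : R) :
  a = c * b -> linear (@qproj R a b).
Proof.
move=> aE r x y; have [[{}x ->] [{}y ->]] := conj (qpi_surj x) (qpi_surj y).
by rewrite -qpiZ -qpiD !(qprojE _ aE) qpiD qpiZ.
Qed.

Section DirectSum.
Variables (R : pzRingType) (n : nat) (M : 'I_n -> lmodType R).

Definition dirsum := forall i, M i.
HB.instance Definition _ := Choice.on dirsum.

Lemma dirsum_ext (v w : dirsum) : (forall i, v i = w i) -> v = w.
Proof. by move=> vw; apply: functional_extensionality_dep. Qed.

Fact dirsum_addA : associative (fun (v w : dirsum) i => v i + w i).
Proof. by move=> u v w; apply: dirsum_ext => i; rewrite addrA. Qed.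
Fact dirsum_addC : commutative (fun (v w : dirsum) i => v i + w i).
Proof. by move=> v w; apply: dirsum_ext => i; rewrite addrC. Qed.
Fact dirsum_add0 :
  left_id (fun i => 0 : M i) (fun (v w : dirsum) i => v i + w i).
Proof. by move=> v; apply: dirsum_ext => i; rewrite add0r. Qed.
Fact dirsum_addN :
  left_inverse (fun i => 0 : M i) (fun (v : dirsum) i => - v i)
    (fun (v w : dirsum) i => v i + w i).
Proof. by move=> v; apply: dirsum_ext => i; rewrite addNr. Qed.
HB.instance Definition _ := GRing.isZmodule.Build dirsum
  dirsum_addA dirsum_addC dirsum_add0 dirsum_addN.

Fact dirsum_scaleA a b (v : dirsum) :
  (fun i => a *: (b *: v i)) = (fun i => (a * b) *: v i) :> dirsum.
Proof. by apply: dirsum_ext => i; rewrite scalerA. Qed.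
Fact dirsum_scale1 : left_id 1 (fun a (v : dirsum) i => a *: v i).
Proof. by move=> v; apply: dirsum_ext => i; rewrite scale1r. Qed.
Fact dirsum_scaleDr :
  right_distributive (fun a (v : dirsum) i => a *: v i) +%R.
Proof. by move=> a v w; apply: dirsum_ext => i; rewrite scalerDr. Qed.
Fact dirsum_scaleDl (v : dirsum) :
  {morph (fun a i => a *: v i : M i) : a b / a + b >-> (a : dirsum) + b}.
Proof. by move=> a b; apply: dirsum_ext => i; rewrite scalerDl. Qed.
HB.instance Definition _ := GRing.Zmodule_isLmodule.Build R dirsum
  dirsum_scaleA dirsum_scale1 dirsum_scaleDr dirsum_scaleDl.

End DirectSum.

Definition mklin (A : pzRingType) (U V : lmodType A) (f : U -> V)
    (lf : linear f) : {linear U -> V} :=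
  HB.pack f (GRing.isLinear.Build A U V _ f lf).

Section Endomorphisms.
Variables (R : pzRingType) (M : lmodType R).

Definition endo := {linear M -> M}.
HB.instance Definition _ := gen_eqMixin endo.
HB.instance Definition _ := gen_choiceMixin endo.

Lemma endo_ext (f g : endo) : f =1 g -> f = g.
Proof.
move=> fg; have {fg} : (f : M -> M) = g by exact: functional_extensionality_dep.
case: f g => [f [[f1] [f2]]] [g [[g1] [g2]]] /= fg.
subst g.
by rewrite (Prop_irrelevance f1 g1) (Prop_irrelevance f2 g2).
Qed.

Definition endo0 : endo := (\0 : M -> M)%R.
Definition endo_opp (f : endo) : endo := (\- f)%R.
Definition endo_add (f g : endo) : endo := (f \+ g)%R.
Definition endo1 : endo := (idfun : M -> M).
Definition endo_mul (f g : endo) : endo := (f \o g).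

Fact endo_addA : associative endo_add.
Proof. by move=> f g h; apply: endo_ext => x; apply: addrA. Qed.
Fact endo_addC : commutative endo_add.
Proof. by move=> f g; apply: endo_ext => x; apply: addrC. Qed.
Fact endo_add0 : left_id endo0 endo_add.
Proof. by move=> f; apply: endo_ext => x; apply: add0r. Qed.
Fact endo_addN : left_inverse endo0 endo_opp endo_add.
Proof. by move=> f; apply: endo_ext => x; apply: addNr. Qed.
HB.instance Definition _ := GRing.isZmodule.Build endo
  endo_addA endo_addC endo_add0 endo_addN.

Fact endo_mulA : associative endo_mul.
Proof. by move=> f g h; apply: endo_ext. Qed.
Fact endo_mul1 : left_id endo1 endo_mul.
Proof. by move=> f; apply: endo_ext. Qed.
Fact endo_1mul : right_id endo1 endo_mul.
Proof. by move=> f; apply: endo_ext. Qed.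
Fact endo_mulDl : left_distributive endo_mul +%R.
Proof. by move=> f g h; apply: endo_ext. Qed.
Fact endo_mulDr : right_distributive endo_mul +%R.
Proof. by move=> f g h; apply: endo_ext => x; apply: (linearD f). Qed.
HB.instance Definition _ := GRing.Zmodule_isPzRing.Build endo
  endo_mulA endo_mul1 endo_1mul endo_mulDl endo_mulDr.

End Endomorphisms.

Lemma homothety_is_linear (R : comPzRingType) (M : lmodType R) (r : R) :
  linear (fun x : M => r *: x).
Proof. by move=> a x y; rewrite scalerDr !scalerA mulrC. Qed.
Definition homothety (R : comPzRingType) (M : lmodType R) (r : R) : endo M :=
  mklin (@homothety_is_linear R M r).

Section LeftIdeal.
Variables (A : pzRingType) (e : A).

Definition in_leftideal : {pred A^o} := fun b => `[< exists c : A, b = c * e >].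

Fact leftideal_closed : submod_closed in_leftideal.
Proof.
split=> [|a x y /asboolP[c ->] /asboolP[d ->]].
  by apply/asboolP; exists 0; rewrite mul0r.
by apply/asboolP; exists (a * c + d); rewrite mulrDl -mulrA.
Qed.
HB.instance Definition _ :=
  GRing.isSubmodClosed.Build A A^o in_leftideal leftideal_closed.

Record leftideal := LeftIdeal {
  leftideal_val :> A^o;
  leftideal_subproof : leftideal_val \in in_leftideal }.
HB.instance Definition _ := [isSub for leftideal_val].
HB.instance Definition _ := [Choice of leftideal by <:].
HB.instance Definition _ := [SubChoice_isSubLmodule of leftideal by <:].

End LeftIdeal.

(* Right multiplication Ae -> Ae', b |-> b * a, for a in eAe'. *)
Section RightMultiplication.
Variables (A : pzRingType) (e e' a : A).

Fact rmul_subproof (aE : a * e' = a) (b : leftideal e) :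
  ((val b : A) * a : A^o) \in in_leftideal e'.
Proof. by apply/asboolP; exists ((val b : A) * a); rewrite -mulrA aE. Qed.

Definition rmul_fun (aE : a * e' = a) (b : leftideal e) : leftideal e' :=
  LeftIdeal (rmul_subproof aE b).

Fact rmul_is_linear (aE : a * e' = a) : linear (rmul_fun aE).
Proof. by move=> c x y; apply: val_inj; rewrite /= mulrDl -mulrA. Qed.

Definition rmul (aE : a * e' = a) : {linear leftideal e -> leftideal e'} :=
  mklin (rmul_is_linear aE).

End RightMultiplication.

Section Auslander.
Variables (k : comNzRingType) (n : nat).

(* Ordinals count from 0, so i : 'I_n stands for the index i + 1: var i is
   x_(i+1), xprod i is x_[1,i+1], projP i is P_[1,i+1]. *)
Definition ringR : comPzRingType := qring (\prod_(i < n) 'X_i : {mpoly k[n]}).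

Definition cst (c : k) : ringR := qpi _ c%:MP.

Definition var (i : 'I_n) : ringR := qpi _ 'X_i.

Definition xprod (m : 'I_n) : ringR := \prod_(j < n | (j <= m)%N) var j.

Definition summands : lmodType ringR := dirsum (fun m => qring (xprod m)).

Definition ringB : pzRingType := endo summands.

(* The projector onto the summand R/(xprod m). *)
Definition idem_fun (m : 'I_n) (v : summands) : summands :=
  fun l => if l == m then v l else 0.
Fact idem_is_linear m : linear (idem_fun m).
Proof.
move=> a v w; apply: dirsum_ext => l; rewrite /idem_fun.
rewrite -[RHS]/(a *: (if l == m then v l else 0) + (if l == m then w l else 0)).
by case: eqP => // _; rewrite scaler0 addr0.
Qed.
Definition idem (m : 'I_n) : ringB := mklin (idem_is_linear m).

Definition projP (m : 'I_n) : lmodType ringB := leftideal (idem m).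

(* The natural projection R/(xprod i) -> R/(xprod j) for j <= i,
   extended by zero to an endomorphism of the direct sum. *)
Section Alpha.
Variables (j i : 'I_n) (leji : (j <= i)%N).

Lemma xprod_dvd : exists c, xprod i = c * xprod j.
Proof.
exists (\prod_(l < n | (l <= i)%N && ~~ (l <= j)%N) var l).
rewrite /xprod mulrC (bigID (fun l : 'I_n => (l <= j)%N)) /=; congr (_ * _).
apply: eq_bigl => l; case: (leqP l j) => lj; rewrite ?andbF ?andbT //.
exact: leq_trans lj leji.
Qed.

Definition transition_fun (v : summands) : summands :=
  fun l => if l == j then qproj (xprod l) (v i) else 0.
Fact transition_is_linear : linear transition_fun.
Proof.
have [c cE] := xprod_dvd.
move=> a v w; apply: dirsum_ext => l; rewrite /transition_fun.
rewrite -[RHS]/(a *: (if l == j then qproj (xprod l) (v i) else 0)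
  + (if l == j then qproj (xprod l) (w i) else 0)).
case: eqP => [->|_]; last by rewrite scaler0 addr0.
exact: (qproj_is_linear cE).
Qed.
Definition transition : ringB := mklin transition_is_linear.

Fact transition_idem : transition * idem i = transition.
Proof.
apply: endo_ext => v; apply: dirsum_ext => l.
rewrite -[LHS]/(if l == j then qproj (xprod l) (idem_fun i v i) else 0).
by rewrite /idem_fun eqxx.
Qed.

Definition alpha : {linear projP j -> projP i} := rmul _ transition_idem.

Lemma alpha_inj : injective alpha.
Proof.
have [c cE] := xprod_dvd.
move=> x y xy; apply: val_inj; apply: endo_ext => v.
pose w : summands := fun l => qpi (xprod l) (qrepr (v j)).
have wE : idem j v = transition w.
  apply: dirsum_ext => l; rewrite -[LHS]/(if l == j then v l else 0).
  rewrite -[RHS]/(if l == j then qproj (xprod l) (w i) else 0).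
  by case: eqP => // ->; rewrite (qprojE _ cE) qreprK.
have idemK : idem j (transition w) = transition w.
  rewrite -wE; apply: dirsum_ext => l; rewrite /= /idem_fun.
  by case: eqP.
have key (z : projP j) : (val z : ringB) v = (val (alpha z) : ringB) w.
  have /asboolP[d dE] := valP z.
  rewrite -[RHS]/((val z : ringB) (transition w)) dE.
  by rewrite -[LHS]/(d (idem j v)) -[RHS]/(d (idem j (transition w))) idemK wE.
by rewrite !key xy.
Qed.

End Alpha.

(* In ordinal indexing the first case is Pbar_1 = P_[1], the second is
   Pbar_i = coker (P_[1,i-1] -> P_[1,i]) with i = m'.+2. *)
Definition Pbar (i : 'I_n) : lmodType ringB :=
  let: Ordinal m lt_mn := i in
  match m return (m < n)%N -> lmodType ringB with
  | 0%N => fun lt0n => projP (Ordinal lt0n)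
  | m'.+1 => fun ltmn =>
      coker (@alpha (Ordinal (ltnW ltmn)) (Ordinal ltmn) (leqnSn m'))
  end lt_mn.

End Auslander.

Record complex (A : pzRingType) := Complex {
  cobj :> int -> lmodType A;
  cdiff : forall i, {linear cobj i -> cobj (i + 1)};
  cdiffK : forall i x, cdiff (i + 1) (cdiff i x) = 0 }.

Record chmap (A : pzRingType) (X Y : complex A) := Chmap {
  cmap :> forall i, {linear X i -> Y i};
  cmapP : forall i x, cmap (i + 1) (cdiff X i x) = cdiff Y i (cmap i x) }.

Section Complexes.
Variable A : pzRingType.
Implicit Types X Y Z : complex A.

(* Every integer is of the form i + 1, so the equation covers all degrees. *)
Definition homotopic X Y (f g : forall i, X i -> Y i) : Prop :=
  exists h : forall i, {linear X (i + 1) -> Y i},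
    forall i x, f (i + 1) x - g (i + 1) x =
      cdiff Y i (h i x) + h (i + 1) (cdiff X (i + 1) x).

Definition chmap_eq X Y (f g : chmap X Y) : Prop :=
  homotopic (fun i => f i) (fun i => g i).

Definition nullhomotopic X Y (f : chmap X Y) : Prop :=
  homotopic (fun i => f i) (fun i _ => 0).

Definition chmap_id X : chmap X X :=
  @Chmap A X X (fun i => idfun) (fun i x => erefl).

Fact chmap_comp_subproof X Y Z (g : chmap Y Z) (f : chmap X Y) i x :
  (g (i + 1) \o f (i + 1)) (cdiff X i x) = cdiff Z i ((g i \o f i) x).
Proof. by rewrite /= !cmapP. Qed.
Definition chmap_comp X Y Z (g : chmap Y Z) (f : chmap X Y) : chmap X Z :=
  @Chmap A X Z (fun i => g i \o f i) (chmap_comp_subproof g f).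

Definition mutually_inverse X Y (f : chmap X Y) (g : chmap Y X) : Prop :=
  chmap_eq (chmap_comp g f) (chmap_id X) /\
  chmap_eq (chmap_comp f g) (chmap_id Y).

Definition homotopy_equivalent X Y : Prop :=
  exists (f : chmap X Y) (g : chmap Y X), mutually_inverse f g.

Fact shift_subproof X i (x : X (i + 1)) :
  (\- cdiff X (i + 1 + 1)) ((\- cdiff X (i + 1)) x) = 0.
Proof. by rewrite /= linearN cdiffK !oppr0. Qed.
Definition shift X : complex A :=
  @Complex A (fun i => X (i + 1)) (fun i => \- cdiff X (i + 1))
    (@shift_subproof X).

Definition chmap_shift X Y (f : chmap X Y) : chmap (shift X) (shift Y).
Proof.
exists (fun i => f (i + 1)) => i x.
by rewrite /= linearN cmapP.
Defined.

Section Cone.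
Variables (X Y : complex A) (f : chmap X Y).

Definition cone_obj (i : int) : lmodType A := (X (i + 1)%R * Y i)%type.
Definition cone_fun i (p : cone_obj i) : cone_obj (i + 1) :=
  (- cdiff X (i + 1) p.1, f (i + 1) p.1 + cdiff Y i p.2).
Fact cone_fun_is_linear i : linear (@cone_fun i).
Proof.
move=> a p q; congr pair; rewrite /= !linearP ?opprD ?scalerN //.
by rewrite scalerDr addrACA.
Qed.
Fact cone_subproof i (p : cone_obj i) :
  mklin (@cone_fun_is_linear (i + 1)) (mklin (@cone_fun_is_linear i) p) = 0.
Proof.
rewrite /= /cone_fun /=; congr pair; first by rewrite linearN cdiffK !oppr0.
by rewrite !linearN linearD cdiffK addr0 cmapP addNr.
Qed.
Definition cone : complex A :=
  @Complex A cone_obj (fun i => mklin (@cone_fun_is_linear i)) cone_subproof.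

Fact cone_in_is_linear i : linear (fun y : Y i => (0, y) : cone i).
Proof. by move=> a y z; congr pair; rewrite /= scaler0 addr0. Qed.
Fact cone_in_subproof i (y : Y i) :
  mklin (@cone_in_is_linear (i + 1)) (cdiff Y i y) =
  cdiff cone i (mklin (@cone_in_is_linear i) y).
Proof. by rewrite /= /cone_fun /= !linear0 ?oppr0 add0r. Qed.
Definition cone_in : chmap Y cone := Chmap cone_in_subproof.

Fact cone_out_is_linear i : linear (fun p : cone i => p.1 : shift X i).
Proof. by []. Qed.
Fact cone_out_subproof i (p : cone i) :
  mklin (@cone_out_is_linear (i + 1)) (cdiff cone i p) =
  cdiff (shift X) i (mklin (@cone_out_is_linear i) p).
Proof. by []. Qed.
Definition cone_out : chmap cone (shift X) := Chmap cone_out_subproof.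

End Cone.

(* X -f-> Y -g-> Z -h-> X[1] is isomorphic, by the identity on X and Y, to the
   triangle of the cone of f. *)
Definition distinguished X Y Z
    (f : chmap X Y) (g : chmap Y Z) (h : chmap Z (shift X)) : Prop :=
  exists (u : chmap Z (cone f)) (v : chmap (cone f) Z),
    [/\ mutually_inverse u v,
        chmap_eq (chmap_comp u g) (cone_in f) &
        chmap_eq (chmap_comp (cone_out f) u) h].

(* Hom(X, Y[m]) = 0 for all integers m; for m < 0 this group is written as
   Hom(X[-m], Y). *)
Definition Hom_vanish X Y : Prop := forall m : nat,
  (forall f : chmap X (iter m shift Y), nullhomotopic f) /\
  (forall f : chmap (iter m shift X) Y, nullhomotopic f).

Definition projective (M : lmodType A) : Prop :=
  forall (U V : lmodType A) (p : {linear U -> V}) (f : {linear M -> V}),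
    (forall v, exists u, p u = v) ->
    exists g : {linear M -> U}, forall x, p (g x) = f x.

Definition finitely_generated (M : lmodType A) : Prop :=
  exists (r : nat) (g : 'I_r -> M),
    forall x, exists a : 'I_r -> A, x = \sum_(i < r) a i *: g i.

Definition bounded X : Prop :=
  exists N : nat, forall i : int, (N < `|i|)%N -> forall x : X i, x = 0.

Definition perfect X : Prop :=
  bounded X /\ forall i, projective (X i) /\ finitely_generated (X i).

(* The objects of Perf(A); its morphisms are the chain maps up to homotopy. *)
Record perf := Perf { perf_val :> complex A; perfP : perfect perf_val }.

Fact shift_perfect X : perfect X -> perfect (shift X).
Proof.
move=> [[N XN] Xproj]; split=> [|i]; last exact: Xproj.
exists N.+1 => i ltNi; apply: XN.
have := leqD_dist i (i + 1) 0.
rewrite !subr0 opprD addrA subrr sub0r abszN absz1 add1n => le_i.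
by rewrite -ltnS (leq_trans ltNi).
Qed.
Definition perf_shift (X : perf) : perf := Perf (shift_perfect (perfP X)).

(* T is the class of objects of a strictly full triangulated subcategory. *)
Definition triangulated (T : perf -> Prop) : Prop :=
  [/\ (forall X : perf, nullhomotopic (chmap_id X) -> T X),
      (forall X Y : perf, homotopy_equivalent X Y -> T X -> T Y),
      (forall X : perf, T (perf_shift X) <-> T X) &
      (forall (X Y Z : perf) (f : chmap X Y) (g : chmap Y Z)
          (h : chmap Z (shift X)),
        distinguished f g h -> T X -> T Y -> T Z)].

Definition summand_closed (T : perf -> Prop) : Prop :=
  forall (X Y : perf) (s : chmap X Y) (r : chmap Y X),
    chmap_eq (chmap_comp r s) (chmap_id X) -> T Y -> T X.

Definition tri_hull (S : perf -> Prop) (X : perf) : Prop :=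
  forall T, triangulated T -> (forall Y : perf, S Y -> T Y) -> T X.

(* Unlike tri_hull, closed under direct summands. *)
Definition thick_hull (S : perf -> Prop) (X : perf) : Prop :=
  forall T, triangulated T -> summand_closed T -> (forall Y : perf, S Y -> T Y) -> T X.

Definition semiorthogonal_decomposition (r : nat) (C : 'I_r -> perf -> Prop) :
    Prop :=
  [/\ (forall a, triangulated (C a)),
      (forall a b : 'I_r, (a < b)%N ->
        forall X Y : perf, C b X -> C a Y -> Hom_vanish X Y) &
      (forall X : perf, tri_hull (fun Y : perf => exists a, C a Y) X)].

(* Resolutions are indexed cohomologically: X sits in degrees <= 0. *)
Definition resolution X (M : lmodType A) (eps : {linear X 0 -> M}) : Prop :=
  [/\ (forall i : int, 0 < i -> forall x : X i, x = 0),
      (forall i : int, i + 1 < 0 -> forall x : X (i + 1),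
        cdiff X (i + 1) x = 0 -> exists y, x = cdiff X i y),
      (forall x : X 0, eps x = 0 <-> exists y, x = cdiff X (-1) y) &
      (forall z, exists x, eps x = z)].

Definition projective_resolution X (M : lmodType A) : Prop :=
  (forall i, projective (X i)) /\
  exists eps : {linear X 0 -> M}, resolution eps.

Definition cocycle X (N : lmodType A) (i : int) (f : X (i + 1) -> N) : Prop :=
  linear f /\ forall x, f (cdiff X i x) = 0.

Definition coboundary X (N : lmodType A) (i : int) (f : X (i + 1) -> N) : Prop :=
  exists g : {linear X (i + 1 + 1) -> N}, forall x, f x = g (cdiff X (i + 1) x).

(* Ext^m(M, N) is the cohomology of Hom(X, N) at Hom(X_{-m}, N), for X any
   projective resolution of M; here -m is written (- m - 1) + 1. *)
Definition Ext_vanish (M N : lmodType A) (m : int) : Prop :=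
  forall X, projective_resolution X M ->
  forall f : X (- m - 1 + 1) -> N, cocycle f -> coboundary f.

(* An isomorphism Ext^m(M, N) -> V of modules over a commutative ring L acting
   through a ring map L -> Z(A): a surjection from cocycles onto V whose kernel
   consists of the coboundaries. *)
Definition Ext_iso (L : pzRingType) (rho : L -> A) (M N : lmodType A) (m : int)
    (V : lmodType L) : Prop :=
  forall X, projective_resolution X M ->
  exists psi : (X (- m - 1 + 1) -> N) -> V,
    [/\ (forall r f g, cocycle f -> cocycle g ->
           psi (fun x => rho r *: f x + g x) = r *: psi f + psi g),
        (forall v, exists2 f, cocycle f & psi f = v) &
        (forall f, cocycle f -> (psi f = 0 <-> coboundary f))].

(* <M>, where M is identified with its resolutions in Perf(A); they are
   unique up to homotopy equivalence. *)
Definition module_hull (M : lmodType A) : perf -> Prop :=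
  thick_hull (fun X : perf => projective_resolution X M).

End Complexes.

Section Equivalences.
Variables (k A A' : pzRingType) (rho : k -> A) (rho' : k -> A').

(* A k-linear exact functor from Perf(A) to Perf(A'), where k acts through
   ring maps rho and rho' to the centers; exact_shift is the isomorphism
   F(X[1]) -> F(X)[1]. *)
Record exact_functor := ExactFunctor {
  fobj :> perf A -> perf A';
  fmap : forall X Y : perf A, chmap X Y -> chmap (fobj X) (fobj Y);
  fmap_eq : forall (X Y : perf A) (f g : chmap X Y),
    chmap_eq f g -> chmap_eq (fmap f) (fmap g);
  fmap_id : forall X : perf A,
    chmap_eq (fmap (chmap_id X)) (chmap_id (fobj X));
  fmap_comp : forall (X Y Z : perf A) (g : chmap Y Z) (f : chmap X Y),
    chmap_eq (fmap (chmap_comp g f)) (chmap_comp (fmap g) (fmap f));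
  fmap_linear : forall (X Y : perf A) (c : k) (f g h : chmap X Y),
    (forall i x, h i x = rho c *: f i x + g i x) ->
    homotopic (fun i => fmap h i)
      (fun i x => rho' c *: fmap f i x + fmap g i x);
  fshift : forall X : perf A, chmap (fobj (perf_shift X)) (shift (fobj X));
  fshift_iso : forall X : perf A,
    exists g : chmap (shift (fobj X)) (fobj (perf_shift X)),
      mutually_inverse (fshift X) g;
  fshift_natural : forall (X Y : perf A) (f : chmap X Y),
    chmap_eq
      (chmap_comp (fshift Y)
         (@fmap (perf_shift X) (perf_shift Y) (chmap_shift f)))
      (chmap_comp (chmap_shift (fmap f)) (fshift X));
  fexact : forall (X Y Z : perf A) (f : chmap X Y) (g : chmap Y Z)
      (h : chmap Z (shift X)),
    distinguished f g h ->
    distinguished (fmap f) (fmap g)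
      (chmap_comp (fshift X) (@fmap Z (perf_shift X) h)) }.

(* Perf(A) is equivalent to the full triangulated subcategory T of Perf(A'). *)
Definition perf_equivalent (T : perf A' -> Prop) : Prop :=
  exists F : exact_functor,
    [/\ (forall X, T (F X)),
        (forall Y, T Y -> exists X, homotopy_equivalent (F X) Y),
        (forall (X Y : perf A) (f g : chmap X Y),
          chmap_eq (fmap F f) (fmap F g) -> chmap_eq f g) &
        (forall (X Y : perf A) (g : chmap (F X) (F Y)),
          exists f : chmap X Y, chmap_eq (fmap F f) g)].

End Equivalences.

(* Main.v *)
(* Write y_t = x_1 ... x_t.  For a B-module M let F_t M be the annihilator of y_t
   in M.  Since F_t P_[1,m] = P_[1,min(t,m)], every finitely generated projective P
   is filtered by the finitely generated projectives F_t P, and the cone of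
   F_(i-1) P -> F_i P lies in <Pbar_i>; hence the <Pbar_i> generate.

   Let u_i be the product of the x_j with j <> i and e_k the idempotent of the summand
   R.  The functor G_i M = u_i e_k M from B-modules to R/(x_i)-modules preserves finitely
   generated projectives, and on these it is left adjoint to the functor
   W_i Q = Hom(u_i e_k B, Q), which is Pbar_i (x) Q for projective Q.  The unit P_[1,i] -> W_i G_i P_[1,i]
   is surjective with kernel F_(i-1) P_[1,i], so the unit X -> W_i G_i X is a
   quasi-isomorphism for X in <Pbar_i>.  By adjunction G_i is then fully faithful on
   <Pbar_i>.  It is essentially surjective onto Perf(R/(x_i)) because every W_i Q has a
   resolution of length one in <Pbar_i>, and a quasi-inverse of an exact equivalence is
   exact.  Finally G_i kills <Pbar_j> for j < i, which by naturality of the unit gives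
   Hom(<Pbar_j>, <Pbar_i>) = 0. *)

(* All functors are applied to complexes term by term. [G_i] preserves finitely generated
   projectives, so it needs no derived functor. [W_i Q] is in general not projective, so the unit
   leaves the perfect complexes and can only be asked to be a quasi-isomorphism. This suffices: for
   a bounded above complex X with projective terms, composing with a quasi-isomorphism is a
   bijection on homotopy classes of maps out of X. The same asymmetry explains the abstract
   quasi-inverse: the functor with an explicit formula goes to R/(x_i)-modules, whereas the required
   equivalence starts from Perf(R/(x_i)).

   Taking [W_i Q] to be a Hom makes it a module of functions, and the adjunction becomes evaluation
   at 1.

   The arithmetic reduces to two facts on R: the annihilator of a product of distinct variables is
   generated by the product of the remaining ones, and x_i divides r once it divides r times a
   product of other variables. Since k may have zero divisors, both are traced back to coefficients
   of polynomials. *)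
Require Import Defs.
From HB Require Import structures.
From mathcomp Require Import all_boot all_order all_algebra.
From mathcomp Require Import zify.
From mathcomp.multinomials Require Import mpoly.
From mathcomp.classical Require Import boolp.
From Stdlib Require Import Setoid Morphisms.

Set Implicit Arguments.
Unset Strict Implicit.
Unset Printing Implicit Defensive.

Import Order.TTheory GRing.Theory Num.Theory.

Local Open Scope ring_scope.

(** * Identities in abelian groups, by reflection *)

Section AbelianIdentities.
Inductive zexpr := ZVar of nat | ZZero | ZAdd of zexpr & zexpr | ZOpp of zexpr.

Fixpoint zeval (V : zmodType) (env : seq V) (e : zexpr) : V :=
  match e with
  | ZVar j => nth 0 env j
  | ZZero => 0
  | ZAdd e1 e2 => zeval env e1 + zeval env e2
  | ZOpp e1 => - zeval env e1
  end.

Fixpoint zcoef (e : zexpr) (i : nat) : int :=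
  match e with
  | ZVar j => (i == j)%:Z
  | ZZero => 0
  | ZAdd e1 e2 => zcoef e1 i + zcoef e2 i
  | ZOpp e1 => - zcoef e1 i
  end.

Lemma zevalE (V : zmodType) (env : seq V) e :
  zeval env e = \sum_(i < size env) nth 0 env i *~ zcoef e i.
Proof.
elim: e => [j||e1 IH1 e2 IH2|e IH] /=; last 1 first.
- by rewrite IH -sumrN; apply: eq_bigr => i _; rewrite mulrNz.
- have [js|sj] := ltnP j (size env); last first.
    rewrite nth_default // big1 // => i _.
    by rewrite (ltn_eqF (leq_trans (ltn_ord i) sj)) mulr0z.
  rewrite (bigD1 (Ordinal js)) //= eqxx mulr1z big1 ?addr0 // => i.
  by rewrite -val_eqE /= => /negbTE ->; rewrite mulr0z.
- by rewrite big1 // => i _; rewrite mulr0z.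
- by rewrite IH1 IH2 -big_split; apply: eq_bigr => i _; rewrite mulrzDr.
Qed.

(** Both sides are integer combinations of the atoms. The hypothesis is a closed boolean, so [abel]
    proves it by computation with [isT]. *)
Lemma zeval_eq (V : zmodType) (env : seq V) e1 e2 :
  all (fun i => zcoef e1 i == zcoef e2 i) (iota 0 (size env)) ->
  zeval env e1 = zeval env e2.
Proof.
move=> /allP e12; rewrite !zevalE; apply: eq_bigr => i _.
by rewrite (eqP (e12 i _)) // mem_iota ltn_ord.
Qed.

(** Reduces an identity that holds modulo [a = b] to one that holds in every abelian group; [zuse]
    tries both orientations. *)
Lemma zmod_using (V : zmodType) (a b x y : V) : a = b -> x + b = y + a -> x = y.
Proof. by move=> -> /addIr. Qed.

End AbelianIdentities.

(** The inner [match goal] runs a test while a term is being built. Falling back on [unify]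
    identifies atoms that are merely convertible, such as two presentations of the same
    differential. *)
Ltac zindex x env :=
  lazymatch env with
  | nil => fail
  | ?y :: ?env' =>
    match goal with
    | _ => let _ := match goal with _ => first [constr_eq x y | unify x y] end in constr:(0%N)
    | _ => let j := zindex x env' in constr:(j.+1)
    end
  end.

Ltac zinsert x env :=
  match goal with
  | _ => let _ := zindex x env in env
  | _ => constr:(x :: env)
  end.

Ltac zatoms t env :=
  lazymatch t with
  | ?a + ?b => let env' := zatoms b env in zatoms a env'
  | - ?a => zatoms a env
  | 0 => env
  | _ => zinsert t env
  end.

Ltac zreify t env :=
  lazymatch t with
  | ?a + ?b =>
    let ea := zreify a env in let eb := zreify b env in constr:(ZAdd ea eb)
  | - ?a => let ea := zreify a env in constr:(ZOpp ea)
  | 0 => constr:(ZZero)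
  | _ => let j := zindex t env in constr:(ZVar j)
  end.

Ltac abel :=
  lazymatch goal with
  | |- @eq ?T ?x ?y =>
    let env0 := zatoms x (@nil T) in
    let env := zatoms y env0 in
    let ex := zreify x env in
    let ey := zreify y env in
    exact (@zeval_eq _ env ex ey isT)
  end.
Ltac zuse h := refine (zmod_using h _) + refine (zmod_using (esym h) _).
Tactic Notation "abel" "using" constr(h) := once (zuse h; abel).
Tactic Notation "abel" "using" constr(h1) "," constr(h2) :=
  once (zuse h1; zuse h2; abel).
Tactic Notation "abel" "using" constr(h1) "," constr(h2) "," constr(h3) :=
  once (zuse h1; zuse h2; zuse h3; abel).

(** Homotopies and cocycles live in degrees written [i + 1]; this returns to an arbitrary degree. *)
Lemma int_succ (P : int -> Prop) : (forall i, P (i + 1)) -> forall i, P i.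
Proof. by move=> H i; rewrite -(subrK 1 i). Qed.

(** Hides the transport along [i - 1 + 1 = i] behind an equation, so that later constructions never
    meet a cast. *)
Lemma family_pred (T : int -> Type) (k : forall i, T (i + 1)) :
  exists k' : forall i, T i, forall i, k' (i + 1) = k i.
Proof.
exists (fun j => eq_rect _ T (k (j - 1)) j (subrK 1 j)) => i.
move: (subrK 1 (i + 1)); move: (i + 1 - 1) => j e.
have ji : j = i by apply: addIr e.
by subst j; rewrite (eq_irrelevance e erefl).
Qed.

(** Same purpose for changing one member of a dependent family: the cast occurs only inside this
    proof. *)
Lemma family_update (T : int -> Type) (h : forall i, T i) j (v : T j) :
  exists h' : forall i, T i, h' j = v /\ forall i, i != j -> h' i = h i.
Proof.
exists (fun i => match j =P i with
  | ReflectT e => eq_rect j T v i e | ReflectF _ => h i end); split.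
  by case: eqP => // e; rewrite (eq_irrelevance e erefl).
by move=> i ij; case: eqP => // e; rewrite e eqxx in ij.
Qed.

Lemma linear_ext (A : pzRingType) (U V : lmodType A) (f g : {linear U -> V}) :
  f =1 g -> f = g.
Proof.
move=> fg; have {fg} : (f : U -> V) = g by exact: functional_extensionality_dep.
case: f g => [f [[f1] [f2]]] [g [[g1] [g2]]] /= fg.
subst g.
by rewrite (Prop_irrelevance f1 g1) (Prop_irrelevance f2 g2).
Qed.

(** * Modules and homotopies *)

Section Kernel.
Variables (A : pzRingType) (U V : lmodType A) (f : {linear U -> V}).

Definition in_ker : {pred U} := fun x => f x == 0.

Fact ker_closed : submod_closed in_ker.
Proof.
split=> [|a x y /eqP fx /eqP fy]; first by apply/eqP; rewrite linear0.
by apply/eqP; rewrite linearP fx fy scaler0 addr0.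
Qed.
HB.instance Definition _ := GRing.isSubmodClosed.Build A U in_ker ker_closed.

Record kermod := KerMod { kerval :> U; ker_subproof : kerval \in in_ker }.
HB.instance Definition _ := [isSub for kerval].
HB.instance Definition _ := [Choice of kermod by <:].
HB.instance Definition _ := [SubChoice_isSubLmodule of kermod by <:].

Fact kerval_is_linear : linear kerval.
Proof. by []. Qed.
Definition kincl : {linear kermod -> U} := mklin kerval_is_linear.

Lemma kinclP x : f (kincl x) = 0.
Proof. by have /eqP := ker_subproof x. Qed.

Lemma kincl_inj : injective kincl.
Proof. exact: val_inj. Qed.

Lemma kincl_ex y : f y = 0 -> exists x, kincl x = y.
Proof. by move/eqP => fy; exists (KerMod fy). Qed.

Section Corestrict.
Variables (W : lmodType A) (g : {linear W -> U}) (fg : forall w, f (g w) = 0).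
Definition kcor_fun (w : W) : kermod := KerMod (introT eqP (fg w)).
Fact kcor_is_linear : linear kcor_fun.
Proof. by move=> a x y; apply: val_inj; rewrite /= linearP. Qed.
Definition kcor : {linear W -> kermod} := mklin kcor_is_linear.
Lemma kcorE w : kincl (kcor w) = g w. Proof. by []. Qed.
End Corestrict.

End Kernel.

Section Pairs.
Variables (A : pzRingType) (U V : lmodType A).
Fact lfst_is_linear : linear (fun p : U * V => p.1). Proof. by []. Qed.
Definition lfst : {linear (U * V)%type -> U} := mklin lfst_is_linear.
Fact lsnd_is_linear : linear (fun p : U * V => p.2). Proof. by []. Qed.
Definition lsnd : {linear (U * V)%type -> V} := mklin lsnd_is_linear.
Variables (W : lmodType A).
Fact lpair_is_linear (f : {linear W -> U}) (g : {linear W -> V}) :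
  linear (fun w => (f w, g w)).
Proof. by move=> a x y; rewrite !linearP. Qed.
Definition lpair f g : {linear W -> (U * V)%type} := mklin (lpair_is_linear f g).
Fact lcase_is_linear (f : {linear U -> W}) (g : {linear V -> W}) :
  linear (fun p : U * V => f p.1 + g p.2).
Proof. by move=> a x y; rewrite /= !linearP scalerDr addrACA. Qed.
Definition lcase f g : {linear (U * V)%type -> W} := mklin (lcase_is_linear f g).
End Pairs.

Definition lzero (A : pzRingType) (U V : lmodType A) : {linear U -> V} := \0.
Definition lid (A : pzRingType) (U : lmodType A) : {linear U -> U} := idfun.
Definition lcomp (A : pzRingType) (U V W : lmodType A) (g : {linear V -> W})
  (f : {linear U -> V}) : {linear U -> W} := g \o f.
Definition ladd (A : pzRingType) (U V : lmodType A) (f g : {linear U -> V}) :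
  {linear U -> V} := f \+ g.
Definition lopp (A : pzRingType) (U V : lmodType A) (f : {linear U -> V}) :
  {linear U -> V} := \- f.

(** [p] need not be onto, only hit the image of [f]: the pullback of [p] along [f], written as the
    kernel of [q], surjects onto [M], and a section of it yields the lift. *)
Lemma projective_lift (A : pzRingType) (M U V : lmodType A)
    (p : {linear U -> V}) (f : {linear M -> V}) :
  projective M -> (forall x, exists u, p u = f x) ->
  exists g : {linear M -> U}, forall x, p (g x) = f x.
Proof.
move=> Mp fp; pose q := lcase f (lopp p); pose K := kermod q.
have [|s sE] := Mp K M (lcomp (lfst _ _) (kincl q)) (lid M).
  move=> x; have [u uE] := fp x.
  have /kincl_ex[z zE] : q (x, u) = 0 by rewrite /= uE subrr.
  by exists z; rewrite -[LHS]/(lfst _ _ (kincl q z)) zE.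
exists (lcomp (lsnd _ _) (lcomp (kincl q) s)) => x.
have /eqP := kinclP (s x); rewrite /q /= subr_eq0 => /eqP <-.
by congr (f _); apply: sE.
Qed.

Section Homotopy.
Variable A : pzRingType.
Implicit Types X Y Z : complex A.

Lemma chmap_eq_ext X Y (f g : chmap X Y) : (forall i, f i =1 g i) -> chmap_eq f g.
Proof.
move=> fg; exists (fun i => lzero _ _) => i x.
by rewrite fg subrr /= linear0 addr0.
Qed.

Lemma chmap_eq_refl X Y (f : chmap X Y) : chmap_eq f f.
Proof. exact: chmap_eq_ext. Qed.

Lemma chmap_eq_sym X Y (f g : chmap X Y) : chmap_eq f g -> chmap_eq g f.
Proof.
move=> [h hE]; exists (fun i => lopp (h i)) => i x.
by rewrite -opprB hE /= linearN opprD.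
Qed.

Lemma chmap_eq_trans X Y (f g e : chmap X Y) :
  chmap_eq f g -> chmap_eq g e -> chmap_eq f e.
Proof.
move=> [h hE] [k kE]; exists (fun i => ladd (h i) (k i)) => i x.
by rewrite -(subrK (g (i + 1) x) (f (i + 1) x)) -addrA hE kE /= linearD addrACA.
Qed.

Lemma chmap_comp_eq X Y Z (g g' : chmap Y Z) (f f' : chmap X Y) :
  chmap_eq g g' -> chmap_eq f f' -> chmap_eq (chmap_comp g f) (chmap_comp g' f').
Proof.
move=> [h hE] [k kE].
exists (fun i => ladd (lcomp (h i) (f (i + 1))) (lcomp (g' i) (k i))) => i x /=.
rewrite -(subrK (g' (i + 1) (f (i + 1) x)) (g _ _)) hE -addrA -linearB kE.
by rewrite !linearD -!cmapP addrACA.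
Qed.

End Homotopy.

#[export] Instance chmap_eq_equiv (A : pzRingType) (X Y : complex A) :
  Equivalence (@chmap_eq A X Y).
Proof.
split; [exact: chmap_eq_refl|exact: chmap_eq_sym|exact: chmap_eq_trans].
Qed.

#[export] Hint Resolve chmap_eq_refl : core.

#[export] Instance chmap_comp_proper (A : pzRingType) (X Y Z : complex A) :
  Proper (@chmap_eq A Y Z ==> @chmap_eq A X Y ==> @chmap_eq A X Z)
    (@chmap_comp A X Y Z).
Proof. by move=> g g' gE f f' fE; apply: chmap_comp_eq. Qed.

Section Homotopy2.
Variable A : pzRingType.
Implicit Types X Y Z W : complex A.

Lemma chmap_ext X Y (f g : chmap X Y) : (forall i, f i =1 g i) -> f = g.
Proof.
case: f g => [f fP] [g gP] /= fg.
have e : f = g by apply: functional_extensionality_dep => i; apply: linear_ext; apply: fg.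
by subst g; rewrite (Prop_irrelevance fP gP).
Qed.

Lemma chmap_compA X Y Z W (h : chmap Z W) (g : chmap Y Z) (f : chmap X Y) :
  chmap_comp h (chmap_comp g f) = chmap_comp (chmap_comp h g) f.
Proof. exact: chmap_ext. Qed.
Lemma chmap_comp1 X Y (f : chmap X Y) : chmap_comp (chmap_id Y) f = f.
Proof. exact: chmap_ext. Qed.
Lemma chmap_1comp X Y (f : chmap X Y) : chmap_comp f (chmap_id X) = f.
Proof. exact: chmap_ext. Qed.

Fact chsub_subproof X Y (f g : chmap X Y) i x :
  ladd (f (i + 1)) (lopp (g (i + 1))) (cdiff X i x) =
  cdiff Y i (ladd (f i) (lopp (g i)) x).
Proof. by rewrite /= !cmapP linearB. Qed.
Definition chsub X Y (f g : chmap X Y) : chmap X Y := Chmap (chsub_subproof f g).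

Definition chzero X Y : chmap X Y :=
  @Chmap A X Y (fun i => lzero (X i) (Y i)) (fun i x => esym (linear0 (cdiff Y i))).

Lemma chmap_eq_subP X Y (f g : chmap X Y) :
  chmap_eq f g <-> nullhomotopic (chsub f g).
Proof. by split=> -[h hE]; exists h => i x; have := hE i x; rewrite /= ?subr0. Qed.

Lemma nullhomotopicP X Y (f : chmap X Y) :
  nullhomotopic f <-> chmap_eq f (chzero X Y).
Proof. by []. Qed.

Lemma chmap_comp0 X Y Z (g : chmap Y Z) :
  chmap_comp g (chzero X Y) = chzero X Z.
Proof. by apply: chmap_ext => i x; exact: (linear0 (g i)). Qed.
Lemma mutually_inverse_sym X Y (f : chmap X Y) g :
  mutually_inverse f g -> mutually_inverse g f.
Proof. by case. Qed.

Lemma he_sym X Y : homotopy_equivalent X Y -> homotopy_equivalent Y X.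
Proof. by move=> [f [g [? ?]]]; exists g, f. Qed.

Lemma mutually_inverse_comp X Y Z (f : chmap X Y) f' (g : chmap Y Z) g' :
  mutually_inverse f f' -> mutually_inverse g g' ->
  mutually_inverse (chmap_comp g f) (chmap_comp f' g').
Proof.
move=> [fK f'K] [gK g'K]; split.
  by rewrite -chmap_compA [X in chmap_comp _ X]chmap_compA gK chmap_comp1.
by rewrite -chmap_compA [X in chmap_comp _ X]chmap_compA f'K chmap_comp1.
Qed.

Lemma he_trans X Y Z :
  homotopy_equivalent X Y -> homotopy_equivalent Y Z -> homotopy_equivalent X Z.
Proof.
move=> [f [f' ff']] [g [g' gg']].
exists (chmap_comp g f), (chmap_comp f' g'); exact: mutually_inverse_comp.
Qed.

Definition acyclic X : Prop := forall i (x : X (i + 1)),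
  cdiff X (i + 1) x = 0 -> exists y, x = cdiff X i y.

Definition bounded_above X : Prop :=
  exists N : int, forall i, N < i -> forall x : X i, x = 0.

End Homotopy2.

Section NullAcyclic.
Variables (A : pzRingType) (X Y : complex A) (f : chmap X Y).
Hypotheses (Xp : forall i, projective (X i)) (Ya : acyclic Y).

Let family := forall i, {linear X (i + 1) -> Y i}.
Let homotopy_at (h : family) (j : int) := forall x : X (j + 1),
  f (j + 1) x = cdiff Y j (h j x) + h (j + 1) (cdiff X (j + 1) x).

(** One step of a descending construction: only [h j] is redefined. The implication sits inside the
    existential so that a step can be chosen for every [h] and iterated. *)
Lemma null_step (j : int) (h : family) : exists h' : family,
  (forall i, i != j -> h' i = h i) /\
  ((forall i, j < i -> homotopy_at h i) -> forall i, j <= i -> homotopy_at h' i).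
Proof.
have [hP|nhP] := pselect (forall i, j < i -> homotopy_at h i); last first.
  by exists h; split=> // hP; have := nhP hP.
pose g := ladd (f (j + 1)) (lopp (lcomp (h (j + 1)) (cdiff X (j + 1)))).
have [|v vE] := projective_lift (p := cdiff Y j) (f := g) (@Xp (j + 1)).
  move=> x; have [|y ->] := @Ya j (g x); last by exists y.
  rewrite /= linearB -cmapP (hP (j + 1)) ?ltrDl //.
  by rewrite cdiffK linear0 addr0 subrr.
have [h' [h'j h'E]] := family_update h v.
exists h'; split=> // _ i; rewrite le_eqVlt => /orP[/eqP <-|ji] x.
  by rewrite h'j vE h'E ?/g /= ?subrK // gt_eqF // ltrDl.
have ji1 : j < i + 1 by rewrite ltr_wpDr.
by rewrite !h'E ?(gt_eqF ji) ?(gt_eqF ji1) //; apply: hP.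
Qed.

Lemma null_acyclic : bounded_above X -> nullhomotopic f.
Proof.
move=> [N XN].
pose step j h := projT1 (cid (null_step j h)).
have stepP j h := projT2 (cid (null_step j h)).
pose H := fix H (m : nat) : family :=
  if m is m'.+1 then step (N - m'%:Z) (H m') else (fun i => lzero _ _).
have HP m i : N - m%:Z < i -> homotopy_at (H m) i.
  elim: m i => [|m IHm] i.
    rewrite subr0 => Ni x; rewrite /= linear0 addr0.
    by rewrite (XN _ _ x) ?linear0 // ltr_wpDr.
  move=> im; have [_ SP] := stepP (N - m%:Z) (H m).
  by apply: SP IHm _ _; move: im; lia.
have HE m d i : N - m%:Z < i -> H (m + d)%N i = H m i.
  move=> im; elim: d => [|d IHd]; first by rewrite addn0.
  rewrite addnS -IHd; have [SE _] := stepP (N - (m + d)%N%:Z) (H (m + d)%N).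
  by apply: SE; move: im; lia.
(* A degree [i <= N] is set on passing to [H (N - i + 1)] and never changed afterwards, so this
   diagonal agrees with every later stage. *)
exists (fun i => H (absz (N - i)).+1 i) => i x; rewrite subr0.
rewrite (HP (absz (N - i)).+1 i); last by lia.
congr (_ + _); set m1 := (absz _).+1; set m2 := (absz _).+1.
have [m12|m21] := leqP m1 m2.
  by rewrite -(subnKC m12) HE // /m1; lia.
by rewrite -(subnKC (ltnW m21)) HE // /m2; lia.
Qed.

End NullAcyclic.

(** * Quasi-isomorphisms *)

Section QuasiIsomorphisms.
Variable A : pzRingType.
Implicit Types X Y Z : complex A.

(** Injectivity and surjectivity on cohomology, expressed with cocycles so that no cohomology module
    has to be formed. *)
Definition qis X Y (f : chmap X Y) : Prop :=
  (forall i (x : X (i + 1)), cdiff X (i + 1) x = 0 ->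
     (exists y, f (i + 1) x = cdiff Y i y) -> exists x', x = cdiff X i x') /\
  (forall i (y : Y (i + 1)), cdiff Y (i + 1) y = 0 ->
     exists x y', cdiff X (i + 1) x = 0 /\ y = f (i + 1) x + cdiff Y i y').

Lemma chmap_eq_cocycle X Y (f g : chmap X Y) : chmap_eq f g ->
  forall i (x : X (i + 1)), cdiff X (i + 1) x = 0 ->
  exists y, f (i + 1) x = g (i + 1) x + cdiff Y i y.
Proof.
move=> [h hE] i x dx; exists (h i x).
by have := hE i x; rewrite dx linear0 addr0 => <-; abel.
Qed.

Lemma qis_cone X Y (f : chmap X Y) : qis f -> acyclic (cone f).
Proof.
move=> [fi fs] i [x y] e.
have /eqP dx : - cdiff X (i + 1 + 1) x = 0 := congr1 fst e.
have fx : f (i + 1 + 1) x + cdiff Y (i + 1) y = 0 := congr1 snd e.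
move: dx; rewrite oppr_eq0 => /eqP dx.
have [|x' xE] := fi (i + 1) x dx.
  by exists (- y); rewrite linearN; apply/eqP; rewrite -addr_eq0 fx.
have [|x'' [y' [dx'' yE]]] := fs i (y + f (i + 1) x').
  by rewrite linearD -cmapP -xE; abel using fx.
exists (x'' - x', y'); congr pair; rewrite /= linearB.
  by rewrite dx'' xE; abel.
by abel using yE.
Qed.

Lemma qis_homotopic X Y (f g : chmap X Y) : chmap_eq f g -> qis f -> qis g.
Proof.
move=> /chmap_eq_cocycle fg [fi fs]; split=> i.
  move=> x dx [y gx]; have [z fx] := fg i x dx.
  by apply: (fi _ _ dx); exists (y + z); rewrite fx gx linearD.
move=> y dy; have [x [y' [dx ->]]] := fs i y dy.
have [z ->] := fg i x dx; exists x, (z + y').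
by rewrite linearD addrA.
Qed.

Lemma qis_comp X Y Z (g : chmap Y Z) (f : chmap X Y) :
  qis g -> qis f -> qis (chmap_comp g f).
Proof.
move=> [gi gs] [fi fs]; split=> i.
  by move=> x dx gfx; apply: (fi _ _ dx); apply: gi gfx; rewrite -cmapP dx linear0.
move=> z dz; have [y [z' [dy ->]]] := gs i z dz.
have [x [y' [dx ->]]] := fs i y dy; exists x, (g i y' + z').
by split=> //=; rewrite !linearD -cmapP; abel.
Qed.

Lemma qis_cancel_left X Y Z (g : chmap Y Z) (f : chmap X Y) :
  qis g -> qis (chmap_comp g f) -> qis f.
Proof.
move=> [gi gs] [gfi gfs]; split=> i.
  move=> x dx [y fx]; apply: (gfi _ _ dx); exists (g i y).
  by rewrite /= fx cmapP.
move=> y dy; have [|x [z [dx gy]]] := gfs i (g (i + 1) y).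
  by rewrite -cmapP dy linear0.
have [||y' yE] := gi i (y - f (i + 1) x).
- by rewrite linearB dy -cmapP dx linear0 subrr.
- by exists z; rewrite linearB gy /=; abel.
by exists x, y'; rewrite -yE; split=> //; abel.
Qed.

Lemma qis_cancel_right X Y Z (g : chmap Y Z) (f : chmap X Y) :
  qis f -> qis (chmap_comp g f) -> qis g.
Proof.
move=> [fi fs] [gfi gfs]; split=> i.
  move=> y dy [z gy]; have [x [y' [dx yE]]] := fs i y dy.
  have [|x' xE] := gfi i x dx.
    exists (z - g i y'); rewrite linearB -gy yE linearD -cmapP /=.
    by abel.
  by exists (f i x' + y'); rewrite yE xE cmapP linearD.
move=> z dz; have [x [z' [dx ->]]] := gfs i z dz.
by exists (f (i + 1) x), z'; rewrite -cmapP dx linear0.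
Qed.

Lemma mutually_inverse_qis X Y (f : chmap X Y) (g : chmap Y X) :
  mutually_inverse f g -> qis f.
Proof.
move=> [/chmap_eq_cocycle gf /chmap_eq_cocycle fg]; split=> i.
  move=> x dx [y fx]; have [z] := gf i x dx.
  rewrite /= fx cmapP => e; exists (g i y - z).
  by rewrite linearB e; abel.
move=> y dy; have [z e] := fg i y dy; exists (g (i + 1) y), (- z).
by rewrite -cmapP dy linear0 linearN; split=> //; abel using e.
Qed.

Lemma acyclic_qis X Y (f : chmap X Y) : acyclic X -> acyclic Y -> qis f.
Proof.
move=> Xa Ya; split=> i; first by move=> x /Xa.
by move=> y /Ya[y' ->]; exists 0, y'; rewrite !linear0 add0r.
Qed.

Lemma qis_acyclic X Y (f : chmap X Y) : qis f -> acyclic X -> acyclic Y.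
Proof.
move=> [_ fs] Xa i y /fs[x [y' [/Xa[x' ->] ->]]].
by exists (f i x' + y'); rewrite cmapP linearD.
Qed.

Lemma acyclic_qis_source X Y (f : chmap X Y) : qis f -> acyclic Y -> acyclic X.
Proof.
move=> [fi _] Ya i x dx; apply: (fi _ _ dx); apply: Ya.
by rewrite -cmapP dx linear0.
Qed.

Lemma nullhomotopic_id_acyclic X : nullhomotopic (chmap_id X) -> acyclic X.
Proof.
move=> [h hE] i x dx; exists (h i x).
by have := hE i x; rewrite dx !linear0 !addr0.
Qed.

(* Bounded above with projective terms. *)
Definition bap X : Prop := bounded_above X /\ forall i, projective (X i).

Lemma acyclic_nullhomotopic_id X :
  bap X -> acyclic X -> nullhomotopic (chmap_id X).
Proof. by move=> [Xb Xp] Xa; apply: null_acyclic. Qed.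

Lemma shift_bounded_above X : bounded_above X -> bounded_above (shift X).
Proof. by move=> [N XN]; exists N => i Ni x; apply: XN; rewrite ltr_wpDr. Qed.

Lemma shift_bap X : bap X -> bap (shift X).
Proof. by move=> [Xb Xp]; split=> [|i]; [exact: shift_bounded_above|exact: Xp]. Qed.

(** The composite of [f] with [Z -> cone q] is null-homotopic, the cone being acyclic. The first
    component [a] of the homotopy is the lift, and the second component [b] relates [q a] to [f]. *)
Lemma qis_lift X Y Z (q : chmap Y Z) (f : chmap X Z) : bap X -> qis q ->
  exists f' : chmap X Y, chmap_eq (chmap_comp q f') f.
Proof.
move=> [Xb Xp] /qis_cone Ca.
have [h hE] := null_acyclic (chmap_comp (cone_in q) f) Xp Ca Xb.
pose a i := lcomp (lfst _ _) (h i); pose b i := lcomp (lsnd _ _) (h i).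
have aE i x : cdiff Y (i + 1) (a i x) = a (i + 1) (cdiff X (i + 1) x).
  by have /(congr1 fst) /= e := hE i x; abel using e.
have bE i x : f (i + 1) x =
    q (i + 1) (a i x) + cdiff Z i (b i x) + b (i + 1) (cdiff X (i + 1) x).
  by have /(congr1 snd) /= e := hE i x; abel using e.
have [f' f'E] := family_pred (T := fun j => {linear X j -> Y j}) a.
have f'P : forall i x, f' (i + 1) (cdiff X i x) = cdiff Y i (f' i x).
  by apply: int_succ => i x; rewrite !f'E aE.
exists (Chmap f'P), (fun i => lopp (b i)) => i x.
by rewrite bE /= f'E linearN; abel.
Qed.

(** A null homotopy [b] of [q f] makes [(f, -b)] a chain map from [shift X] to the acyclic [cone q].
    Contracting that map and taking first components, up to sign, contracts [f]. *)
Lemma qis_null X Y Z (q : chmap Y Z) (f : chmap X Y) : bap X -> qis q ->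
  nullhomotopic (chmap_comp q f) -> nullhomotopic f.
Proof.
move=> Xbap /qis_cone Ca [b bE]; have [Sb Sp] := shift_bap Xbap.
pose p i : {linear shift X i -> cone q i} := lpair (f (i + 1)) (lopp (b i)).
have pP i x : p (i + 1) (cdiff (shift X) i x) = cdiff (cone q) i (p i x).
  congr pair; first by rewrite /= linearN cmapP.
  have /= e := bE i x; rewrite /= (linearN (b _)) (linearN (cdiff _ _)).
  by abel using e.
have [h hE] := null_acyclic (Chmap pP) Sp Ca Sb.
have [k kE] := family_pred (T := fun j => {linear X (j + 1) -> Y j})
  (fun i => lopp (lcomp (lfst _ _) (h i))).
exists k; apply: int_succ => i x.
rewrite !kE; have /(congr1 fst) /= e := hE i x.
rewrite (linearN (h (i + 1))) /= in e.
by rewrite /= (linearN (cdiff _ _)); abel using e.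
Qed.

Lemma qis_inj X Y Z (q : chmap Y Z) (f g : chmap X Y) : bap X -> qis q ->
  chmap_eq (chmap_comp q f) (chmap_comp q g) -> chmap_eq f g.
Proof.
move=> Xbap qq /chmap_eq_subP e; apply/chmap_eq_subP.
apply: (qis_null Xbap qq); have -> // :
  chmap_comp q (chsub f g) = chsub (chmap_comp q f) (chmap_comp q g).
by apply: chmap_ext => i x; rewrite /= (linearB (q i)).
Qed.

Lemma qis_inverse X Y (f : chmap X Y) : bap X -> bap Y -> qis f ->
  exists g, mutually_inverse f g.
Proof.
move=> Xb Yb fq; have [g gE] := qis_lift (chmap_id Y) Yb fq.
exists g; split=> //; apply: (qis_inj Xb fq).
by rewrite chmap_compA gE chmap_comp1 chmap_1comp.
Qed.

(** The homotopy [k] is the off-diagonal entry of the map of cones. The clause on quasi-isomorphisms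
    is the five lemma for the two long exact sequences, done by chasing elements. *)
Lemma cone_map_of X Y X' Y' (f : chmap X Y) (f' : chmap X' Y')
    (a : chmap X X') (b : chmap Y Y') (k : forall i, {linear X (i + 1) -> Y' i}) :
  (forall i x, b (i + 1) (f (i + 1) x) - f' (i + 1) (a (i + 1) x) =
     cdiff Y' i (k i x) + k (i + 1) (cdiff X (i + 1) x)) ->
  exists m : chmap (cone f) (cone f'),
    (forall i p, m i p = (a (i + 1) p.1, k i p.1 + b i p.2)) /\
    (qis a -> qis b -> qis m).
Proof.
move=> kE.
have {}kE i x : b (i + 1) (f (i + 1) x) =
    f' (i + 1) (a (i + 1) x) + cdiff Y' i (k i x) + k (i + 1) (cdiff X (i + 1) x).
  by rewrite -addrA -kE /= addrC subrK.
pose m i : {linear cone f i -> cone f' i} :=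
  lpair (lcomp (a (i + 1)) (lfst _ _)) (lcase (k i) (b i)).
have mP i x : m (i + 1) (cdiff (cone f) i x) = cdiff (cone f') i (m i x).
  case: x => x y; congr pair; rewrite /= !linearN ?cmapP //.
  by rewrite !linearD cmapP kE; abel.
exists (Chmap mP); split=> [//|].
move=> [ai as_] [bi bs]; split=> i.
- move=> [x y] e [[x' y'] e'].
  have /eqP := congr1 fst e; rewrite /= oppr_eq0 => /eqP dx.
  have fxy : f (i + 1 + 1) x + cdiff Y (i + 1) y = 0 := congr1 snd e.
  have ax : a (i + 1 + 1) x = - cdiff X' (i + 1) x' := congr1 fst e'.
  have by_ : k (i + 1) x + b (i + 1) y = f' (i + 1) x' + cdiff Y' i y' :=
    congr1 snd e'.
  (* Injectivity: [x] bounds some [x1], but [x' + a x1] is a cocycle that need not vanish in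
     cohomology. Subtracting a cocycle [x2] of [X] that represents it makes the second component
     bound as well. *)
  have [|x1 xE] := ai (i + 1) x dx; first by exists (- x'); rewrite linearN.
  have [|x2 [x3 [dx2 x2E]]] := as_ i (x' + a (i + 1) x1).
    by rewrite linearD -cmapP -xE ax; abel.
  have [||y2 y2E] := bi i (y + f (i + 1) x1 - f (i + 1) x2).
  - by rewrite linearB linearD -!cmapP dx2 -xE linear0; abel using fxy.
  - exists (y' + f' i x3 + k i x1 - k i x2).
    have e2 : f' (i + 1) x' + f' (i + 1) (a (i + 1) x1) =
        f' (i + 1) (a (i + 1) x2) + cdiff Y' i (f' i x3).
      by rewrite -linearD x2E linearD cmapP.
    have e3 := kE i x1; rewrite -xE in e3.
    have e4 := kE i x2; rewrite dx2 linear0 in e4.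
    rewrite !(linearB (cdiff _ _)) !(linearD (cdiff _ _)) (linearB (b _)).
    by rewrite (linearD (b _)) e3 e4; abel using by_, e2.
  exists (x2 - x1, y2); congr pair => /=.
    by rewrite linearB dx2 sub0r opprK.
  by rewrite linearB -y2E; abel.
- move=> [x' y'] e.
  have /eqP := congr1 fst e; rewrite /= oppr_eq0 => /eqP dx'.
  have fxy : f' (i + 1 + 1) x' + cdiff Y' (i + 1) y' = 0 := congr1 snd e.
  (* Surjectivity: [x'] comes from a cocycle [x], and [f x] bounds because its image in [Y'] does.
     The remaining discrepancy is a cocycle of [Y'], which comes from [Y] up to a coboundary. *)
  have [x [x1 [dx x'E]]] := as_ (i + 1) x' dx'.
  have f'x : f' (i + 1 + 1) (a (i + 1 + 1) x) =
      - cdiff Y' (i + 1) (y' + f' (i + 1) x1).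
    rewrite linearD -(cmapP f'); move: fxy; rewrite x'E linearD => fxy.
    by abel using fxy.
  have [||y0 fx] := bi (i + 1) (f (i + 1 + 1) x).
  - by rewrite -cmapP dx linear0.
  - exists (k (i + 1) x - (y' + f' (i + 1) x1)).
    by rewrite kE dx f'x linear0 linearB; abel.
  have [|y1 [y1' [dy1 wE]]] :=
      bs i (y' + b (i + 1) y0 - k (i + 1) x + f' (i + 1) x1).
    have e1 := kE (i + 1) x; rewrite dx linear0 f'x fx cmapP in e1.
    rewrite (linearD (cdiff _ _)) in e1.
    rewrite !(linearD (cdiff _ _)) (linearN (cdiff _ _)).
    by abel using e1.
  exists (x, y1 - y0), (- x1, y1'); split.
    by congr pair; rewrite /= ?dx ?oppr0 // linearB fx dy1 sub0r subrr.
  congr pair; first by rewrite /= linearN opprK x'E.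
  by rewrite /= linearN linearB; abel using wE.
Qed.

Lemma cone_map X Y X' Y' (f : chmap X Y) (f' : chmap X' Y')
    (a : chmap X X') (b : chmap Y Y') :
  chmap_eq (chmap_comp b f) (chmap_comp f' a) ->
  exists m : chmap (cone f) (cone f'),
    [/\ chmap_comp m (cone_in f) = chmap_comp (cone_in f') b,
        chmap_comp (cone_out f') m = chmap_comp (chmap_shift a) (cone_out f) &
        qis a -> qis b -> qis m].
Proof.
move=> [k kE]; have [m [mE mq]] := cone_map_of kE; exists m; split=> //.
  by apply: chmap_ext => i y; rewrite /= mE /= !linear0 add0r.
by apply: chmap_ext => i y; rewrite /= mE.
Qed.

End QuasiIsomorphisms.

(** * Finitely generated projectives and perfect complexes *)

Section Modules.
Variable A : pzRingType.
Implicit Types M N U V : lmodType A.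

Definition fgproj M : Prop := projective M /\ finitely_generated M.

Definition retract M N : Prop :=
  exists (s : {linear M -> N}) (r : {linear N -> M}), forall x, r (s x) = x.

Lemma projective_retract M N : retract M N -> projective N -> projective M.
Proof.
move=> [s [r rs]] Np U V p f pS.
have [g gE] := Np U V p (lcomp f r) pS.
by exists (lcomp g s) => x; rewrite /= gE /= rs.
Qed.

Lemma finitely_generated_surj M N (r : {linear N -> M}) :
  (forall x, exists y, r y = x) -> finitely_generated N -> finitely_generated M.
Proof.
move=> rS [n [g gE]]; exists n, (fun i => r (g i)) => x.
have [y <-] := rS x; have [a {1}->] := gE y; exists a.
by rewrite linear_sum; apply: eq_bigr => i _; rewrite linearZ.
Qed.

Lemma fgproj_retract M N : retract M N -> fgproj N -> fgproj M.
Proof.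
move=> MN [Np Nf]; split; first exact: projective_retract MN Np.
have [s [r rs]] := MN; apply: (finitely_generated_surj (r := r)) Nf => x.
by exists (s x).
Qed.

Lemma fgproj_pair U V : fgproj U -> fgproj V -> fgproj (U * V)%type.
Proof.
move=> [Up [m [g gE]]] [Vp [n [h hE]]]; split.
  move=> M N p f pS.
  have [a aE] := Up M N p (lcomp f (lpair (lid U) (lzero U V))) pS.
  have [b bE] := Vp M N p (lcomp f (lpair (lzero V U) (lid V))) pS.
  exists (lcase a b) => -[x y]; rewrite /= linearD aE bE /= -linearD.
  by congr (f _); congr pair; rewrite /= ?addr0 ?add0r.
exists (m + n)%N, (fun i => match split i with inl a => (g a, 0) | inr b => (0, h b) end).
move=> [x y]; have [a xE] := gE x; have [b yE] := hE y.
exists (fun i => match split i with inl c => a c | inr c => b c end).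
rewrite big_split_ord /=.
rewrite (eq_bigr (fun i => (a i *: g i, 0 : V))); last first.
  by move=> i _; rewrite (unsplitK (inl i)); congr pair; rewrite /= ?scaler0.
rewrite [X in _ + X](eq_bigr (fun i => (0 : U, b i *: h i))); last first.
  by move=> i _; rewrite (unsplitK (inr i)); congr pair; rewrite /= ?scaler0.
have -> : \sum_(i < m) (a i *: g i, 0 : V) = (x, 0).
  rewrite xE; elim/big_rec2: _ => // i u _ _ ->.
  by congr pair; rewrite /= ?addr0.
have -> : \sum_(i < n) (0 : U, b i *: h i) = (0, y).
  rewrite yE; elim/big_rec2: _ => // i u _ _ ->.
  by congr pair; rewrite /= ?addr0.
by congr pair; rewrite /= ?addr0 ?add0r.
Qed.

Definition triv : lmodType A := 'rV[A]_0.

Lemma triv_eq0 (x : triv) : x = 0.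
Proof. exact: thinmx0. Qed.

Lemma fgproj_triv : fgproj triv.
Proof.
split=> [U V p f pS|]; first by exists (lzero _ _) => x; rewrite (triv_eq0 x) !linear0.
by exists 0%N, (fun _ => 0) => x; exists (fun _ => 0); rewrite big_ord0 (triv_eq0 x).
Qed.

Lemma retract_zero M N : (forall x : M, x = 0) -> retract M N.
Proof.
by move=> M0; exists (lzero M N), (lzero N M) => x; rewrite [RHS]M0 [LHS]M0.
Qed.

Fact lscale_is_linear M (x : M) : linear (fun a : A^o => (a : A) *: x).
Proof. by move=> a b c; rewrite scalerDl scalerA. Qed.
Definition lscale M (x : M) : {linear A^o -> M} := mklin (lscale_is_linear x).

Lemma fgproj_regular : fgproj A^o.
Proof.
split=> [U V p f pS|].
  have [u uE] := pS (f 1); exists (lscale u) => x /=.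
  by rewrite linearZ_LR uE -linearZ_LR; congr (f _); exact: mulr1.
exists 1%N, (fun _ => 1) => x; exists (fun _ => x).
by rewrite big_ord1; apply/esym/mulr1.
Qed.

(* The surjection onto [P] is built from the class [C], one generator at a
   time; projectivity of [P] splits it. *)
Lemma fgproj_ind (C : lmodType A -> Prop) :
  (forall M N, retract M N -> C N -> C M) ->
  (forall M N, C M -> C N -> C (M * N)%type) -> C triv -> C A^o ->
  forall P, fgproj P -> C P.
Proof.
move=> Cr Cp C0 C1 P [Pp [n [g gE]]].
suff [N [CN [q qS]]] : exists N, C N /\ exists q : {linear N -> P},
    forall x, exists y, q y = x.
  have [s sE] := Pp N P q (lid P) qS; apply: Cr CN.
  by exists s, q => x; rewrite sE.
suff /(_ n (leqnn n))[N [CN [q qP]]] : forall m, (m <= n)%N ->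
    exists N, C N /\ exists q : {linear N -> P},
    forall a : 'I_n -> A, exists y, q y = \sum_(i < n | (i < m)%N) a i *: g i.
  exists N; split=> //; exists q => x; have [a ->] := gE x.
  have [y yE] := qP a; exists y; rewrite yE; apply: eq_bigl => i; exact: ltn_ord.
elim=> [_|m IHm mn].
  exists triv; split=> //; exists (lzero _ _) => a; exists 0.
  by rewrite big_pred0 // => i; rewrite ltn0.
have [N [CN [q qP]]] := IHm (ltnW mn).
exists (N * A^o)%type; split; first exact: Cp.
exists (lcase q (lscale (g (Ordinal mn)))) => a.
have [y yE] := qP a; exists (y, a (Ordinal mn)).
rewrite -[LHS]/(q y + a (Ordinal mn) *: g (Ordinal mn)) yE [RHS](bigD1 (Ordinal mn)) //= [RHS]addrC; congr (_ + _).
by apply: eq_bigl => i; rewrite ltnS ltn_neqAle andbC -val_eqE.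
Qed.

End Modules.

(** * Complexes concentrated in one degree *)

Section Concentrated.
Variable A : pzRingType.
Implicit Types (X Y : complex A) (U V : lmodType A).

(** Matching on [i] lets degree 0 compute to [U]. For [conc_at], in a variable degree, the term is
    only available through the isomorphism [conc_at_iso]. *)
Definition conc_obj U (i : int) : lmodType A := if i is Posz 0 then U else triv A.
Definition conc U : complex A :=
  @Complex A (conc_obj U) (fun i => lzero _ _) (fun i x => erefl).

Definition conc_lin U V (u : {linear U -> V}) i : {linear conc U i -> conc V i} :=
  match i return {linear conc_obj U i -> conc_obj V i} with
  | Posz 0 => u | _ => lzero _ _ end.
Fact conc_map_subproof U V (u : {linear U -> V}) i x :
  conc_lin u (i + 1) (cdiff (conc U) i x) = cdiff (conc V) i (conc_lin u i x).
Proof. by rewrite [LHS]linear0. Qed.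
Definition conc_map U V (u : {linear U -> V}) : chmap (conc U) (conc V) :=
  Chmap (conc_map_subproof u).

Lemma conc_eq0 U i (x : conc U i) : i != 0 -> x = 0.
Proof. by case: i x => [[|i]|i] // x _; exact: triv_eq0. Qed.

Lemma bijective_qis X Y (f : chmap X Y) :
  (forall i x, f i x = 0 -> x = 0) -> (forall i y, exists x, f i x = y) -> qis f.
Proof.
move=> fI fS; split=> i.
  move=> x dx [y fx]; have [x' x'E] := fS i y; exists x'.
  by apply/eqP; rewrite -subr_eq0; apply/eqP/fI; rewrite linearB fx -x'E cmapP subrr.
move=> y dy; have [x xE] := fS _ y; exists x, 0.
rewrite linear0 addr0 xE; split=> //.
by apply: fI; rewrite cmapP xE.
Qed.

Definition concentrated j X : Prop := forall i, i != j -> forall x : X i, x = 0.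

Lemma concentrated_chmap j X Y (a : {linear X j -> Y j}) :
  concentrated j X -> concentrated j Y -> exists f : chmap X Y, f j = a.
Proof.
move=> Xj Yj.
have [f [fj fE]] := family_update (T := fun i => {linear X i -> Y i})
  (fun i => lzero _ _) a.
have fP i x : f (i + 1) (cdiff X i x) = cdiff Y i (f i x).
  have [ij|ij] := eqVneq i j; last by rewrite (Xj i ij x) !linear0.
  have i1j : i + 1 != j by rewrite -ij -subr_eq0 addrAC subrr.
  by rewrite (Yj _ i1j (f _ _)) (Yj _ i1j (cdiff _ _ _)).
by exists (Chmap fP).
Qed.

Lemma concentrated_qis j X Y (a : {linear X j -> Y j}) :
  concentrated j X -> concentrated j Y ->
  (forall x, a x = 0 -> x = 0) -> (forall y, exists x, a x = y) ->
  exists f : chmap X Y, f j = a /\ qis f.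
Proof.
move=> Xj Yj aI aS; have [f fj] := concentrated_chmap a Xj Yj.
exists f; split=> //; apply: bijective_qis => i.
  have [->|ij x _] := eqVneq i j; [by rewrite fj|exact: Xj].
have [->|ij y] := eqVneq i j; first by rewrite fj.
by exists 0; rewrite linear0 (Yj i ij y).
Qed.

Definition conc_at (j : int) U : complex A :=
  @Complex A (fun i => if i == j then U else triv A) (fun i => lzero _ _)
    (fun i x => erefl).

Lemma conc_at_concentrated j U : concentrated j (conc_at j U).
Proof. by move=> i /negbTE ij; rewrite /= ij => x; exact: triv_eq0. Qed.

Lemma conc_at_iso j U : exists (a : {linear conc_at j U j -> U})
    (b : {linear U -> conc_at j U j}), cancel a b /\ cancel b a.
Proof. by rewrite /= eqxx; exists (lid U), (lid U). Qed.

End Concentrated.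

Section Perfect.
Variable A : pzRingType.
Implicit Types X Y Z : complex A.

Lemma perfect_bap X : perfect X -> bap X.
Proof.
move=> [[N XN] XP]; split=> [|i]; last by case: (XP i).
by exists N%:Z => i Ni x; apply: XN; lia.
Qed.

Lemma perfect_cone X Y (f : chmap X Y) : perfect X -> perfect Y -> perfect (cone f).
Proof.
move=> [[N XN] XP] [[M YM] YP]; split=> [|i]; last first.
  exact: fgproj_pair (XP (i + 1)) (YP i).
exists (N + M).+1 => i iNM [x y]; congr pair; [apply: XN|apply: YM]; lia.
Qed.

Lemma perfect_conc (U : lmodType A) : fgproj U -> perfect (conc U).
Proof.
move=> Up; split=> [|i]; first by exists 0%N => i i0 x; apply: conc_eq0; lia.
by case: i => [[|i]|i] //; exact: fgproj_triv.
Qed.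

Lemma perfect_conc_at j (U : lmodType A) : fgproj U -> perfect (conc_at j U).
Proof.
move=> Up; split=> [|i]; last by rewrite /=; case: ifP => // _; exact: fgproj_triv.
by exists (absz j) => i ij x; apply: conc_at_concentrated; apply/eqP; lia.
Qed.

End Perfect.

(** * Triangulated subcategories of perfect complexes *)

Section Cones.
Variable A : pzRingType.
Implicit Types X Y Z : complex A.

Lemma cone_distinguished X Y (f : chmap X Y) :
  distinguished f (cone_in f) (cone_out f).
Proof.
exists (chmap_id _), (chmap_id _).
by split; rewrite ?chmap_comp1 ?chmap_1comp //; split; rewrite chmap_comp1.
Qed.

(** Rotation of the triangle of [f]. It turns closure under cones into two out of three, although
    [triangulated] only mentions the third vertex of a triangle. *)
Lemma rotated_cone X Y (f : chmap X Y) :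
  exists m : chmap (cone (cone_out f)) (shift Y), qis m.
Proof.
pose m i : {linear cone (cone_out f) i -> shift Y i} :=
  lcase (lsnd _ _) (f (i + 1)).
have mP i x : m (i + 1) (cdiff _ i x) = cdiff (shift Y) i (m i x).
  case: x => [[x' y] x]; rewrite /= (linearB (f _)) (linearD (cdiff _ _)) cmapP.
  by abel.
exists (Chmap mP); split=> i.
  move=> [[x' y] x] e [w mw].
  have dx : x' - cdiff X (i + 1 + 1) x = 0 by have /(congr1 snd) := e.
  have yx : y + f (i + 1 + 1) x = - cdiff Y (i + 1) w by [].
  exists ((x, w), 0); congr pair; last by rewrite /= linear0; abel.
  by congr pair; rewrite /=; [abel using dx|abel using yx].
move=> y /= dy; exists ((0, y), 0), 0; split; last first.
  by rewrite /= !linear0; abel.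
have {}dy : cdiff Y (i + 1 + 1) y = 0 by abel using dy.
congr pair; last by rewrite /= linear0; abel.
by congr pair; rewrite /= ?dy !linear0; abel.
Qed.

Lemma ses_qis X Y Z (f : chmap X Y) (g : chmap Y Z) :
  (forall i x, f i x = 0 -> x = 0) ->
  (forall i x, g i (f i x) = 0) ->
  (forall i y, g i y = 0 -> exists x, y = f i x) ->
  (forall i z, exists y, z = g i y) ->
  exists m : chmap (cone f) Z, qis m.
Proof.
move=> f0 gf ex gS.
pose m i : {linear cone f i -> Z i} := lcomp (g i) (lsnd _ _).
have mP i x : m (i + 1) (cdiff _ i x) = cdiff Z i (m i x).
  by case: x => x y; rewrite /= linearD gf add0r cmapP.
exists (Chmap mP); split=> i.
  move=> [x y] e [z gy].
  have fx : f (i + 1 + 1) x + cdiff Y (i + 1) y = 0 := congr1 snd e.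
  have [y1 zE] := gS i z.
  have [|x1 x1E] := ex _ (y - cdiff Y i y1).
    by rewrite linearB cmapP -zE -gy /= subrr.
  exists (x1, y1); congr pair; last by rewrite /= -x1E; abel.
  apply/eqP; rewrite -subr_eq0; apply/eqP/f0.
  rewrite /= (linearB (f _)) (linearN (f _)) cmapP -x1E (linearB (cdiff _ _)).
  by rewrite cdiffK; abel using fx.
move=> z dz; have [y zE] := gS _ z.
have [|x xE] := ex _ (cdiff Y (i + 1) y); first by rewrite cmapP -zE.
exists (- x, y), 0; split; last by rewrite linear0 addr0.
congr pair; last by rewrite /= xE (linearN (f _)); abel.
apply: f0; rewrite /= (linearN (cdiff _ _)) opprK cmapP -xE.
by rewrite cdiffK.
Qed.

End Cones.

Section Triangulated.
Variables (A : pzRingType) (T : perf A -> Prop).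
Implicit Types X Y Z : complex A.

(** Membership for an unbundled complex; by proof irrelevance the choice of [p] is immaterial. *)
Definition inT X : Prop := exists p : perfect X, T (Perf p).

Lemma inT_perf (X : perf A) : inT X <-> T X.
Proof.
case: X => X p /=; split=> [[q Tq]|TX]; last by exists p.
by rewrite (Prop_irrelevance p q).
Qed.

Hypothesis HT : triangulated T.

Lemma inT_acyclic X : perfect X -> acyclic X -> inT X.
Proof.
move=> Xp Xa; exists Xp; have [H _ _ _] := HT; apply: H.
exact: acyclic_nullhomotopic_id (perfect_bap Xp) Xa.
Qed.

Lemma inT_he X Y : perfect Y -> homotopy_equivalent X Y -> inT X -> inT Y.
Proof. by move=> Yp XY [Xp TX]; exists Yp; have [_ H _ _] := HT; apply: H TX. Qed.

Lemma inT_qis X Y (f : chmap X Y) : perfect Y -> qis f -> inT X -> inT Y.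
Proof.
move=> Yp fq TX; apply: (inT_he Yp _ TX); have [Xp _] := TX.
have [g fg] := qis_inverse (perfect_bap Xp) (perfect_bap Yp) fq.
by exists f, g.
Qed.

Lemma inT_qis_source X Y (f : chmap X Y) : perfect X -> qis f -> inT Y -> inT X.
Proof.
move=> Xp fq TY; apply: (inT_he Xp _ TY); have [Yp _] := TY.
have [g fg] := qis_inverse (perfect_bap Xp) (perfect_bap Yp) fq.
by exists g, f; apply: mutually_inverse_sym.
Qed.

Lemma inT_shift X : perfect X -> inT (shift X) <-> inT X.
Proof.
move=> Xp; have [_ _ H _] := HT; have {}H := H (Perf Xp).
split=> -[p Tp]; [exists Xp|exists (shift_perfect Xp)]; move: H.
  by rewrite /perf_shift /= (Prop_irrelevance (shift_perfect _) p) => -[H _]; apply: H.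
by rewrite (Prop_irrelevance Xp p) => -[_ H]; apply: H.
Qed.

Lemma inT_cone X Y (f : chmap X Y) : inT X -> inT Y -> inT (cone f).
Proof.
move=> [Xp TX] [Yp TY]; exists (perfect_cone f Xp Yp); have [_ _ _ H] := HT.
exact: (H (Perf Xp) (Perf Yp) (Perf _) f _ _ (cone_distinguished f)).
Qed.

Lemma inT_target X Y (f : chmap X Y) :
  perfect Y -> inT X -> inT (cone f) -> inT Y.
Proof.
move=> Yp TX TC; apply/(inT_shift Yp).
have [m mq] := rotated_cone f.
apply: (inT_qis (shift_perfect Yp) mq); apply: inT_cone TC _.
by apply/inT_shift => //; case: TX.
Qed.

Section ShortExact.
Variables (X Y Z : complex A) (f : chmap X Y) (g : chmap Y Z).
Hypotheses (f0 : forall i x, f i x = 0 -> x = 0)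
  (gf : forall i x, g i (f i x) = 0)
  (ex : forall i y, g i y = 0 -> exists x, y = f i x)
  (gS : forall i z, exists y, z = g i y).

Lemma inT_extension : perfect Y -> inT X -> inT Z -> inT Y.
Proof.
move=> Yp TX TZ; have [m mq] := ses_qis f0 gf ex gS.
apply: (inT_target (f := f) Yp TX); apply: (inT_qis_source _ mq TZ).
by apply: perfect_cone => //; case: TX.
Qed.

End ShortExact.

Lemma inT_conc_at (U : lmodType A) : fgproj U -> inT (conc U) ->
  forall j, inT (conc_at j U).
Proof.
move=> Up TU.
have step j : inT (conc_at (j + 1) U) <-> inT (conc_at j U).
  have [a [b [aK bK]]] := conc_at_iso j U.
  have [a' [b' [a'K b'K]]] := conc_at_iso (j + 1) U.
  have Pc i := perfect_conc_at i Up.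
  have [|||x|f [_ fq]] := concentrated_qis (j := j)
    (X := shift (conc_at (j + 1) U)) (Y := conc_at j U) (a := lcomp b a').
  - by move=> i ij; apply: conc_at_concentrated; rewrite (inj_eq (addIr 1)).
  - exact: conc_at_concentrated.
  - move=> x /= /(congr1 a); rewrite bK linear0 => /(congr1 b').
    by rewrite a'K linear0.
  - by exists (b' (a x)); rewrite /= b'K aK.
  split=> H.
    by apply: (inT_qis (Pc j) fq); apply/(inT_shift (Pc _)).
  by apply/(inT_shift (Pc _)); apply: (inT_qis_source _ fq H); apply: shift_perfect.
have T0 : inT (conc_at 0 U).
  have [a [b [aK bK]]] := conc_at_iso 0 U.
  have [|||x|f [_ fq]] := concentrated_qis (j := 0) (X := conc U)
    (Y := conc_at 0 U) (a := b).
  - by move=> i i0 x; apply: conc_eq0.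
  - exact: conc_at_concentrated.
  - by move=> x /(congr1 a); rewrite bK linear0.
  - by exists (a x); rewrite aK.
  exact: (inT_qis (perfect_conc_at 0 Up) fq TU).
elim/int_ind => [//|n IH|n IH].
  by rewrite (_ : n.+1%:Z = n%:Z + 1); [apply/step|lia].
by apply/step; rewrite (_ : - n.+1%:Z + 1 = - n%:Z); last lia.
Qed.

(** * Removing one term of a complex *)

Section Truncation.
Variables (X : complex A) (j : int).

(** The term of degree [j] is replaced by zero by passing to the kernel of [keep] in every degree.
    The case distinction thus stays in the maps and does not enter the types. *)
Let keep i : {linear X i -> X i} := if i == j then lid _ else lzero _ _.
Let drop i : {linear X i -> X i} := if i == j then lzero _ _ else lid _.

Let keep_drop i x : keep i (drop i x) = 0.
Proof. by rewrite /keep /drop; case: eqP. Qed.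
Let drop_ker i x : keep i x = 0 -> drop i x = x.
Proof. by rewrite /keep /drop; case: eqP. Qed.

Let trunc_obj i : lmodType A := kermod (keep i).
Let trunc_diff i : {linear trunc_obj i -> trunc_obj (i + 1)} :=
  kcor (g := lcomp (drop (i + 1)) (lcomp (cdiff X i) (kincl (keep i))))
    (fun x => keep_drop _).

Fact trunc_subproof i x : trunc_diff (i + 1) (trunc_diff i x) = 0.
Proof.
apply: val_inj; rewrite /= /drop.
by case: (eqVneq (i + 1) j) => _ /=; rewrite ?linear0 ?cdiffK ?linear0.
Qed.
Definition trunc : complex A := Complex trunc_subproof.

Lemma trunc_retract i : retract (trunc i) (X i).
Proof.
exists (kincl (keep i)), (kcor (g := drop i) (@keep_drop i)) => x.
by apply: kincl_inj; rewrite kcorE drop_ker // kinclP.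
Qed.

Lemma perfect_trunc : perfect X -> perfect trunc.
Proof.
move=> [[N XN] XP]; split=> [|i]; last exact: fgproj_retract (trunc_retract i) (XP i).
by exists N => i Ni x; apply: val_inj; apply: XN.
Qed.

Lemma trunc_eq0 (x : trunc j) : x = 0.
Proof.
have keepj y : keep j y = y by rewrite /keep eqxx.
by apply: kincl_inj; rewrite -[LHS]keepj kinclP linear0.
Qed.

Lemma trunc_zero i : (forall x : X i, x = 0) -> forall x : trunc i, x = 0.
Proof. by move=> X0 x; apply: val_inj; apply: X0. Qed.

(** When [j] bounds the degrees of [X] from above, [X j] placed in degree [j] is a subcomplex and
    [trunc] is the quotient. *)
Lemma inT_trunc : perfect X -> (forall i, j < i -> forall x : X i, x = 0) ->
  inT (conc_at j (X j)) -> inT trunc -> inT X.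
Proof.
move=> Xp Xj Tj Tt; have [a [b [aK bK]]] := conc_at_iso j (X j).
have [f [fj fE]] := family_update
  (T := fun i => {linear conc_at j (X j) i -> X i}) (fun i => lzero _ _) a.
have fP i x : f (i + 1) (cdiff (conc_at j (X j)) i x) = cdiff X i (f i x).
  rewrite [LHS]linear0; have [ij|ij] := eqVneq i j.
    by rewrite (Xj (i + 1) _ (cdiff _ _ _)) // ij ltrDl.
  by rewrite fE // linear0.
pose g i : {linear X i -> trunc i} := kcor (g := drop i) (@keep_drop i).
have gP i x : g (i + 1) (cdiff X i x) = cdiff trunc i (g i x).
  apply: val_inj; rewrite -[LHS]/(drop (i + 1) (cdiff X i x)).
  rewrite -[RHS]/(drop (i + 1) (cdiff X i (drop i x))).
  have [ij|ij] := eqVneq i j; last by rewrite {3}/drop (negbTE ij).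
  by rewrite (Xj (i + 1) _ (cdiff _ _ x)) ?(Xj (i + 1) _ (cdiff _ _ (drop i x))) ?ij ?ltrDl.
apply: (inT_extension (f := Chmap fP) (g := Chmap gP)) Tj Tt => //= i.
- have [->|/eqP ij x _] := pselect (i = j); last exact: conc_at_concentrated.
  by move=> x; rewrite fj => /(congr1 b); rewrite aK linear0.
- have [->|/eqP ij x] := pselect (i = j); first by move=> x; apply: trunc_eq0.
  by rewrite fE //; exact: (linear0 (g i)).
- have [->|/eqP ij x] := pselect (i = j); first by move=> x _; exists (b x); rewrite fj bK.
  have drop_id : drop i x = x by rewrite /drop (negbTE ij).
  move=> /(congr1 (kincl _)); rewrite kcorE drop_id => ->.
  by exists 0; rewrite !linear0.
- move=> z; exists (kincl _ z); apply: kincl_inj.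
  by rewrite kcorE drop_ker // kinclP.
Qed.

End Truncation.

Lemma triangulated_all : (forall P, fgproj P -> inT (conc P)) -> forall X : perf A, T X.
Proof.
move=> TP X; apply/inT_perf; have Xp := perfP X; have [[N XN] _] := Xp.
(* Induction on the width [w] of an interval []j - w, j]] outside which [Y] vanishes, removing the
   top term. The interval from [-N] to [N] has [N + N + 1] degrees. *)
suff H : forall w j (Y : complex A), perfect Y ->
    (forall i, j < i -> forall x : Y i, x = 0) ->
    (forall i, i <= j - w%:Z -> forall x : Y i, x = 0) -> inT Y.
  by apply: (H (N + N).+1 N%:Z) => // i iN x; apply: XN; lia.
elim=> [|w IHw] j Y Yp Yj Yw.
  apply: inT_acyclic => // i x _; exists 0; rewrite linear0.
  by have [ij|ij] := leP (i + 1) j; [apply: Yw; rewrite subr0|apply: Yj].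
apply: (@inT_trunc Y j) => //; first exact: inT_conc_at (Yp.2 j) (TP _ (Yp.2 j)) j.
apply: (IHw (j - 1)); first exact: perfect_trunc.
  move=> i ij; have [->|nij] := pselect (i = j); first exact: trunc_eq0.
  by apply: trunc_zero; apply: Yj; lia.
by move=> i ij; apply: trunc_zero; apply: Yw; lia.
Qed.

End Triangulated.

(** * Additive functors *)

Record addfun (A A' : pzRingType) := AddFun {
  fo :> lmodType A -> lmodType A';
  fm : forall M N : lmodType A, {linear M -> N} -> {linear fo M -> fo N};
  fm_id : forall M x, fm (lid M) x = x;
  fm_comp : forall (M N P : lmodType A) (g : {linear N -> P})
    (f : {linear M -> N}) x, fm (lcomp g f) x = fm g (fm f x);
  fm_add : forall (M N : lmodType A) (f g : {linear M -> N}) x,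
    fm (ladd f g) x = fm f x + fm g x }.

Fact addfun_comp_subproof1 (A A' A'' : pzRingType) (W : addfun A' A'')
  (G : addfun A A') M x : fm W (fm G (lid M)) x = x.
Proof.
rewrite (_ : fm G (lid M) = lid _) ?fm_id //.
by apply: linear_ext => y; rewrite fm_id.
Qed.
Fact addfun_comp_subproof2 (A A' A'' : pzRingType) (W : addfun A' A'')
  (G : addfun A A') (M N P : lmodType A) (g : {linear N -> P}) (f : {linear M -> N}) x :
  fm W (fm G (lcomp g f)) x = fm W (fm G g) (fm W (fm G f) x).
Proof.
rewrite -fm_comp (_ : fm G (lcomp g f) = lcomp (fm G g) (fm G f)) //.
by apply: linear_ext => y; rewrite fm_comp.
Qed.
Fact addfun_comp_subproof3 (A A' A'' : pzRingType) (W : addfun A' A'')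
  (G : addfun A A') (M N : lmodType A) (f g : {linear M -> N}) x :
  fm W (fm G (ladd f g)) x = fm W (fm G f) x + fm W (fm G g) x.
Proof.
rewrite -fm_add (_ : fm G (ladd f g) = ladd (fm G f) (fm G g)) //.
by apply: linear_ext => y; rewrite fm_add.
Qed.
Definition addfun_comp (A A' A'' : pzRingType) (W : addfun A' A'')
    (G : addfun A A') : addfun A A'' :=
  @AddFun A A'' (fun M => W (G M)) (fun M N f => fm W (fm G f))
    (@addfun_comp_subproof1 _ _ _ W G) (@addfun_comp_subproof2 _ _ _ W G)
    (@addfun_comp_subproof3 _ _ _ W G).

Section AdditiveFunctor.
Variables (A A' : pzRingType) (F : addfun A A').
Implicit Types (M N : lmodType A) (X Y Z : complex A).

Lemma fm_zero M N x : fm F (lzero M N) x = 0.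
Proof.
apply: (addrI (fm F (lzero M N) x)); rewrite addr0 -fm_add.
by congr (fm F _ x); apply: linear_ext => y; exact: addr0.
Qed.

Lemma fm_opp M N (f : {linear M -> N}) x : fm F (lopp f) x = - fm F f x.
Proof.
apply/eqP; rewrite -addr_eq0 -fm_add; apply/eqP; rewrite -[RHS](@fm_zero M N x).
by congr (fm F _ x); apply: linear_ext => y; exact: addNr.
Qed.

Lemma fm_ext M N (f g : {linear M -> N}) x : f =1 g -> fm F f x = fm F g x.
Proof. by move=> /linear_ext ->. Qed.

Lemma addfun_eq0 M : (forall x : M, x = 0) -> forall x : F M, x = 0.
Proof.
move=> M0 x; rewrite -[x]fm_id -[RHS](@fm_zero M M x).
by apply: fm_ext => y; rewrite (M0 y) !linear0.
Qed.

Lemma addfun_retract M N : retract M N -> retract (F M) (F N).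
Proof.
move=> [s [r rs]]; exists (fm F s), (fm F r) => x.
by rewrite -fm_comp -[RHS]fm_id; apply: fm_ext.
Qed.

Lemma addfun_pairK M N (x : F (M * N)%type) :
  lcase (fm F (lpair (lid M) (lzero M N))) (fm F (lpair (lzero N M) (lid N)))
    (lpair (fm F (lfst M N)) (fm F (lsnd M N)) x) = x.
Proof.
rewrite /= -!fm_comp -fm_add -[RHS]fm_id; apply: fm_ext => -[y z].
by congr pair; rewrite /= ?addr0 ?add0r.
Qed.

Lemma addfun_pair M N : retract (F (M * N)%type) (F M * F N)%type.
Proof. by eexists; eexists; apply: addfun_pairK. Qed.

Fact fcx_subproof X i x : fm F (cdiff X (i + 1)) (fm F (cdiff X i) x) = 0.
Proof.
rewrite -fm_comp -[RHS](@fm_zero (X i) (X (i + 1 + 1)) x); apply: fm_ext => y.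
exact: cdiffK.
Qed.
Definition fcx X : complex A' := Complex (@fcx_subproof X).

Fact fchm_subproof X Y (f : chmap X Y) i x :
  fm F (f (i + 1)) (cdiff (fcx X) i x) = cdiff (fcx Y) i (fm F (f i) x).
Proof. by rewrite /= -!fm_comp; apply: fm_ext => y; exact: cmapP. Qed.
Definition fchm X Y (f : chmap X Y) : chmap (fcx X) (fcx Y) :=
  @Chmap _ (fcx X) (fcx Y) (fun i => fm F (f i)) (fchm_subproof f).

Lemma fchm_homotopic X Y (f g : chmap X Y) :
  chmap_eq f g -> chmap_eq (fchm f) (fchm g).
Proof.
move=> [h hE]; exists (fun i => fm F (h i)) => i x.
rewrite /= -!fm_comp -fm_add -fm_opp -fm_add; apply: fm_ext => y.
exact: hE.
Qed.

Lemma fchm_id X : fchm (chmap_id X) = chmap_id (fcx X).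
Proof. by apply: chmap_ext => i x; exact: fm_id. Qed.

Lemma fchm_comp X Y Z (g : chmap Y Z) (f : chmap X Y) :
  fchm (chmap_comp g f) = chmap_comp (fchm g) (fchm f).
Proof. by apply: chmap_ext => i x; exact: fm_comp. Qed.

Lemma fchm_inverse X Y (f : chmap X Y) g :
  mutually_inverse f g -> mutually_inverse (fchm f) (fchm g).
Proof.
by move=> [gf fg]; split; rewrite -fchm_comp -fchm_id; apply: fchm_homotopic.
Qed.

Fact fcx_shift_subproof X i x :
  lid _ (cdiff (fcx (shift X)) i x) = cdiff (shift (fcx X)) i (lid _ x).
Proof. exact: fm_opp. Qed.
Definition fcx_shift X : chmap (fcx (shift X)) (shift (fcx X)) :=
  @Chmap _ (fcx (shift X)) (shift (fcx X)) (fun i => lid _) (@fcx_shift_subproof X).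

Lemma fcx_shift_inverse X : exists g, mutually_inverse (fcx_shift X) g.
Proof.
exists (@Chmap _ (shift (fcx X)) (fcx (shift X)) (fun i => lid _)
  (fun i x => esym (@fcx_shift_subproof X i x))).
by split; apply: chmap_eq_ext.
Qed.

Section FunctorCone.
Variables (X Y : complex A) (f : chmap X Y).

Let to i : {linear fcx (cone f) i -> cone (fchm f) i} :=
  lpair (fm F (lfst _ _)) (fm F (lsnd _ _)).
Let from i : {linear cone (fchm f) i -> fcx (cone f) i} :=
  lcase (fm F (lpair (lid (X (i + 1))) (lzero _ (Y i))))
    (fm F (lpair (lzero _ (X (i + 1))) (lid (Y i)))).

Fact fcx_cone_subproof i x :
  to (i + 1) (cdiff (fcx (cone f)) i x) = cdiff (cone (fchm f)) i (to i x).
Proof.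
congr pair; rewrite /= -!fm_comp.
  by rewrite -fm_opp; apply: fm_ext.
by rewrite -fm_add; apply: fm_ext.
Qed.
Definition fcx_cone : chmap (fcx (cone f)) (cone (fchm f)) :=
  Chmap fcx_cone_subproof.

Lemma fcx_cone_invK i x : to i (from i x) = x.
Proof.
case: x => x y; congr pair; rewrite /= linearD -!fm_comp.
  rewrite -[RHS]addr0 -{2}[x]fm_id -(@fm_zero (Y i) (X (i + 1)) y).
  by congr (_ + _); apply: fm_ext.
rewrite -[RHS]add0r -{2}[y]fm_id -(@fm_zero (X (i + 1)) (Y i) x).
by congr (_ + _); apply: fm_ext.
Qed.

Lemma fcx_coneK i x : from i (to i x) = x.
Proof.
rewrite /= -!fm_comp -fm_add -[RHS]fm_id; apply: fm_ext => -[y z].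
by congr pair; rewrite /= ?addr0 ?add0r.
Qed.

Fact fcx_cone_inv_subproof i x :
  from (i + 1) (cdiff (cone (fchm f)) i x) = cdiff (fcx (cone f)) i (from i x).
Proof. by rewrite -{1}(fcx_cone_invK x) -fcx_cone_subproof fcx_coneK. Qed.
Definition fcx_cone_inv : chmap (cone (fchm f)) (fcx (cone f)) :=
  Chmap fcx_cone_inv_subproof.

Lemma fcx_cone_inverse : mutually_inverse fcx_cone fcx_cone_inv.
Proof. by split; apply: chmap_eq_ext => i x; [exact: fcx_coneK|exact: fcx_cone_invK]. Qed.

Lemma fcx_cone_in : chmap_comp fcx_cone (fchm (cone_in f)) = cone_in (fchm f).
Proof.
apply: chmap_ext => i x; congr pair; rewrite /= -fm_comp.
  by rewrite -[RHS](@fm_zero (Y i) (X (i + 1)) x); apply: fm_ext.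
by rewrite -[RHS]fm_id; apply: fm_ext.
Qed.

Lemma fcx_cone_out : chmap_comp (cone_out (fchm f)) fcx_cone =
  chmap_comp (fcx_shift X) (fchm (cone_out f)).
Proof. by apply: chmap_ext => i x; apply: fm_ext. Qed.

End FunctorCone.

Lemma fcx_distinguished X Y Z (f : chmap X Y) (g : chmap Y Z) (h : chmap Z (shift X)) :
  distinguished f g h ->
  distinguished (fchm f) (fchm g) (chmap_comp (fcx_shift X) (fchm h)).
Proof.
move=> [u [v [uv ug hu]]].
exists (chmap_comp (fcx_cone f) (fchm u)), (chmap_comp (fchm v) (fcx_cone_inv f)).
split; first exact: mutually_inverse_comp (fchm_inverse uv) (fcx_cone_inverse f).
  by rewrite -chmap_compA -fchm_comp (fchm_homotopic ug) fcx_cone_in.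
rewrite chmap_compA fcx_cone_out -chmap_compA -fchm_comp.
by rewrite (fchm_homotopic hu).
Qed.

Section Exact.
Hypothesis Fp : forall M, fgproj M -> fgproj (F M).

Lemma fcx_perfect X : perfect X -> perfect (fcx X).
Proof.
move=> [[N XN] XP]; split=> [|i]; last by have := Fp (XP i).
by exists N => i Ni; apply: addfun_eq0; apply: XN.
Qed.

Variables (k : pzRingType) (rho : k -> A) (rho' : k -> A').
Hypothesis Flin : forall c M N (f g h : {linear M -> N}),
  (forall x, h x = rho c *: f x + g x) ->
  forall x, fm F h x = rho' c *: fm F f x + fm F g x.

Fact addfun_linear_subproof (X Y : perf A) (c : k) (f g h : chmap X Y) :
  (forall i x, h i x = rho c *: f i x + g i x) ->
  homotopic (fun i => fchm h i) (fun i x => rho' c *: fchm f i x + fchm g i x).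
Proof.
move=> hE; exists (fun i => lzero _ _) => i x.
by rewrite /= linear0 addr0 (Flin (hE (i + 1))) subrr.
Qed.

Lemma fchm_shift X Y (f : chmap X Y) :
  chmap_comp (fcx_shift Y) (fchm (chmap_shift f)) =
  chmap_comp (chmap_shift (fchm f)) (fcx_shift X).
Proof. exact: chmap_ext. Qed.

Definition addfun_exact : exact_functor rho rho'.
Proof.
unshelve refine (@ExactFunctor k A A' rho rho'
  (fun X : perf A => Perf (fcx_perfect (perfP X)))
  (fun (X Y : perf A) f => fchm f) _ _ _ addfun_linear_subproof
  (fun X : perf A => fcx_shift X) _ _ _).
- by move=> X Y f g; exact: fchm_homotopic.
- by move=> X; rewrite fchm_id.
- by move=> X Y Z g f; rewrite fchm_comp.
- by move=> X; exact: fcx_shift_inverse.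
- by move=> X Y f; rewrite (fchm_shift f).
- by move=> X Y Z f g h; exact: fcx_distinguished.
Defined.

End Exact.
End AdditiveFunctor.

Lemma qis_retract (A : pzRingType) (X X' Y Y' : complex A) (f : chmap X X')
    (g : chmap Y Y') (s : chmap X Y) (r : chmap Y X) (s' : chmap X' Y')
    (r' : chmap Y' X') :
  chmap_eq (chmap_comp r s) (chmap_id X) ->
  chmap_eq (chmap_comp r' s') (chmap_id X') ->
  chmap_comp g s = chmap_comp s' f -> chmap_comp f r = chmap_comp r' g ->
  qis g -> qis f.
Proof.
move=> /chmap_eq_cocycle rs /chmap_eq_cocycle rs' gs fr [gi gS].
have {}gs i x : g i (s i x) = s' i (f i x) by rewrite -[LHS]/(chmap_comp g s i x) gs.
have {}fr i x : f i (r i x) = r' i (g i x) by rewrite -[LHS]/(chmap_comp f r i x) fr.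
split=> i.
  move=> x dx [z fx]; have [||y sx] := gi i (s (i + 1) x).
  - by rewrite -cmapP dx linear0.
  - by exists (s' i z); rewrite gs fx cmapP.
  have [w /= rsx] := rs i x dx; exists (r i y - w).
  by rewrite linearB -cmapP -sx rsx; abel.
move=> z dz; have [w /= rsz] := rs' i z dz.
have [|y [y' [dy sz]]] := gS i (s' (i + 1) z); first by rewrite -cmapP dz linear0.
exists (r (i + 1) y), (r' i y' - w); split; first by rewrite -cmapP dy linear0.
have := rsz; rewrite sz linearD fr cmapP => e.
by rewrite (linearB (cdiff _ _)); abel using e.
Qed.

(** * Complexes on which a natural transformation is a quasi-isomorphism *)

Section UnitThick.
Variables (A : pzRingType) (F : addfun A A) (eta : forall M : lmodType A, {linear M -> F M}).
Hypothesis eta_nat : forall (M N : lmodType A) (f : {linear M -> N}) x, eta N (f x) = fm F f (eta M x).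
Implicit Types X Y Z : complex A.

Fact eta_subproof X i x :
  eta (X (i + 1)) (cdiff X i x) = cdiff (fcx F X) i (eta (X i) x).
Proof. exact: eta_nat. Qed.
Definition etac X : chmap X (fcx F X) := @Chmap _ X (fcx F X) (fun i => eta (X i)) (@eta_subproof X).

Lemma etac_nat X Y (f : chmap X Y) :
  chmap_comp (etac Y) f = chmap_comp (fchm F f) (etac X).
Proof. by apply: chmap_ext => i x; exact: eta_nat. Qed.

Lemma etac_he X Y : homotopy_equivalent X Y -> qis (etac X) -> qis (etac Y).
Proof.
move=> [f [g fg]] Xq; apply: (qis_cancel_right (f := f)).
  exact: mutually_inverse_qis fg.
rewrite etac_nat; apply: qis_comp Xq.
exact: mutually_inverse_qis (fchm_inverse F fg).
Qed.

Lemma qis_shift X Y (f : chmap X Y) : qis f <-> qis (chmap_shift f).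
Proof.
split=> -[fi fs]; split.
- move=> i x /= /eqP; rewrite oppr_eq0 => /eqP dx [y fx].
  have [|x' x'E] := fi _ x dx; first by exists (- y); rewrite linearN.
  by exists (- x'); rewrite linearN opprK.
- move=> i y /= /eqP; rewrite oppr_eq0 => /eqP dy.
  have [x [y' [dx yE]]] := fs _ y dy; exists x, (- y'); rewrite dx oppr0.
  by rewrite linearN opprK.
- apply: int_succ => i x dx [y fx].
  have [||x' x'E] := fi i x; first by rewrite /= dx oppr0.
    by exists (- y); rewrite /= linearN opprK.
  by exists (- x'); rewrite linearN.
- apply: int_succ => i y dy.
  have [|x [y' [dx yE]]] := fs i y; first by rewrite /= dy oppr0.
  exists x, (- y'); split; last by rewrite linearN.
  by apply/eqP; rewrite -oppr_eq0; apply/eqP.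
Qed.

Lemma etac_shift X : qis (etac (shift X)) <-> qis (etac X).
Proof.
have e : chmap_comp (fcx_shift F X) (etac (shift X)) = chmap_shift (etac X).
  exact: chmap_ext.
have [g gE] := fcx_shift_inverse F X; have Sq := mutually_inverse_qis gE.
split=> H; first by apply: (proj2 (qis_shift _)); rewrite -e; apply: qis_comp.
by apply: (qis_cancel_left (g := fcx_shift F X)) => //; rewrite e; apply: (proj1 (qis_shift _)).
Qed.

Lemma etac_cone X Y (f : chmap X Y) :
  qis (etac X) -> qis (etac Y) -> qis (etac (cone f)).
Proof.
move=> Xq Yq.
have Cq := mutually_inverse_qis (fcx_cone_inverse F f).
apply: (qis_cancel_left (g := fcx_cone F f)) => //.
have [|m [mE mq]] := cone_map_of (f := f) (f' := fchm F f) (a := etac X)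
  (b := etac Y) (k := fun i => lzero _ _).
  by move=> i x; rewrite /= eta_nat subrr linear0 addr0.
have -> : chmap_comp (fcx_cone F f) (etac (cone f)) = m; last exact: mq.
apply: chmap_ext => i x; rewrite mE.
by congr pair; rewrite /= -eta_nat // add0r.
Qed.

Lemma etac_triangulated : triangulated (fun X : perf A => qis (etac X)).
Proof.
split.
- move=> X X0; apply: acyclic_qis; first exact: nullhomotopic_id_acyclic.
  apply: nullhomotopic_id_acyclic; apply/nullhomotopicP; rewrite -fchm_id.
  have /nullhomotopicP/(fchm_homotopic F) -> := X0.
  by apply: chmap_eq_ext => i x; exact: fm_zero.
- by move=> X Y; exact: etac_he.
- by move=> X; exact: etac_shift.
- move=> X Y Z f g h [u [v [uv _ _]]] Xq Yq.
  by apply: (etac_he (X := cone f)); [exists v, u; apply: mutually_inverse_sym|exact: etac_cone].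
Qed.

Lemma etac_summand_closed : summand_closed (fun X : perf A => qis (etac X)).
Proof.
move=> X Y s r rs; apply: (qis_retract rs (s' := fchm F s) (r' := fchm F r)).
- by rewrite -fchm_comp -fchm_id; apply: fchm_homotopic.
- exact: etac_nat.
- exact: etac_nat.
Qed.

End UnitThick.

(** * Quasi-inverses of exact functors *)

(** The form in which [a b = c] can be rewritten at the head of a right-nested composite. *)
Lemma comp_eql (A : pzRingType) (X Y Z : complex A) (a : chmap Y Z) (b : chmap X Y)
    (c : chmap X Z) : chmap_eq (chmap_comp a b) c ->
  forall W (x : chmap W X), chmap_eq (chmap_comp a (chmap_comp b x)) (chmap_comp c x).
Proof. by move=> e W x; rewrite chmap_compA e. Qed.

Lemma chmap_shift_eq (A : pzRingType) (X Y : complex A) (f g : chmap X Y) :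
  chmap_eq f g -> chmap_eq (chmap_shift f) (chmap_shift g).
Proof.
move=> [h hE]; exists (fun i => lopp (h (i + 1))) => i x.
have /= e := hE (i + 1) x; rewrite /= (linearN (cdiff _ _)) (linearN (h _)).
by abel using e.
Qed.

Lemma chmap_shift_comp (A : pzRingType) (X Y Z : complex A) (g : chmap Y Z)
    (f : chmap X Y) :
  chmap_shift (chmap_comp g f) = chmap_comp (chmap_shift g) (chmap_shift f).
Proof. exact: chmap_ext. Qed.

Lemma chmap_shift_id (A : pzRingType) (X : complex A) :
  chmap_shift (chmap_id X) = chmap_id (shift X).
Proof. exact: chmap_ext. Qed.

Section QuasiInverse.
Variables (k A A' : pzRingType) (rho : k -> A) (rho' : k -> A').
Variables (E : exact_functor rho' rho) (T : perf A' -> Prop).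
Hypotheses (HT : triangulated T)
  (E_faithful : forall (X Y : perf A') (f g : chmap X Y), T X -> T Y ->
     chmap_eq (fmap E f) (fmap E g) -> chmap_eq f g)
  (E_full : forall (X Y : perf A') (g : chmap (E X) (E Y)), T X -> T Y ->
     exists f : chmap X Y, chmap_eq (fmap E f) g)
  (E_surj : forall X : perf A, exists Y, T Y /\ homotopy_equivalent (E Y) X)
  (rho_central : forall c a, rho c * a = a * rho c)
  (rho'_central : forall c a, rho' c * a = a * rho' c).

Lemma E_lift_inverse (X Y : perf A') (v : chmap X Y) (w : chmap (E Y) (E X)) :
  T X -> T Y -> mutually_inverse (fmap E v) w ->
  exists v', mutually_inverse v v'.
Proof.
move=> TX TY [wv vw]; have [v' v'E] := E_full w TY TX; exists v'; split.
  by apply: E_faithful => //; rewrite fmap_comp v'E wv fmap_id.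
by apply: E_faithful => //; rewrite fmap_comp v'E vw fmap_id.
Qed.

Lemma preimage_ex (X : perf A) : exists Y : perf A', T Y /\
  exists (b : chmap (E Y) X) (b' : chmap X (E Y)), mutually_inverse b b'.
Proof. by have [Y [TY [b [b' bb']]]] := E_surj X; exists Y; split=> //; exists b, b'. Qed.

Definition inv_obj (X : perf A) : perf A' := projT1 (cid (preimage_ex X)).
Lemma inv_objP (X : perf A) : T (inv_obj X).
Proof. by rewrite /inv_obj; case: cid => Y []. Qed.
Lemma counit_ex (X : perf A) : exists (b : chmap (E (inv_obj X)) X) (b' : chmap X (E (inv_obj X))),
  mutually_inverse b b'.
Proof. by rewrite /inv_obj; case: cid => Y []. Qed.
Definition counit (X : perf A) : chmap (E (inv_obj X)) X := projT1 (cid (counit_ex X)).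
Definition counit' (X : perf A) : chmap X (E (inv_obj X)) :=
  projT1 (cid (projT2 (cid (counit_ex X)))).
Lemma counitP (X : perf A) : mutually_inverse (counit X) (counit' X).
Proof. exact: projT2 (cid (projT2 (cid (counit_ex X)))). Qed.
Lemma counitK (X : perf A) : chmap_eq (chmap_comp (counit' X) (counit X)) (chmap_id _).
Proof. by have [] := counitP X. Qed.
Lemma counit'K (X : perf A) : chmap_eq (chmap_comp (counit X) (counit' X)) (chmap_id _).
Proof. by have [] := counitP X. Qed.

Definition inv_map (X Y : perf A) (f : chmap X Y) : chmap (inv_obj X) (inv_obj Y) :=
  projT1 (cid (E_full (chmap_comp (counit' Y) (chmap_comp f (counit X)))
    (inv_objP X) (inv_objP Y))).
Lemma inv_mapE (X Y : perf A) (f : chmap X Y) : chmap_eq (fmap E (inv_map f))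
  (chmap_comp (counit' Y) (chmap_comp f (counit X))).
Proof. exact: projT2 (cid (E_full _ _ _)). Qed.

Lemma inv_map_eq (X Y : perf A) (f g : chmap X Y) :
  chmap_eq f g -> chmap_eq (inv_map f) (inv_map g).
Proof.
by move=> fg; apply: E_faithful; try exact: inv_objP; rewrite !inv_mapE fg.
Qed.

Lemma inv_map_id (X : perf A) : chmap_eq (inv_map (chmap_id X)) (chmap_id (inv_obj X)).
Proof.
apply: E_faithful; try exact: inv_objP.
by rewrite inv_mapE chmap_comp1 counitK fmap_id.
Qed.

Lemma inv_map_comp (X Y Z : perf A) (g : chmap Y Z) (f : chmap X Y) :
  chmap_eq (inv_map (chmap_comp g f)) (chmap_comp (inv_map g) (inv_map f)).
Proof.
apply: E_faithful; try exact: inv_objP.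
by rewrite fmap_comp !inv_mapE -!chmap_compA (comp_eql (counit'K Y)) chmap_comp1.
Qed.

Fact scaled_subproof (B : pzRingType) (b : B) (bC : forall a, b * a = a * b)
  (M N : lmodType B) (f g : {linear M -> N}) : linear (fun x => b *: f x + g x).
Proof.
move=> a x y; rewrite !linearP !scalerDr !scalerA bC; abel.
Qed.

Lemma scaled_chmap (B : pzRingType) (b : B) (bC : forall a, b * a = a * b)
    (X Y : complex B) (f g : chmap X Y) :
  exists h : chmap X Y, forall i x, h i x = b *: f i x + g i x.
Proof.
have hP i x : mklin (scaled_subproof bC (f (i + 1)) (g (i + 1))) (cdiff X i x) =
    cdiff Y i (mklin (scaled_subproof bC (f i) (g i)) x).
  by rewrite /= linearD linearZ_LR !cmapP.
by exists (Chmap hP).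
Qed.

Lemma inv_map_linear (X Y : perf A) (c : k) (f g h : chmap X Y) :
  (forall i x, h i x = rho c *: f i x + g i x) ->
  homotopic (fun i => inv_map h i) (fun i x => rho' c *: inv_map f i x + inv_map g i x).
Proof.
(* The right-hand side is a bare family of functions; [m] makes it a chain map, so that faithfulness
   of [E] applies. Centrality of the scalar is what makes [m] linear. *)
move=> hE; have [m mE] := scaled_chmap (rho'_central c) (inv_map f) (inv_map g).
suff [e eE] : chmap_eq (inv_map h) m by exists e => i x; rewrite -mE; apply: eE.
apply: E_faithful; try exact: inv_objP.
have Em : homotopic (fun i => fmap E m i) _ := fmap_linear E mE.
have [m' m'E] := scaled_chmap (rho_central c) (fmap E (inv_map f)) (fmap E (inv_map g)).
have {}Em : chmap_eq (fmap E m) m'.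
  by have [e eE] := Em; exists e => i x; rewrite m'E; apply: eE.
rewrite Em inv_mapE.
have [d dE] := inv_mapE f; have [d' d'E] := inv_mapE g.
exists (fun i => lopp (mklin (scaled_subproof (rho_central c) (d i) (d' i)))) => i x.
rewrite m'E /= hE linearD linearZ_LR linearN.
have {}dE := dE i x; have {}d'E := d'E i x; rewrite /= in dE d'E.
have e1 := congr1 (fun z => rho c *: z) dE.
rewrite /= scalerBr scalerDr in e1.
by rewrite (linearD (cdiff _ _)) (linearZ_LR (cdiff _ _)); abel using e1, d'E.
Qed.

Definition Eshift_inv (Y : perf A') : chmap (shift (E Y)) (E (perf_shift Y)) :=
  projT1 (cid (fshift_iso E Y)).
Lemma Eshift_invP Y : mutually_inverse (fshift E Y) (Eshift_inv Y).
Proof. exact: projT2 (cid (fshift_iso E Y)). Qed.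

Lemma shift_inT (X : perf A') : T X -> T (perf_shift X).
Proof. by have [_ _ H _] := HT; move/(H X). Qed.

(** Forced by compatibility with the counit: fullness lifts the composite of the counit of [X[1]],
    the shifted inverse counit of [X], and the inverse of the shift isomorphism of [E]. *)
Definition inv_shift (X : perf A) : chmap (inv_obj (perf_shift X)) (shift (inv_obj X)) :=
  projT1 (cid (@E_full (inv_obj (perf_shift X)) (perf_shift (inv_obj X))
    (chmap_comp (Eshift_inv (inv_obj X))
      (chmap_comp (chmap_shift (counit' X)) (counit (perf_shift X))))
    (inv_objP _) (shift_inT (inv_objP X)))).
Lemma inv_shiftE (X : perf A) :
  chmap_eq (@fmap _ _ _ _ _ E (inv_obj (perf_shift X)) (perf_shift (inv_obj X)) (inv_shift X))
   (chmap_comp (Eshift_inv (inv_obj X))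
      (chmap_comp (chmap_shift (counit' X)) (counit (perf_shift X)))).
Proof. exact: projT2 (cid (E_full _ _ _)). Qed.

Lemma inv_shift_iso (X : perf A) : exists g, mutually_inverse (inv_shift X) g.
Proof.
apply: (@E_lift_inverse (inv_obj (perf_shift X)) (perf_shift (inv_obj X)) (inv_shift X)
  (chmap_comp (chmap_comp (counit' (perf_shift X)) (chmap_shift (counit X)))
     (fshift E (inv_obj X)))); [exact: inv_objP|exact/shift_inT/inv_objP|].
have [a b] := Eshift_invP (inv_obj X).
have c := chmap_shift_eq (counitK X); rewrite chmap_shift_comp chmap_shift_id in c.
have d := chmap_shift_eq (counit'K X); rewrite chmap_shift_comp chmap_shift_id in d.
split; rewrite inv_shiftE -!chmap_compA.
  by rewrite (comp_eql b) chmap_comp1 (comp_eql d) chmap_comp1 (counitK (perf_shift X)).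
by rewrite (comp_eql (counit'K (perf_shift X))) chmap_comp1 (comp_eql c) chmap_comp1.
Qed.

Lemma inv_shift_natural (X Y : perf A) (f : chmap X Y) :
  chmap_eq
    (chmap_comp (inv_shift Y) (@inv_map (perf_shift X) (perf_shift Y) (chmap_shift f)))
    (chmap_comp (chmap_shift (inv_map f)) (inv_shift X)).
Proof.
apply: (@E_faithful (inv_obj (perf_shift X)) (perf_shift (inv_obj Y)));
  [exact: inv_objP|exact/shift_inT/inv_objP|].
have [aY bY] := Eshift_invP (inv_obj Y).
have [aX bX] := Eshift_invP (inv_obj X).
etransitivity; first exact: (@fmap_comp _ _ _ _ _ E (inv_obj (perf_shift X)) (inv_obj (perf_shift Y))
  (perf_shift (inv_obj Y))).
etransitivity; last by symmetry; exact: (@fmap_comp _ _ _ _ _ E (inv_obj (perf_shift X)) (perf_shift (inv_obj X))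
  (perf_shift (inv_obj Y))).
rewrite !inv_shiftE inv_mapE -!chmap_compA (comp_eql (counit'K (perf_shift Y))) chmap_comp1.
have n := fshift_natural E (inv_map f).
have m := chmap_shift_eq (inv_mapE f); rewrite !chmap_shift_comp in m.
set EG := fmap E _ in n *.
have n' : chmap_eq (chmap_comp EG (Eshift_inv (inv_obj X)))
    (chmap_comp (Eshift_inv (inv_obj Y)) (chmap_shift (fmap E (inv_map f)))).
  rewrite -[chmap_shift _]chmap_1comp -bX [chmap_comp (chmap_shift _) _]chmap_compA -n.
  by rewrite !chmap_compA aY chmap_comp1.
rewrite (comp_eql n') m -!chmap_compA.
have d := chmap_shift_eq (counitK X); rewrite chmap_shift_comp chmap_shift_id in d.
have d' := chmap_shift_eq (counit'K X); rewrite chmap_shift_comp chmap_shift_id in d'.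
by rewrite (comp_eql d') chmap_comp1.
Qed.

(** [E] sends the triangle of [C], the cone of [inv_map f], to one isomorphic through [m] to the
    given triangle. Fullness brings the isomorphism of third vertices back to [inv_obj Z -> C], and
    faithfulness checks the two squares. *)
Lemma inv_exact (X Y Z : perf A) (f : chmap X Y) (g : chmap Y Z)
    (h : chmap Z (shift X)) :
  distinguished f g h ->
  distinguished (inv_map f) (inv_map g)
    (chmap_comp (inv_shift X) (@inv_map Z (perf_shift X) h)).
Proof.
move=> [u2 [v2 [uv2 ug2 hu2]]].
pose C := Perf (perfect_cone (inv_map f) (perfP _) (perfP _)).
have TC : T C.
  have [_ _ _ H] := HT; apply: (H (inv_obj X) (inv_obj Y) C (inv_map f));
    [exact: cone_distinguished|exact: inv_objP|exact: inv_objP].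
have [u1 [v1 [[vu1 uv1] ug1 hu1]]] := @fexact _ _ _ _ _ E (inv_obj X) (inv_obj Y) C
  _ _ _ (cone_distinguished (inv_map f)).
have [|m [m_in m_out mq]] := @cone_map _ _ _ _ _ (fmap E (inv_map f)) f (counit X)
    (counit Y).
  by rewrite inv_mapE (comp_eql (counit'K Y)) chmap_comp1.
have [||||m' [m'm mm']] := qis_inverse (f := m) _ _ (mq _ _).
- by apply: perfect_bap; apply: perfect_cone; apply: perfP.
- by apply: perfect_bap; apply: perfect_cone; apply: perfP.
- exact: mutually_inverse_qis (counitP X).
- exact: mutually_inverse_qis (counitP Y).
have [vu2 uv2'] := uv2.
(* After [E], the map [v] runs from [E (inv_obj Z)] through [Z], [cone f] and the cone of
   [E (inv_map f)] to [E C]. *)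
have [v vE] := @E_full (inv_obj Z) C
  (chmap_comp v1 (chmap_comp m' (chmap_comp u2 (counit Z)))) (inv_objP Z) TC.
have [v' vv'] : exists v', mutually_inverse v v'.
  apply: (@E_lift_inverse (inv_obj Z) C v
    (chmap_comp (counit' Z) (chmap_comp v2 (chmap_comp m u1)))) => //.
    exact: inv_objP.
  split; rewrite vE -!chmap_compA.
    rewrite (comp_eql uv1) chmap_comp1 (comp_eql mm') chmap_comp1.
    by rewrite (comp_eql vu2) chmap_comp1 (counitK Z).
  rewrite (comp_eql (counit'K Z)) chmap_comp1 (comp_eql uv2') chmap_comp1.
  by rewrite (comp_eql m'm) chmap_comp1 vu1.
exists v, v'; split=> //.
  apply: (@E_faithful (inv_obj Y) C); [exact: inv_objP|exact: TC|].
  etransitivity; first exact: (@fmap_comp _ _ _ _ _ E (inv_obj Y) (inv_obj Z) C).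
  rewrite vE (inv_mapE g) -!chmap_compA (comp_eql (counit'K Z)) chmap_comp1.
  rewrite (comp_eql ug2) -m_in (comp_eql m'm) chmap_comp1 -ug1.
  by rewrite chmap_compA vu1 chmap_comp1.
apply: (@E_faithful (inv_obj Z) (perf_shift (inv_obj X)));
  [exact: inv_objP|exact/shift_inT/inv_objP|].
etransitivity.
  exact: (@fmap_comp _ _ _ _ _ E (inv_obj Z) C (perf_shift (inv_obj X))).
etransitivity; last by symmetry; exact: (@fmap_comp _ _ _ _ _ E (inv_obj Z)
  (inv_obj (perf_shift X)) (perf_shift (inv_obj X))).
rewrite inv_shiftE vE (@inv_mapE Z (perf_shift X) h) -!chmap_compA.
rewrite (comp_eql (counit'K (perf_shift X))) chmap_comp1.
have [SS _] := Eshift_invP (inv_obj X).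
have d := chmap_shift_eq (counitK X); rewrite chmap_shift_comp chmap_shift_id in d.
have out1 : chmap_eq (@fmap _ _ _ _ _ E C (perf_shift (inv_obj X)) (cone_out (inv_map f)))
    (chmap_comp (Eshift_inv (inv_obj X)) (chmap_comp (cone_out (fmap E (inv_map f))) u1)).
  by rewrite hu1 chmap_compA SS chmap_comp1.
have out2 : chmap_eq (chmap_comp (cone_out (fmap E (inv_map f))) m')
    (chmap_comp (chmap_shift (counit' X)) (cone_out f)).
  rewrite -[cone_out (fmap E _)]chmap_comp1 -d -[X in chmap_comp X m']chmap_compA.
  by rewrite -m_out -!chmap_compA mm' chmap_1comp.
rewrite out1 -!chmap_compA (comp_eql uv1) chmap_comp1 (comp_eql out2) -!chmap_compA.
by rewrite (comp_eql hu2).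
Qed.

Definition inv_exact_functor : exact_functor rho rho' :=
  @ExactFunctor k A A' rho rho' inv_obj inv_map inv_map_eq inv_map_id inv_map_comp
    inv_map_linear inv_shift inv_shift_iso inv_shift_natural inv_exact.

Lemma exact_equivalence : perf_equivalent rho rho' T.
Proof.
exists inv_exact_functor; split.
- exact: inv_objP.
- move=> Y TY; exists (E Y).
  have [v vE] := E_full (counit (E Y)) (inv_objP _) TY.
  have [|v' vv'] := @E_lift_inverse (inv_obj (E Y)) Y v (counit' (E Y)) (inv_objP _) TY.
    by split; rewrite vE; [exact: counitK|exact: counit'K].
  by exists v, v'.
- move=> X Y f g /= fg; have {}fg := fmap_eq E fg; rewrite !inv_mapE in fg.
  have {}fg := chmap_comp_eq (chmap_eq_refl (counit Y))
    (chmap_comp_eq fg (chmap_eq_refl (counit' X))).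
  rewrite -!chmap_compA !(comp_eql (counit'K Y)) !chmap_comp1 in fg.
  by rewrite (counit'K X) !chmap_1comp in fg.
- move=> X Y g.
  exists (chmap_comp (counit Y) (chmap_comp (fmap E g) (counit' X))).
  apply: E_faithful; try exact: inv_objP.
  rewrite /= inv_mapE -!chmap_compA (counitK X) chmap_1comp.
  by rewrite (comp_eql (counitK Y)) chmap_comp1.
Qed.

End QuasiInverse.

(** * Resolutions of length one *)

Section Hull.
Variables (A : pzRingType) (M : lmodType A).

Lemma module_hull_triangulated : triangulated (module_hull M).
Proof.
split.
- by move=> X X0 T HT _ _; have [H _ _ _] := HT; apply: H.
- by move=> X Y XY TX T HT HS HM; have [_ H _ _] := HT; apply: (H X Y XY); apply: TX.
- move=> X; split=> TX T HT HS HM; have [_ _ H _] := HT.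
    by apply: (proj1 (H X)); apply: TX.
  by apply: (proj2 (H X)); apply: TX.
- move=> X Y Z f g h fgh TX TY T HT HS HM; have [_ _ _ H] := HT.
  by apply: (H X Y Z f g h fgh); [apply: TX|apply: TY].
Qed.

Lemma module_hull_summand_closed : summand_closed (module_hull M).
Proof.
by move=> X Y s r rs TY T HT HS HM; apply: (HS X Y s r rs); apply: TY.
Qed.

Lemma module_hull_resolution (X : perf A) : projective_resolution X M -> module_hull M X.
Proof. by move=> XM T HT HS; apply. Qed.

End Hull.

Section TwoTerm.
Variable A : pzRingType.
Implicit Types (M N U V : lmodType A) (X Y : complex A).

Lemma resolution_qis X M (eps : {linear X 0 -> M}) : resolution eps ->
  exists f : chmap X (conc M), qis f.
Proof.
move=> [X0 Xe Xm Xs].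
have [f [f0 fE]] := family_update (T := fun i => {linear X i -> conc M i})
  (fun i => lzero _ _) (eps : {linear X 0 -> conc M 0}).
have fP i x : f (i + 1) (cdiff X i x) = cdiff (conc M) i (f i x).
  have [i0|i0] := eqVneq (i + 1) 0; last by rewrite fE.
  have ei : i = -1 by apply/eqP; rewrite -addr_eq0 i0.
  subst i; rewrite -[LHS]/(f 0 (cdiff X (-1) x)) f0.
  by apply/Xm; exists x.
exists (Chmap fP); split=> i.
  move=> x dx [y fx].
  have [i0|i0|i0] := ltgtP (i + 1) 0.
  - exact: Xe.
  - by exists 0; rewrite linear0 (X0 _ i0 x).
  - have ei : i = -1 by apply/eqP; rewrite -addr_eq0 i0.
    by subst i; apply/Xm; rewrite -f0.
move=> y dy; have [i0|i0] := eqVneq (i + 1) 0; last first.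
  by exists 0, 0; rewrite !linear0 addr0 (conc_eq0 y i0).
have ei : i = -1 by apply/eqP; rewrite -addr_eq0 i0.
subst i; have [x xE] := Xs y; exists x, 0; split; first exact: (X0 1).
by rewrite addr0 -[RHS]/(f 0 x) f0 xE.
Qed.

Lemma projective_resolution_bap X M : projective_resolution X M -> bap X.
Proof. by move=> [Xp [eps [X0 _ _ _]]]; split=> //; exists 0. Qed.

Lemma resolution_unique X Y M : projective_resolution X M ->
  projective_resolution Y M -> homotopy_equivalent X Y.
Proof.
move=> XM YM; have Xb := projective_resolution_bap XM.
have Yb := projective_resolution_bap YM.
have [_ [eX /resolution_qis[p pq]]] := XM; have [_ [eY /resolution_qis[q qq]]] := YM.
have [f fE] := qis_lift p Xb qq.
have [|g fg] := qis_inverse (f := f) Xb Yb; last by exists f, g.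
by apply: (qis_cancel_left qq); apply: qis_homotopic pq; symmetry.
Qed.

Lemma conc_lin_comp U V N (g : {linear V -> N}) (f : {linear U -> V}) i x :
  conc_lin g i (conc_lin f i x) = conc_lin (lcomp g f) i x.
Proof. by case: i x => [[|i]|i] x. Qed.
Lemma conc_lin_inj U V (f : {linear U -> V}) : (forall x, f x = 0 -> x = 0) ->
  forall i x, conc_lin f i x = 0 -> x = 0.
Proof. by move=> f0 [[|i]|i] x; [exact: f0|move=> _; exact: triv_eq0..]. Qed.
Lemma conc_lin_surj U V (f : {linear U -> V}) : (forall y, exists x, f x = y) ->
  forall i y, exists x, conc_lin f i x = y.
Proof.
by move=> fS [[|i]|i] y //=; exists 0; apply/esym/triv_eq0.
Qed.
Lemma conc_lin_id U i (x : conc U i) : conc_lin (lid U) i x = x.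
Proof. by case: i x => [[|i]|i] x //=; apply/esym/triv_eq0. Qed.
Lemma conc_lin_zero U V i (x : conc U i) : conc_lin (lzero U V) i x = 0.
Proof. by case: i x => [[|i]|i] x. Qed.
Lemma conc_lin_ext U V (f g : {linear U -> V}) i x : f =1 g ->
  conc_lin f i x = conc_lin g i x.
Proof. by move=> /linear_ext ->. Qed.
Lemma conc_lin_add U V (f g : {linear U -> V}) i x :
  conc_lin (ladd f g) i x = conc_lin f i x + conc_lin g i x.
Proof. by case: i x => [[|i]|i] x //=; rewrite addr0. Qed.

(** [U] sits in degree -1 and [V] in degree 0, each beside a zero module coming from the other
    factor. *)
Definition two_term U V (u : {linear U -> V}) : complex A := cone (conc_map u).

Lemma two_termE U V (u : {linear U -> V}) i x :
  cdiff (two_term u) i x = (0, conc_lin u (i + 1) x.1).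
Proof. by congr pair; [exact: oppr0|exact: addr0]. Qed.

Lemma perfect_two_term U V (u : {linear U -> V}) :
  fgproj U -> fgproj V -> perfect (two_term u).
Proof. by move=> Up Vp; apply: perfect_cone; apply: perfect_conc. Qed.

Section TwoTermMap.
Variables (U V U' V' : lmodType A) (u : {linear U -> V}) (u' : {linear U' -> V'}).
Variables (a : {linear U -> U'}) (b : {linear V -> V'}).
Hypothesis ab : forall x, b (u x) = u' (a x).

Let m i : {linear two_term u i -> two_term u' i} :=
  lpair (lcomp (conc_lin a (i + 1)) (lfst _ _)) (lcomp (conc_lin b i) (lsnd _ _)).
Fact two_term_map_subproof i x :
  m (i + 1) (cdiff (two_term u) i x) = cdiff (two_term u') i (m i x).
Proof.
rewrite !two_termE; congr pair; rewrite /= ?linear0 // !conc_lin_comp.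
exact: conc_lin_ext.
Qed.
Definition two_term_map : chmap (two_term u) (two_term u') := Chmap two_term_map_subproof.

End TwoTermMap.

Record short_exact U V N (u : {linear U -> V}) (p : {linear V -> N}) : Prop :=
  ShortExact {
    se_inj : forall x, u x = 0 -> x = 0;
    se_comp : forall x, p (u x) = 0;
    se_ex : forall y, p y = 0 -> exists x, y = u x;
    se_surj : forall z, exists y, p y = z }.

Lemma two_term_resolution U V N (u : {linear U -> V}) (p : {linear V -> N}) :
  projective U -> projective V -> short_exact u p ->
  projective_resolution (two_term u) N.
Proof.
move=> Up Vp [u0 pu ex pS]; split.
  move=> i; have cp (W : lmodType A) j : projective W -> projective (conc W j).
    by move=> Wp; case: j => [[|j]|j]; [exact Wp|exact (proj1 (fgproj_triv A))..].
  move=> M M' q f qS.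
  have [g gE] := cp U (i + 1) Up M M' q (lcomp f (lpair (lid _) (lzero _ _))) qS.
  have [h hE] := cp V i Vp M M' q (lcomp f (lpair (lzero _ _) (lid _))) qS.
  exists (lcase g h) => -[x y]; rewrite /= linearD gE hE /= -linearD.
  by congr (f _); congr pair; rewrite /= ?addr0 ?add0r.
exists (lcomp p (lsnd (conc U (0 + 1)) (conc V 0))); split.
- move=> i i0 [x y]; congr pair; apply: conc_eq0; lia.
- move=> i i0 [x y] dxy; exists 0; rewrite linear0.
  have y0 : y = 0 by apply: conc_eq0; lia.
  rewrite y0 in dxy *; congr pair; apply: (conc_lin_inj u0).
  by rewrite two_termE in dxy; have := congr1 snd dxy.
- move=> [x y]; split=> [/ex[z zE]|[[z w]]].
    exists (z, 0); rewrite two_termE; congr pair; first exact: triv_eq0.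
    exact: zE.
  by rewrite two_termE => /(congr1 snd) /= ->; apply: pu.
- by move=> z; have [y yE] := pS z; exists (0, y).
Qed.

Lemma two_term_acyclic U V (u : {linear U -> V}) :
  (forall x, u x = 0 -> x = 0) -> (forall y, exists x, u x = y) ->
  acyclic (two_term u).
Proof.
move=> u0 uS; apply: qis_cone; apply: bijective_qis => i.
  exact: conc_lin_inj.
exact: conc_lin_surj.
Qed.

Section ResolvedIn.
Variable T : perf A -> Prop.
Hypotheses (HT : triangulated T) (HS : summand_closed T).

(** Says that [N] is represented by an object of [T]. The class is stable under products and
    retracts, which reduces [W Q] for finitely generated projective [Q] to [Q = S]. *)
Definition resolved_in N : Prop := exists U V (u : {linear U -> V}) (p : {linear V -> N}),
  [/\ fgproj U, fgproj V, short_exact u p & inT T (two_term u)].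

(* With [e : N -> N] the idempotent of the retract [M] and [a : V -> V] a lift of
   [e], the kernel [L] of [V -> M] is a retract of [U * V]: for [l] in [L] both
   [a l] lies in the image of [U], and [l = a l + (1 - a) l]. *)
Lemma resolved_in_retract M N : retract M N -> resolved_in N -> resolved_in M.
Proof.
move=> [s [r rs]] [U [V [u [p [Up Vp [u0 pu ex pS] TK]]]]].
pose q := lcomp r p; pose L := kermod q.
have [a aE] := projective_lift (p := p) (f := lcomp s q) (proj1 Vp) (fun x => pS _).
rewrite /= in aE.
have aL (l : L) : exists x, u x = lcomp a (kincl q) l.
  have [|x xE] := ex (a (kincl q l)); last by exists x; rewrite -xE.
  by rewrite aE; have /= -> := kinclP l; rewrite linear0.
have uL x : q (u x) = 0 by rewrite /= pu linear0.
have bL x : q (ladd (lid V) (lopp a) x) = 0.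
  by rewrite /= linearB linearB aE rs subrr.
pose uc := kcor uL; pose b := kcor bL.
have u_inj : injective u.
  by move=> x y e; apply/eqP; rewrite -subr_eq0; apply/eqP/u0; rewrite linearB e subrr.
have [c cE] : exists c : {linear L -> U}, forall l, u (c l) = a (kincl q l).
  pose cf l := projT1 (cid (aL l)).
  have cfE l : u (cf l) = a (kincl q l) by rewrite /cf; case: cid.
  have cl : linear cf.
    by move=> t x y; apply: u_inj; rewrite linearP !cfE !linearP.
  by exists (mklin cl).
have Lp : fgproj L.
  apply: fgproj_retract (fgproj_pair Up Vp).
  exists (lpair c (kincl q)), (lcase uc b) => l; apply: kincl_inj.
  by rewrite [LHS]linearD !kcorE /= cE; abel.
exists L, V, (kincl q), q; split=> //.
  split=> [x x0|x|y|z].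
  - by apply: kincl_inj; rewrite x0 linear0.
  - exact: kinclP.
  - by move=> /kincl_ex[x <-]; exists x.
  - by have [y yE] := pS (s z); exists y; rewrite /= yE rs.
have Lpf := perfect_two_term (kincl q) Lp Vp.
have [Kpf TK'] := TK.
pose st := two_term_map (u := kincl q) (u' := u) (a := c) (b := a)
  (fun l => esym (cE l)).
pose rt := two_term_map (u := u) (u' := kincl q) (a := uc) (b := lid V) (fun x => erefl).
exists Lpf; apply: (HS (X := Perf Lpf) (Y := Perf Kpf) (s := st) (r := rt)) TK'.
(* The round trip is [uc c] on [L] and [a] on [V]; in both degrees it differs from the identity
   through [b], which is [1 - a] seen as a map [V -> L]. *)
pose h i : {linear two_term (kincl q) (i + 1) -> two_term (kincl q) i} :=
  lpair (lopp (lcomp (conc_lin b (i + 1)) (lsnd _ _))) (lzero _ _).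
exists h => i [x y].
have e1 j (z : conc L j) :
    conc_lin uc j (conc_lin c j z) + conc_lin b j (conc_lin (kincl q) j z) = z.
  rewrite !conc_lin_comp -conc_lin_add -[RHS]conc_lin_id; apply: conc_lin_ext => l.
  by apply: kincl_inj; rewrite [LHS]linearD !kcorE /= cE; abel.
have e2 j (z : conc V j) :
    conc_lin a j z + conc_lin (kincl q) j (conc_lin b j z) = z.
  rewrite conc_lin_comp -conc_lin_add -[RHS]conc_lin_id; apply: conc_lin_ext => l.
  by rewrite /=; abel.
rewrite !two_termE.
have f1 := e1 _ x; have f2 := e2 _ y.
congr pair; rewrite /=.
  by abel using f1.
rewrite (conc_lin_id (conc_lin a (i + 1) y)) (linearN (conc_lin (kincl q) (i + 1))).
by abel using f2.
Qed.

Lemma resolved_in_triv : resolved_in (triv A).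
Proof.
exists (triv A), (triv A), (lid _), (lzero _ _); split; try exact: fgproj_triv.
  split=> [//|x|y _|z]; [by []|by exists y|by exists 0; rewrite linear0; apply/esym/triv_eq0].
apply: inT_acyclic => //; first by apply: perfect_two_term; exact: fgproj_triv.
by apply: two_term_acyclic => // y; exists y.
Qed.

Lemma inT_two_term_pair U V U' V' (u : {linear U -> V}) (u' : {linear U' -> V'}) :
  inT T (two_term u) -> inT T (two_term u') -> perfect (two_term (lpair
    (lcomp u (lfst U U')) (lcomp u' (lsnd U U')))) ->
  inT T (two_term (lpair (lcomp u (lfst U U')) (lcomp u' (lsnd U U')))).
Proof.
set w := lpair _ _ => TK TK' Kp.
have s_inj (X Y : lmodType A) : forall x, lpair (lid X) (lzero X Y) x = 0 -> x = 0.
  by move=> x /(congr1 fst).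
have r_surj (X Y : lmodType A) : forall y, exists x, lsnd X Y x = y.
  by move=> y; exists (0, y).
have s_ex (X Y : lmodType A) j (z : conc (X * Y)%type j) :
    conc_lin (lsnd X Y) j z = 0 ->
    exists x, z = conc_lin (lpair (lid X) (lzero X Y)) j x.
  case: j z => [[|j]|j] z; try by exists 0; rewrite linear0; exact: triv_eq0.
  by case: z => z y /= ->; exists z.
have sab x : lpair (lid V) (lzero V V') (u x) = w (lpair (lid U) (lzero U U') x).
  by congr pair; rewrite /= linear0.
apply: (inT_extension HT (f := two_term_map sab)
  (g := two_term_map (u := w) (u' := u') (a := lsnd U U') (b := lsnd V V') (fun x => erefl)))
  TK TK' => //.
- move=> i [x y] e; congr pair.
    by apply: (conc_lin_inj (@s_inj U U')); have := congr1 fst e.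
  by apply: (conc_lin_inj (@s_inj V V')); have := congr1 snd e.
- move=> i [x y]; congr pair; rewrite /= conc_lin_comp.
    by rewrite -[RHS](conc_lin_zero U' x); apply: conc_lin_ext.
  by rewrite -[RHS](conc_lin_zero V' y); apply: conc_lin_ext.
- move=> i [x y] e.
  have [|x' ->] := s_ex _ _ _ x; first by have := congr1 fst e.
  have [|y' ->] := s_ex _ _ _ y; first by have := congr1 snd e.
  by exists (x', y').
- move=> i [x y]; have [x' <-] := conc_lin_surj (r_surj U U') x.
  have [y' <-] := conc_lin_surj (r_surj V V') y.
  by exists (x', y').
Qed.

Lemma inT_two_term_retract U V U' V' (u : {linear U -> V}) (u' : {linear U' -> V'})
    (a : {linear U -> U'}) (b : {linear V -> V'}) (a' : {linear U' -> U})
    (b' : {linear V' -> V}) :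
  (forall x, b (u x) = u' (a x)) -> (forall x, b' (u' x) = u (a' x)) ->
  (forall x, a' (a x) = x) -> (forall x, b' (b x) = x) ->
  perfect (two_term u) -> inT T (two_term u') -> inT T (two_term u).
Proof.
move=> ba ba' aK bK Kp [Kp' TK']; exists Kp.
apply: (HS (X := Perf Kp) (Y := Perf Kp') (s := two_term_map ba)
  (r := two_term_map ba')) TK'.
apply: chmap_eq_ext => i [x y]; congr pair; rewrite /= conc_lin_comp.
  by rewrite -[RHS]conc_lin_id; apply: conc_lin_ext.
by rewrite -[RHS]conc_lin_id; apply: conc_lin_ext.
Qed.

Lemma resolved_in_pair M N : resolved_in M -> resolved_in N ->
  resolved_in (M * N)%type.
Proof.
move=> [U [V [u [p [Up Vp [u0 pu ex pS] TK]]]]] [U' [V' [u' [p' [Up' Vp' [u0' pu' ex' pS'] TK']]]]].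
pose w := lpair (lcomp u (lfst U U')) (lcomp u' (lsnd U U')).
pose pr := lpair (lcomp p (lfst V V')) (lcomp p' (lsnd V V')).
have UUp := fgproj_pair Up Up'; have VVp := fgproj_pair Vp Vp'.
exists (U * U')%type, (V * V')%type, w, pr; split=> //.
  split.
  - move=> [x y] e; congr pair.
      by apply: u0; have := congr1 fst e.
    by apply: u0'; have := congr1 snd e.
  - by move=> [x y]; congr pair; rewrite /= ?pu ?pu'.
  - move=> [x y] e.
    have [|x' ->] := ex x; first by have := congr1 fst e.
    have [|y' ->] := ex' y; first by have := congr1 snd e.
    by exists (x', y').
  - move=> [x y]; have [x' <-] := pS x; have [y' <-] := pS' y.
    by exists (x', y').
by apply: inT_two_term_pair => //; apply: perfect_two_term.
Qed.

End ResolvedIn.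
End TwoTerm.

(** * Inverting the shift *)

Section Unshift.
Variable A : pzRingType.

(** Differential and identity are taken along arbitrary equations between degrees, so that casts are
    removed by substituting the degree. *)
Let diff (Y : complex A) a b (e : a + 1 = b) : {linear Y a -> Y b} :=
  eq_rect (a + 1) (fun b => {linear Y a -> Y b}) (cdiff Y a) b e.
Let transport (Y : complex A) a b (e : a = b) : {linear Y a -> Y b} :=
  eq_rect a (fun b => {linear Y a -> Y b}) (lid (Y a)) b e.

Let diffK Y a b c (e : a + 1 = b) (e' : b + 1 = c) x : diff Y e' (diff Y e x) = 0.
Proof. by subst b; subst c; exact: cdiffK. Qed.

Let diff_transport Y a b c d (e : a + 1 = b) (f : b = c) (g : a = d) (h : d + 1 = c) x :
  transport Y f (diff Y e x) = diff Y h (transport Y g x).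
Proof.
by subst d; subst b; move: f h; rewrite /transport => f; case: c / f => h;
  rewrite (eq_irrelevance h erefl).
Qed.

Let predS (j : int) : j - 1 + 1 = j + 1 - 1. Proof. by rewrite subrK addrK. Qed.

Fact unshift_subproof (Y : complex A) (i : int) x :
  lopp (diff Y (predS (i + 1))) (lopp (diff Y (predS i)) x) = 0.
Proof. by rewrite /= linearN diffK !oppr0. Qed.
(* The sign makes [shift (unshift Y)] carry the differential of [Y] itself. *)
Definition unshift (Y : complex A) : complex A :=
  @Complex A (fun i => Y (i - 1)) (fun i => lopp (diff Y (predS i)))
    (@unshift_subproof Y).

Lemma unshift_qis (Y : complex A) : exists f : chmap (shift (unshift Y)) Y, qis f.
Proof.
pose f i : {linear shift (unshift Y) i -> Y i} := transport Y (addrK 1 i).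
have fP i x : f (i + 1) (cdiff (shift (unshift Y)) i x) = cdiff Y i (f i x).
  rewrite /= opprK.
  exact: (diff_transport (predS (i + 1)) (addrK 1 (i + 1)) (addrK 1 i) (erefl (i + 1))).
have tb a b (e : a = b) : bijective (transport Y e).
  by subst b; exists id.
exists (Chmap fP); apply: bijective_qis => i; have [g fg gf] := tb _ _ (addrK 1 i).
  by move=> x /= /(congr1 g); rewrite fg => ->; apply: (bij_inj (tb _ _ (addrK 1 i))); rewrite gf linear0.
by move=> y; exists (g y); apply: gf.
Qed.

Lemma perfect_unshift (Y : complex A) : perfect Y -> perfect (unshift Y).
Proof.
move=> [[N YN] YP]; split=> [|i]; last exact: YP.
by exists N.+1 => i iN x; apply: YN; lia.
Qed.

Lemma qis_unshift (X Y : complex A) (f : chmap (shift X) (shift Y)) :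
  qis f -> exists f' : chmap X Y, qis f'.
Proof.
have [g gE] := family_pred (T := fun i => {linear X i -> Y i}) (fun i => f i).
have gP : forall i x, g (i + 1) (cdiff X i x) = cdiff Y i (g i x).
  apply: int_succ => i x; rewrite !gE; have := cmapP f x.
  by rewrite /= linearN => /oppr_inj.
move=> fq; exists (Chmap gP); apply/qis_shift.
have -> // : chmap_shift (Chmap gP) = f by apply: chmap_ext => i x; rewrite /= gE.
Qed.

End Unshift.

(** * The functors [G] and [W] *)

(* The cyclic right module [cgen B] is an [S]-module through [cact], which need only be
   a ring map modulo the annihilator of [cgen]: below it lifts R/(x_i) to R. *)
Record corner (B S : pzRingType) := Corner {
  cgen : B;
  cact : S -> B;
  cact_central : forall s b, cact s * b = b * cact s;
  cactD : forall s t, cact (s + t) * cgen = (cact s + cact t) * cgen;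
  cactM : forall s t, cact (s * t) * cgen = cact s * cact t * cgen;
  cact1 : cact 1 * cgen = cgen }.

Section CornerModule.
Variables (B S : pzRingType) (D : corner B S) (P : lmodType B).
Let c := cgen D.
Let sg := cact D.

Definition in_gmod : {pred P} := fun y => `[< exists p, y = c *: p >].
Fact gmod_closed : zmod_closed in_gmod.
Proof.
split=> [|x y /asboolP[p ->] /asboolP[q ->]]; apply/asboolP.
  by exists 0; rewrite scaler0.
by exists (p - q); rewrite scalerBr.
Qed.
HB.instance Definition _ := GRing.isZmodClosed.Build P in_gmod gmod_closed.

Record gmod := Gmod { gval :> P; gmod_subproof : gval \in in_gmod }.
HB.instance Definition _ := [isSub for gval].
HB.instance Definition _ := [Choice of gmod by <:].
HB.instance Definition _ := [SubChoice_isSubZmodule of gmod by <:].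

Lemma gvalP (y : gmod) : exists p, val y = c *: p.
Proof. by have /asboolP := gmod_subproof y. Qed.

Fact gscale_subproof (s : S) (y : gmod) : (sg s *: val y) \in in_gmod.
Proof.
have [p ->] := gvalP y; apply/asboolP; exists (sg s *: p).
by rewrite !scalerA cact_central.
Qed.
Definition gscale (s : S) (y : gmod) : gmod := Gmod (gscale_subproof s y).

Fact gscaleA s t y : gscale s (gscale t y) = gscale (s * t) y.
Proof.
apply: val_inj; rewrite /=; have [p ->] := gvalP y.
by rewrite !scalerA cactM.
Qed.
Fact gscale1 : left_id 1 gscale.
Proof.
by move=> y; apply: val_inj; rewrite /=; have [p ->] := gvalP y; rewrite scalerA cact1.
Qed.
Fact gscaleDr : right_distributive gscale +%R.
Proof. by move=> s x y; apply: val_inj; rewrite /= scalerDr. Qed.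
Fact gscaleDl y : {morph gscale^~ y : s t / s + t}.
Proof.
move=> s t; apply: val_inj; rewrite /=; have [p ->] := gvalP y.
by rewrite !scalerA cactD mulrDl scalerDl.
Qed.
HB.instance Definition _ := GRing.Zmodule_isLmodule.Build S gmod
  gscaleA gscale1 gscaleDr gscaleDl.

Fact gcls_subproof (p : P) : c *: p \in in_gmod.
Proof. by apply/asboolP; exists p. Qed.
Definition gcls (p : P) : gmod := Gmod (gcls_subproof p).

Lemma gcls_surj (y : gmod) : exists p, y = gcls p.
Proof. by have [p pE] := gvalP y; exists p; apply: val_inj. Qed.
Lemma gclsD p q : gcls (p + q) = gcls p + gcls q.
Proof. by apply: val_inj; rewrite /= scalerDr. Qed.
Lemma gcls_eq p q : c *: p = c *: q -> gcls p = gcls q.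
Proof. by move=> e; apply: val_inj. Qed.
Lemma gcls_val p q : gcls p = gcls q -> c *: p = c *: q.
Proof. by move/(congr1 gval). Qed.
Lemma gcls_eq0 p : gcls p = 0 <-> c *: p = 0.
Proof. by split=> [/(congr1 val)|e] //; apply: val_inj. Qed.
Lemma gclsZ s p : gcls (sg s *: p) = s *: gcls p.
Proof. by apply: val_inj; rewrite /= !scalerA cact_central. Qed.

End CornerModule.

Section CornerFunctor.
Variables (B S : pzRingType) (D : corner B S).
Implicit Types (M N : lmodType B).

Fact gmap_subproof M N (f : {linear M -> N}) (y : gmod D M) : f (val y) \in @in_gmod B S D N.
Proof.
by have [p ->] := gvalP y; apply/asboolP; exists (f p); rewrite linearZ_LR.
Qed.
Definition gmap_fun M N (f : {linear M -> N}) (y : gmod D M) : gmod D N :=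
  Gmod (gmap_subproof f y).
Fact gmap_is_linear M N (f : {linear M -> N}) : linear (gmap_fun f).
Proof. by move=> s x y; apply: val_inj; rewrite /= linearD linearZ_LR. Qed.
Definition gmap M N (f : {linear M -> N}) : {linear gmod D M -> gmod D N} :=
  mklin (gmap_is_linear f).

Lemma gmap_gcls M N (f : {linear M -> N}) p : gmap f (gcls D p) = gcls D (f p).
Proof. by apply: val_inj; rewrite /= linearZ_LR. Qed.

Definition gfun : addfun B S.
Proof.
unshelve refine (@AddFun B S (fun M => gmod D M) gmap _ _ _).
- by move=> M x; apply: val_inj.
- by move=> M N P g f x; apply: val_inj.
- by move=> M N f g x; apply: val_inj.
Defined.

End CornerFunctor.

Section DualModule.
Variables (B S : pzRingType) (D : corner B S) (Q : lmodType S).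
Let c := cgen D.
Let sg := cact D.

(* The [S]-linear maps [cgen B -> Q], written as functions of [b] through [cgen b]. *)
Record wmod := Wmod {
  wfun :> B -> Q;
  wfunD : forall a b, wfun (a + b) = wfun a + wfun b;
  wfunZ : forall s b, wfun (sg s * b) = s *: wfun b;
  wfun_ker : forall b, c * b = 0 -> wfun b = 0 }.
HB.instance Definition _ := gen_eqMixin wmod.
HB.instance Definition _ := gen_choiceMixin wmod.

Lemma wmod_ext (f g : wmod) : (forall b, f b = g b) -> f = g.
Proof.
move=> fg; have {fg} : (f : B -> Q) = g by exact: functional_extensionality_dep.
case: f g => [f f1 f2 f3] [g g1 g2 g3] /= fg; subst g.
by rewrite (Prop_irrelevance f1 g1) (Prop_irrelevance f2 g2) (Prop_irrelevance f3 g3).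
Qed.

Lemma wfun0 (f : wmod) : f 0 = 0. Proof. by apply: wfun_ker; rewrite mulr0. Qed.
Lemma wfunN (f : wmod) b : f (- b) = - f b.
Proof. by apply/eqP; rewrite -addr_eq0 -wfunD addNr wfun0. Qed.
Lemma wfun_eq (f : wmod) a b : c * a = c * b -> f a = f b.
Proof.
move=> e; apply/eqP; rewrite -subr_eq0 -wfunN -wfunD; apply/eqP/wfun_ker.
by rewrite mulrBr e subrr.
Qed.

Local Obligation Tactic := idtac.

Program Definition wadd (f g : wmod) : wmod := @Wmod (fun b => f b + g b) _ _ _.
Next Obligation. by move=> f g a b /=; rewrite !wfunD addrACA. Qed.
Next Obligation. by move=> f g s b /=; rewrite !wfunZ scalerDr. Qed.
Next Obligation. by move=> f g b e /=; rewrite !wfun_ker // addr0. Qed.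
Program Definition wopp (f : wmod) : wmod := @Wmod (fun b => - f b) _ _ _.
Next Obligation. by move=> f a b /=; rewrite !wfunD opprD. Qed.
Next Obligation. by move=> f s b /=; rewrite !wfunZ scalerN. Qed.
Next Obligation. by move=> f b e /=; rewrite !wfun_ker // oppr0. Qed.
Program Definition wzero : wmod := @Wmod (fun b => 0) _ _ _.
Next Obligation. by move=> a b /=; rewrite addr0. Qed.
Next Obligation. by move=> s b /=; rewrite scaler0. Qed.
Next Obligation. by []. Qed.
Program Definition wscale (a : B) (f : wmod) : wmod := @Wmod (fun b => f (b * a)) _ _ _.
Next Obligation. by move=> a f b b' /=; rewrite mulrDl wfunD. Qed.
Next Obligation. by move=> a f s b /=; rewrite -mulrA wfunZ. Qed.
Next Obligation. by move=> a f b e /=; apply: wfun_ker; rewrite mulrA e mul0r. Qed.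

Fact waddA : associative wadd.
Proof. by move=> f g h; apply: wmod_ext => b; exact: addrA. Qed.
Fact waddC : commutative wadd.
Proof. by move=> f g; apply: wmod_ext => b; exact: addrC. Qed.
Fact wadd0 : left_id wzero wadd.
Proof. by move=> f; apply: wmod_ext => b; exact: add0r. Qed.
Fact waddN : left_inverse wzero wopp wadd.
Proof. by move=> f; apply: wmod_ext => b; exact: addNr. Qed.
HB.instance Definition _ := GRing.isZmodule.Build wmod waddA waddC wadd0 waddN.

Fact wscaleA a b f : wscale a (wscale b f) = wscale (a * b) f.
Proof. by apply: wmod_ext => x; rewrite /= mulrA. Qed.
Fact wscale1 : left_id 1 wscale.
Proof. by move=> f; apply: wmod_ext => x; rewrite /= mulr1. Qed.
Fact wscaleDr : right_distributive wscale +%R.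
Proof. by move=> a f g; apply: wmod_ext. Qed.
Fact wscaleDl f : {morph wscale^~ f : a b / a + b}.
Proof. by move=> a b; apply: wmod_ext => x; rewrite /= mulrDr wfunD. Qed.
HB.instance Definition _ := GRing.Zmodule_isLmodule.Build B wmod
  wscaleA wscale1 wscaleDr wscaleDl.

End DualModule.

Section DualFunctor.
Variables (B S : pzRingType) (D : corner B S).
Implicit Types (Q : lmodType S) (M N P : lmodType B).

Local Obligation Tactic := idtac.

Program Definition wmap_fun Q Q' (f : {linear Q -> Q'}) (w : wmod D Q) : wmod D Q' :=
  @Wmod _ _ D Q' (fun b => f (w b)) _ _ _.
Next Obligation. by move=> Q Q' f w a b /=; rewrite wfunD linearD. Qed.
Next Obligation. by move=> Q Q' f w s b /=; rewrite wfunZ linearZ_LR. Qed.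
Next Obligation. by move=> Q Q' f w b e /=; rewrite wfun_ker // linear0. Qed.
Fact wmap_is_linear Q Q' (f : {linear Q -> Q'}) : linear (wmap_fun f).
Proof. by move=> a x y; apply: wmod_ext => b; exact: linearD. Qed.
Definition wmap Q Q' (f : {linear Q -> Q'}) : {linear wmod D Q -> wmod D Q'} :=
  mklin (wmap_is_linear f).

Lemma wmap_comp (Q Q' Q'' : lmodType S) (g : {linear Q' -> Q''}) (f : {linear Q -> Q'}) w :
  wmap (lcomp g f) w = wmap g (wmap f w).
Proof. exact: wmod_ext. Qed.
Lemma wmap_add (Q Q' : lmodType S) (f g : {linear Q -> Q'}) w :
  wmap (ladd f g) w = wmap f w + wmap g w.
Proof. exact: wmod_ext. Qed.
Lemma wmap_opp (Q Q' : lmodType S) (f : {linear Q -> Q'}) w :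
  wmap (lopp f) w = - wmap f w.
Proof. exact: wmod_ext. Qed.

Definition dualfun : addfun S B.
Proof.
unshelve refine (@AddFun S B (fun Q => wmod D Q) wmap _ _ _).
- by move=> Q x; apply: wmod_ext.
- by move=> M N P g f x; apply: wmod_ext.
- by move=> M N f g x; apply: wmod_ext.
Defined.

Program Definition weta_fun M (p : M) : wmod D (gmod D M) :=
  @Wmod _ _ D (gmod D M) (fun b => gcls D (b *: p)) _ _ _.
Next Obligation. by move=> M p a b /=; rewrite scalerDl gclsD. Qed.
Next Obligation. by move=> M p s b /=; rewrite -scalerA gclsZ. Qed.
Next Obligation. by move=> M p b e /=; apply/gcls_eq0; rewrite scalerA e scale0r. Qed.
Fact weta_is_linear M : linear (@weta_fun M).
Proof.
move=> a x y; apply: wmod_ext => b; rewrite [RHS]/=.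
by rewrite -[RHS]gclsD /= scalerDr scalerA.
Qed.
Definition weta M : {linear M -> wmod D (gmod D M)} := mklin (@weta_is_linear M).

Lemma weta_nat M N (f : {linear M -> N}) x :
  weta N (f x) = fm (addfun_comp dualfun (gfun D)) f (weta M x).
Proof. by apply: wmod_ext => b; rewrite /= -[RHS]/(gmap D f _) gmap_gcls linearZ_LR. Qed.

Lemma weta_inj M Q (f g : {linear gmod D M -> Q}) :
  (forall p, wmap f (weta M p) = wmap g (weta M p)) -> f =1 g.
Proof.
move=> fg y; have [p ->] := gcls_surj y.
have /(congr1 (fun w : wmod D Q => w 1)) := fg p.
by rewrite /= scale1r.
Qed.

(** The only candidate sends [c p] to [w p 1], with [c] the generator. It is well defined by a dual
    basis [s i], [g i] of [P]: if [c p = 0] then [c (s i p) = 0], and [w (s i p *: g i) 1] is the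
    value of [w (g i)] at [s i p]. *)
Lemma weta_adjoint P Q (w : {linear P -> wmod D Q}) : fgproj P ->
  exists f : {linear gmod D P -> Q}, forall p, w p = wmap f (weta P p).
Proof.
move=> [Pp [n [g gE]]].
have [s sE] : exists s : 'I_n -> {linear P -> B^o},
    forall x, x = \sum_i (s i x : B) *: g i.
  pose F : lmodType B := {ffun 'I_n -> B^o}.
  pose q0 (a : F) : P := \sum_i (a i : B) *: g i.
  have ql : linear q0.
    move=> b a a'; rewrite /q0 scaler_sumr -big_split; apply: eq_bigr => i _.
    by rewrite !ffunE scalerDl scalerA.
  have [|t tE] := Pp F P (mklin ql) (lid P).
    move=> x; have [a aE] := gE x; exists [ffun i => a i].
    by rewrite /= /q0 [RHS]aE; apply: eq_bigr => i _; rewrite ffunE.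
  have tl i : linear (fun x => t x i : B^o).
    by move=> b x y; rewrite linearP !ffunE.
  by exists (fun i => mklin (tl i)) => x; exact: esym (tE x).
have w0 p : cgen D *: p = 0 -> w p 1 = 0.
  move=> cp; rewrite [p]sE linear_sum.
  have -> : (\sum_i w ((s i p : B) *: g i)) 1 = \sum_i (w ((s i p : B) *: g i)) 1.
    elim/big_rec2: _ => [//|i u v _ <-]; by [].
  rewrite big1 // => i _; rewrite linearZ_LR /= mul1r; apply: wfun_ker.
  by rewrite -[LHS]/(cgen D *: (s i p)) -linearZ_LR cp linear0.
pose f0 (y : gmod D P) : Q := w (projT1 (cid (gcls_surj y))) 1.
have f0E p : f0 (gcls D p) = w p 1.
  rewrite /f0; case: cid => q /= /(congr1 val) /= e.
  apply/eqP; rewrite -subr_eq0; apply/eqP.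
  have := w0 (q - p); rewrite linearB; apply.
  by rewrite scalerBr e subrr.
have fl : linear f0.
  move=> t x y; have [p ->] := gcls_surj x; have [q ->] := gcls_surj y.
  rewrite -gclsZ -gclsD !f0E linearD linearZ_LR.
  rewrite -[LHS]/(w p (1 * cact D t) + w q 1) mul1r -[cact D t]mulr1 wfunZ.
  by [].
exists (mklin fl) => p; apply: wmod_ext => b.
by rewrite /= f0E linearZ_LR /= mul1r.
Qed.

End DualFunctor.

Section CornerUnit.
Variables (B S : pzRingType) (D : corner B S).
Let G := gfun D.
Let W := dualfun D.

Fact corner_unit_subproof (X : complex B) i x :
  weta D (X (i + 1)) (cdiff X i x) = cdiff (fcx W (fcx G X)) i (weta D (X i) x).
Proof. exact: (weta_nat D (cdiff X i)). Qed.
Definition corner_unit (X : complex B) : chmap X (fcx W (fcx G X)) :=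
  @Chmap _ X (fcx W (fcx G X)) (fun i => weta D (X i)) (@corner_unit_subproof X).

Lemma corner_unit_nat (X Y : complex B) (f : chmap X Y) :
  chmap_comp (corner_unit Y) f = chmap_comp (fchm W (fchm G f)) (corner_unit X).
Proof. by apply: chmap_ext => i x; exact: (weta_nat D (f i)). Qed.

Lemma corner_unit_thick : triangulated (fun X : perf B => qis (corner_unit X)) /\
  summand_closed (fun X : perf B => qis (corner_unit X)).
Proof.
split.
  exact: (etac_triangulated (F := addfun_comp W G) (eta := weta D) (@weta_nat B S D)).
exact (@etac_summand_closed B (addfun_comp W G) (weta D) (@weta_nat B S D)).
Qed.

End CornerUnit.

(** * The restriction of [G] to [T] as an equivalence *)

Section CornerEquivalence.
Variables (k B S : pzRingType) (D : corner B S) (T : perf B -> Prop).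
Variables (rho : k -> S) (rho' : k -> B).
Hypotheses (HT : triangulated T)
  (Gp : forall M : lmodType B, fgproj M -> fgproj (gmod D M))
  (Tunit : forall X : perf B, T X -> qis (corner_unit D X))
  (Wres : forall Q : lmodType S, fgproj Q -> resolved_in T (wmod D Q))
  (rho_central : forall c s, rho c * s = s * rho c)
  (rho'_central : forall c b, rho' c * b = b * rho' c)
  (rho_act : forall c, cact D (rho c) * cgen D = rho' c * cgen D).
Variable kap : wmod D (S^o).
Hypothesis kap1 : kap 1 = 1.

Let G := gfun D.
Let W := dualfun D.
Let unit X := corner_unit D X.

Fact gfun_linear c (M N : lmodType B) (f g h : {linear M -> N}) :
  (forall x, h x = rho' c *: f x + g x) ->
  forall x, fm G h x = rho c *: fm G f x + fm G g x.
Proof.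
move=> hE y; apply: val_inj; rewrite /= hE; congr (_ + _).
have [p ->] := gvalP y; rewrite !linearZ_LR !scalerA rho_act.
by [].
Qed.

Definition gexact : exact_functor rho' rho := addfun_exact (F := gfun D) Gp gfun_linear.

Lemma unit_adjoint (X : complex B) (Y : complex S) (p : chmap X (fcx W Y)) :
  (forall i, fgproj (X i)) ->
  exists f : chmap (fcx G X) Y, p = chmap_comp (fchm W f) (unit X).
Proof.
move=> Xp; pose f i := projT1 (cid (weta_adjoint (p i) (Xp i))).
have fE i x : p i x = wmap D (f i) (weta D (X i) x) by rewrite /f; case: cid.
have fP i y : f (i + 1) (cdiff (fcx G X) i y) = cdiff Y i (f i y).
  apply: (@weta_inj _ _ D _ _ (lcomp (f (i + 1)) (cdiff (fcx G X) i))
    (lcomp (cdiff Y i) (f i))) => x.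
  rewrite !wmap_comp -fE -[RHS]/(cdiff (fcx W Y) i (p i x)) -cmapP fE; congr (wmap _ _ _).
  exact: esym (weta_nat D (cdiff X i) x).
by exists (Chmap fP); apply: chmap_ext => i x; exact: fE.
Qed.

Lemma unit_adjoint_homotopy (X : complex B) (Y : complex S) (f g : chmap (fcx G X) Y) :
  (forall i, fgproj (X i)) ->
  chmap_eq (chmap_comp (fchm W f) (unit X)) (chmap_comp (fchm W g) (unit X)) ->
  chmap_eq f g.
Proof.
move=> Xp [h hE]; pose e i := projT1 (cid (weta_adjoint (h i) (Xp (i + 1)))).
have eE i x : h i x = wmap D (e i) (weta D (X (i + 1)) x) by rewrite /e; case: cid.
exists e => i y.
apply: (@weta_inj _ _ D _ _ (ladd (f (i + 1)) (lopp (g (i + 1))))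
  (ladd (lcomp (cdiff Y i) (e i)) (lcomp (e (i + 1)) (cdiff (fcx G X) (i + 1))))) => x.
rewrite !wmap_add wmap_opp !wmap_comp -eE.
have /= -> := hE i x; congr (_ + _); rewrite eE; congr (wmap _ _ _).
exact: (weta_nat D (cdiff X (i + 1)) x).
Qed.

(** Evaluation at 1 from [W Q] to [Q] has the natural section [tau], which sends [q] to
    [b |-> kap b *: q]. So cocycles and primitives pass to [W] and back. *)
Lemma dualfun_reflects (X Y : complex S) (f : chmap X Y) : qis (fchm W f) -> qis f.
Proof.
pose tau (Q : lmodType S) (q : Q) : wmod D Q := wmap D (lscale q) kap.
have tau1 (Q : lmodType S) (q : Q) : tau Q q 1 = q by rewrite /= kap1 scale1r.
have tauM (Q Q' : lmodType S) (g : {linear Q -> Q'}) q : wmap D g (tau Q q) = tau Q' (g q).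
  by apply: wmod_ext => b; rewrite /= linearZ_LR.
have tau0 (Q : lmodType S) : tau Q 0 = 0.
  by apply: wmod_ext => b; rewrite /= scaler0.
move=> [fi fs]; split=> i.
  move=> x dx [y fx]; have [||w wE] := fi i (tau _ x).
  - by rewrite [LHS]tauM dx tau0.
  - by exists (tau _ y); rewrite [LHS]tauM [RHS]tauM fx.
  by exists (w 1); rewrite -{1}[x]tau1 wE.
move=> y dy; have [|w [v [dw yE]]] := fs i (tau _ y).
  by rewrite [LHS]tauM dy tau0.
exists (w 1), (v 1); split; first exact: (congr1 (fun u : wmod D _ => u 1) dw).
by rewrite -{1}[y]tau1 yE.
Qed.

Lemma gexact_faithful (X Y : perf B) (f g : chmap X Y) : T X -> T Y ->
  chmap_eq (fmap gexact f) (fmap gexact g) -> chmap_eq f g.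
Proof.
move=> TX TY fg; apply: (qis_inj (perfect_bap (perfP X)) (Tunit TY)).
rewrite !corner_unit_nat; apply: chmap_comp_eq => //.
by have := fchm_homotopic W fg.
Qed.

Lemma gexact_full (X Y : perf B) (g : chmap (gexact X) (gexact Y)) : T X -> T Y ->
  exists f : chmap X Y, chmap_eq (fmap gexact f) g.
Proof.
move=> TX TY.
have [f fE] := qis_lift (chmap_comp (fchm W g) (unit X)) (perfect_bap (perfP X)) (Tunit TY).
exists f; apply: (unit_adjoint_homotopy (proj2 (perfP X))).
by rewrite -fE corner_unit_nat.
Qed.

(** Let [K] be the resolution of [W Q] in [T]. The map [K -> W Q] is adjoint to some [f : G K -> Q],
    and it factors as the unit followed by [W f]. Both it and the unit are quasi-isomorphisms, hence
    so are [W f] and [f]. *)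
Lemma gexact_conc (Q : lmodType S) : fgproj Q ->
  exists Y : perf B, T Y /\ homotopy_equivalent (gexact Y) (conc Q).
Proof.
move=> Qp; have [U [V [u [p [Up Vp up [Kp TK]]]]]] := Wres Qp.
exists (Perf Kp); split=> //.
have [_ [eps /resolution_qis[q qq]]] :=
  two_term_resolution (proj1 Up) (proj1 Vp) up.
have [||||r [_ rq]] := concentrated_qis (j := 0) (X := conc (wmod D Q))
  (Y := fcx W (conc Q)) (a := lid (wmod D Q)).
- by move=> i i0 x; apply: conc_eq0.
- by move=> i i0; apply: addfun_eq0 => x; apply: conc_eq0.
- by [].
- by move=> y; exists y.
have [f fE] := unit_adjoint (chmap_comp r q) (proj2 Kp).
have fq : qis f.
  apply: dualfun_reflects; apply: (qis_cancel_right (f := unit _)); first exact: (Tunit TK).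
  by rewrite -fE; apply: qis_comp.
have [||g fg] := qis_inverse (f := f) _ _ fq; last by exists f, g.
  by apply: perfect_bap; apply: (perfP (gexact (Perf Kp))).
exact/perfect_bap/perfect_conc.
Qed.

(** The essential image is triangulated and contains every finitely generated projective in degree
    0, so it is everything. *)
Lemma gexact_surj (X : perf S) :
  exists Y, T Y /\ homotopy_equivalent (gexact Y) X.
Proof.
pose T' (X : perf S) := exists Y, T Y /\ homotopy_equivalent (gexact Y) X.
have he_qis (X1 X2 : perf S) (f : chmap X1 X2) : qis f -> homotopy_equivalent X1 X2.
  move=> fq; have [||g fg] := qis_inverse (f := f) _ _ fq; last by exists f, g.
    by apply: perfect_bap; apply: perfP.
  by apply: perfect_bap; apply: perfP.
have qis_he (X1 X2 : perf S) : homotopy_equivalent X1 X2 -> exists f : chmap X1 X2, qis f.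
  by move=> [f [g fg]]; exists f; apply: mutually_inverse_qis fg.
have GS (Y : perf B) : homotopy_equivalent (gexact (perf_shift Y)) (shift (gexact Y)).
  by have [g gE] := fcx_shift_inverse G Y; exists (fcx_shift G Y), g.
suff T'T : triangulated T'.
  apply: (triangulated_all T'T) => P Pp; exists (perfect_conc Pp).
  exact: gexact_conc.
split.
- move=> Z Z0.
  have Cp := perfect_conc (fgproj_triv B).
  have Ca : acyclic (conc (triv B)).
    by move=> i x _; exists 0; rewrite linear0; case: i x => [[|i]|i] x; case: (_ + _) x => [[|?]|?] x; apply: triv_eq0.
  exists (Perf Cp); split.
    by have [p' Tp] := inT_acyclic HT Cp Ca; rewrite (Prop_irrelevance Cp p').
  apply: (he_qis _ _ (chzero _ _)); apply: acyclic_qis.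
    move=> i x _; exists 0; rewrite linear0.
    apply: (@addfun_eq0 _ _ G) => y.
    by case: (i + 1) y => [[|?]|?] y; apply: triv_eq0.
  exact: nullhomotopic_id_acyclic.
- by move=> X1 X2 e [Y [TY Ye]]; exists Y; split=> //; apply: he_trans e.
- move=> Z; split=> -[Y [TY Ye]].
    (* A preimage of [Z[1]] has to be shifted back. This needs an actual inverse of the shift, which
       is defined only up to casts between degrees. *)
    have Up := perfect_unshift (perfP Y); have [f fq] := unshift_qis Y.
    have TU : T (Perf Up).
      have [_ _ H _] := HT; apply: (proj1 (H (Perf Up))).
      apply/inT_perf; apply: (inT_qis_source HT _ fq); last by apply/inT_perf.
      by apply: shift_perfect.
    exists (Perf Up); split=> //.
    have fb := @perfect_bap _ _ (shift_perfect Up).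
    have [g fg] := qis_inverse fb (perfect_bap (perfP Y)) fq.
    have e1 : homotopy_equivalent (shift (gexact (Perf Up))) (shift Z).
      apply: he_trans (he_sym (GS (Perf Up))) _; apply: he_trans Ye.
      by exists (fchm G f), (fchm G g); apply: fchm_inverse.
    have [f1 f1q] := qis_he (perf_shift (gexact (Perf Up))) (perf_shift Z) e1.
    have [f2 f2q] := qis_unshift f1q.
    exact: he_qis f2q.
  exists (perf_shift Y); split; first by have [_ _ H _] := HT; apply: (proj2 (H Y)).
  apply: he_trans (GS Y) _; have [f [g [gf fg]]] := Ye.
  exists (chmap_shift f), (chmap_shift g); split.
    by rewrite -chmap_shift_comp (chmap_shift_eq gf) chmap_shift_id.
  by rewrite -chmap_shift_comp (chmap_shift_eq fg) chmap_shift_id.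
- move=> X1 X2 X3 f g h [u [v [uv _ _]]] [Y1 [TY1 [b1 [b1' bb1]]]] [Y2 [TY2 [b2 [b2' bb2]]]].
  (* Fullness realises [f] up to homotopy as the image of a map in [T], whose cone is then a
     preimage of the third vertex. *)
  have [f1 f1E] := gexact_full (chmap_comp b2' (chmap_comp f b1)) TY1 TY2.
  have Cp := perfect_cone f1 (perfP Y1) (perfP Y2).
  exists (Perf Cp); split.
    have [_ _ _ H] := HT.
    exact: (H Y1 Y2 (Perf Cp) f1 _ _ (cone_distinguished f1)).
  have [|m [_ _ mq]] := cone_map (f := fchm G f1) (f' := f) (a := b1) (b := b2).
    have -> : chmap_eq (fchm G f1) (chmap_comp b2' (chmap_comp f b1)) by exact: f1E.
    by have [_ b2K] := bb2; rewrite (comp_eql b2K) chmap_comp1.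
  have {}mq := mq (mutually_inverse_qis bb1) (mutually_inverse_qis bb2).
  have cq := mutually_inverse_qis (fcx_cone_inverse G f1).
  have vq := mutually_inverse_qis (mutually_inverse_sym uv).
  apply: (he_qis (gexact (Perf Cp)) X3 (chmap_comp v (chmap_comp m (fcx_cone G f1)))).
  by apply: qis_comp vq _; apply: qis_comp.
Qed.

Theorem corner_equivalence : perf_equivalent rho rho' T.
Proof.
exact: (exact_equivalence HT gexact_faithful gexact_full gexact_surj
  rho_central rho'_central).
Qed.

End CornerEquivalence.

Lemma acyclic_shift (A : pzRingType) (X : complex A) : acyclic (shift X) <-> acyclic X.
Proof.
split=> Xa.
  apply: int_succ => i x dx; have [|y yE] := Xa i x; first by rewrite /= dx oppr0.
  by exists (- y); rewrite linearN.
move=> i x /= /eqP; rewrite oppr_eq0 => /eqP /Xa[y yE].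
by exists (- y); rewrite linearN opprK.
Qed.

(** * Complexes that become acyclic under an additive functor *)

Section AcyclicThick.
Variables (A A' : pzRingType) (F : addfun A A').

Lemma acyclic_triangulated : triangulated (fun X : perf A => acyclic (fcx F X)).
Proof.
have he (X Y : complex A) : homotopy_equivalent X Y -> acyclic (fcx F X) -> acyclic (fcx F Y).
  by move=> [f [g fg]]; apply: qis_acyclic (mutually_inverse_qis (fchm_inverse F fg)).
split.
- move=> X X0; apply: nullhomotopic_id_acyclic; apply/nullhomotopicP; rewrite -fchm_id.
  have /nullhomotopicP/(fchm_homotopic F) -> := X0.
  by apply: chmap_eq_ext => i x; exact: fm_zero.
- by move=> X Y; exact: he.
- move=> X; have [g gE] := fcx_shift_inverse F X; have Sq := mutually_inverse_qis gE.
  split=> Xa; first by apply: (proj1 (acyclic_shift _)); apply: qis_acyclic Sq Xa.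
  by apply: (acyclic_qis_source Sq); apply: (proj2 (acyclic_shift _)).
- move=> X Y Z f g h [u [v [uv _ _]]] Xa Ya.
  apply: (he (cone f)); first by exists v, u; apply: mutually_inverse_sym.
  apply: (acyclic_qis_source (mutually_inverse_qis (fcx_cone_inverse F f))).
  by apply: qis_cone; apply: acyclic_qis.
Qed.

Lemma acyclic_summand_closed : summand_closed (fun X : perf A => acyclic (fcx F X)).
Proof.
move=> X Y s r rs Ya i x dx.
have /chmap_eq_cocycle e : chmap_eq (chmap_comp (fchm F r) (fchm F s)) (chmap_id _).
  by rewrite -fchm_comp -fchm_id; apply: fchm_homotopic.
have [z zE] := e i x dx; have [|y yE] := Ya i (fchm F s (i + 1) x).
  by rewrite -cmapP dx linear0.
exists (fchm F r i y - z); rewrite linearB -cmapP -yE.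
by rewrite [X in _ = X - _]zE /=; abel.
Qed.

End AcyclicThick.

Section Orthogonality.
Variables (B S : pzRingType) (D : corner B S).

Lemma corner_hom_null (X Y : perf B) (f : chmap X Y) :
  (forall M : lmodType B, fgproj M -> fgproj (gmod D M)) ->
  acyclic (fcx (gfun D) X) -> qis (corner_unit D Y) -> nullhomotopic f.
Proof.
move=> Gp Xa Yq; apply: (qis_null (perfect_bap (perfP X)) Yq).
apply/nullhomotopicP; rewrite corner_unit_nat.
(* [G X] is acyclic with projective terms, hence contractible; so [W (G f)] is null-homotopic
   without any exactness of [W]. *)
have Gb : bap (fcx (gfun D) X) by apply/perfect_bap/fcx_perfect => //; apply: perfP.
have /nullhomotopicP e := acyclic_nullhomotopic_id Gb Xa.
rewrite -[fchm (gfun D) f]chmap_1comp (fchm_homotopic _ (chmap_comp_eq (chmap_eq_refl _) e)).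
by rewrite chmap_comp0; apply: chmap_eq_ext => i x /=; apply: wmod_ext.
Qed.

End Orthogonality.

Lemma inT_iter_shift (A : pzRingType) (T : perf A -> Prop) : triangulated T ->
  forall m (X : perf A), T X -> inT T (iter m (@shift A) X).
Proof.
move=> HT; elim=> [|m IH] X TX; first by apply/inT_perf.
have Tm := IH X TX; have [p _] := Tm.
by rewrite iterS; apply: (proj2 (inT_shift HT p)).
Qed.

Lemma Hom_vanish_triangulated (A : pzRingType) (T T' : perf A -> Prop) :
  triangulated T -> triangulated T' ->
  (forall (X Y : perf A) (f : chmap X Y), T X -> T' Y -> nullhomotopic f) ->
  forall X Y : perf A, T X -> T' Y -> Hom_vanish X Y.
Proof.
move=> HT HT' H X Y TX TY m; split=> f.
  have [p Tp] := inT_iter_shift HT' m TY.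
  exact: (H X (Perf p) f).
have [p Tp] := inT_iter_shift HT m TX.
exact: (H (Perf p) Y f).
Qed.

(** * Divisibility by square-free monomials *)

Section Polynomials.
Variables (k : comNzRingType) (n : nat).
Local Notation P := {mpoly k[n]}.

(** The polynomial ring need not be a domain, so the cancellation compares coefficients. *)
Lemma mpolyX_reg (j : 'I_n) (f g : P) : 'X_j * f = 'X_j * g -> f = g.
Proof.
move=> e; apply/mpolyP => m.
by rewrite -(mcoeffMX f U_(j)%MM m) -(mcoeffMX g U_(j)%MM m) ![_ * 'X_[_]]mulrC e.
Qed.

(** Divisibility by ['X_i] can be read on the support. Multiplying by ['X_j] leaves the exponent of
    ['X_i] unchanged, so every monomial of [f] already contains ['X_i]. *)
Lemma mpolyX_prime (i j : 'I_n) (f g : P) : j != i -> 'X_j * f = 'X_i * g ->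
  exists h, f = 'X_i * h.
Proof.
move=> ji e.
have supp m : m \in msupp f -> (0 < m i)%N.
  move=> mf; have : (U_(j) + m)%MM \in msupp (f * 'X_j).
    by rewrite (perm_mem (msuppMX _ _)); apply: map_f.
  rewrite mulrC e mulrC (perm_mem (msuppMX _ _)) => /mapP[m' _ /mnmP/(_ i)].
  by rewrite !mnmDE !mnm1E eqxx (negbTE ji) add0n => ->.
exists (\sum_(m <- msupp f) f@_m *: 'X_[m - U_(i)]).
rewrite {1}[f]mpolyE mulr_sumr; apply: eq_big_seq => m mf.
rewrite -scalerAr -mpolyXD; congr (_ *: 'X_[_]); apply/mnmP => l.
rewrite mnmDE mnmBE mnm1E; have [<-|_] := eqVneq i l; last by rewrite add0n subn0.
by rewrite subnKC // supp.
Qed.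

Definition mprod (A : pred 'I_n) : P := \prod_(j < n | A j) 'X_j.

Lemma mprod_reg A (f g : P) : mprod A * f = mprod A * g -> f = g.
Proof.
rewrite /mprod; move: f g.
apply: (big_ind (fun p : P => forall f g : P, p * f = p * g -> f = g)) => [f g|p q Hp Hq f g|j _ f g].
- by rewrite !mul1r.
- by rewrite -!mulrA => /Hp/Hq.
- exact: mpolyX_reg.
Qed.

Lemma mprod_prime A i (f g : P) : ~~ A i -> mprod A * f = 'X_i * g ->
  exists h, f = 'X_i * h.
Proof.
move=> Ai; rewrite /mprod; move: f g.
apply: (big_ind (fun p : P => forall f g : P, p * f = 'X_i * g -> exists h, f = 'X_i * h)).
- by move=> f g; rewrite mul1r => ->; exists g.
- by move=> p q Hp Hq f g; rewrite -mulrA => /Hp[h /Hq].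
- move=> j Aj f g; apply: mpolyX_prime.
  by apply: contraNneq Ai => <-.
Qed.

Let R := ringR k n.

Lemma qpiM (A : comPzRingType) (a x y : A) : qpi a (x * y) = qpi a x * qpi a y.
Proof. exact/esym/qmulE. Qed.

Lemma qrepr_qpi (A : comPzRingType) (a x : A) : exists u, qrepr (qpi a x) = x + u * a.
Proof.
have [u uE] : exists u, qrepr (qpi a x) - x = u * a by apply/qpi_eqP; rewrite qreprK.
by exists u; rewrite -uE addrC subrK.
Qed.

Definition vprod (A : pred 'I_n) : R := \prod_(j < n | A j) var k j.

Lemma vprodE A : vprod A = qpi _ (mprod A).
Proof.
rewrite /vprod /mprod; apply: (big_rec2 (fun (x : R) y => x = qpi _ y)) => //.
by move=> j x y _ ->; rewrite qpiM.
Qed.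

Lemma vprod_ID A A' : vprod (fun j => A j && A' j) * vprod (fun j => A j && ~~ A' j) =
  vprod A.
Proof. by rewrite /vprod [RHS](bigID A'). Qed.

Lemma mprod_ID A : mprod A * mprod (fun j => ~~ A j) = \prod_(j < n) 'X_j.
Proof. by rewrite /mprod [RHS](bigID A). Qed.

Lemma vprod_C A : vprod A * vprod (fun j => ~~ A j) = 0.
Proof.
rewrite !vprodE -qpiM mprod_ID.
by apply/qpi_eqP; exists 1; rewrite mul1r subr0.
Qed.

(** The relation of [R] is the product over [A] times the product over its complement, and the first
    factor can be cancelled among polynomials. *)
Lemma vprod_ann A (r : R) : vprod A * r = 0 -> exists r', r = vprod (fun j => ~~ A j) * r'.
Proof.
have [f ->] := qpi_surj r; rewrite vprodE -qpiM => /qpi_eqP[g].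
rewrite subr0 => e.
have /mprod_reg fE : mprod A * f = mprod A * (g * mprod (fun j => ~~ A j)).
  by rewrite e -(mprod_ID A) mulrCA.
by exists (qpi _ g); rewrite vprodE -qpiM mulrC fE.
Qed.

Lemma vprod_prime A i (r s : R) : ~~ A i -> vprod A * r = var k i * s ->
  exists t, r = var k i * t.
Proof.
move=> Ai; have [f ->] := qpi_surj r; have [g ->] := qpi_surj s.
rewrite vprodE -!qpiM => /qpi_eqP[h].
move=> /eqP; rewrite subr_eq => /eqP e.
(* Lifting to polynomials costs a multiple of the product of all variables, which is itself
   divisible by ['X_i]. *)
have e' : mprod A * f = 'X_i * (h * \prod_(j < n | j != i) 'X_j + g).
  by rewrite e (bigD1 i) //= mulrDr mulrCA.
have [t ->] := mprod_prime Ai e'.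
by exists (qpi _ t); rewrite qpiM.
Qed.

Lemma vprod1 i : vprod (fun j => j == i) = var k i.
Proof. by rewrite /vprod big_pred1_eq. Qed.

Lemma eq_vprod (A A' : pred 'I_n) : A =1 A' -> vprod A = vprod A'.
Proof. by move=> AA'; apply: eq_bigl. Qed.

Lemma vprod_sub (A A' : pred 'I_n) : (forall j, A j -> A' j) -> exists c, vprod A' = c * vprod A.
Proof.
move=> AA'; exists (vprod (fun j => A' j && ~~ A j)); rewrite mulrC -(vprod_ID A' A).
congr (_ * _); apply: eq_vprod => j; apply/andP/idP => [[]//|Aj].
by split=> //; apply: AA'.
Qed.

End Polynomials.

(** * Elements of the Auslander algebra *)

Section LeftIdealRetract.
Variables (A : pzRingType) (e : A).

Fact leftideal_incl_is_linear : linear (fun b : leftideal e => val b).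
Proof. by []. Qed.
Definition leftideal_incl : {linear leftideal e -> A^o} := mklin leftideal_incl_is_linear.

Lemma leftideal_valZ (a : A) (b : leftideal e) : val (a *: b) = a * (val b : A) :> A.
Proof. by []. Qed.

Fact leftideal_proj_subproof (b : A^o) : ((b : A) * e : A^o) \in in_leftideal e.
Proof. by apply/asboolP; exists b. Qed.
Definition leftideal_proj_fun b : leftideal e := LeftIdeal (leftideal_proj_subproof b).
Fact leftideal_proj_is_linear : linear leftideal_proj_fun.
Proof. by move=> a x y; apply: val_inj; rewrite /= mulrDl -mulrA. Qed.
Definition leftideal_proj : {linear A^o -> leftideal e} := mklin leftideal_proj_is_linear.

Lemma fgproj_leftideal : e * e = e -> fgproj (leftideal e).
Proof.
move=> ee; apply: fgproj_retract (fgproj_regular A).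
exists leftideal_incl, leftideal_proj => b; apply: val_inj => /=.
by have /asboolP[c ->] := valP b; rewrite -mulrA ee.
Qed.

End LeftIdealRetract.

Section AuslanderElements.
Variables (k : comNzRingType) (n' : nat).
Let n := n'.+1.
Let R := ringR k n.
Let V := summands k n.
Let B := ringB k n.

(* For [i : 'I_n], [yprod i] is x_[1,i] in the paper's indexing and [Pbar i] is Pbar_(i+1). *)
Definition yprod (t : nat) : R := vprod k (fun j : 'I_n => (j < t)%N).

Lemma xprod_yprod (m : 'I_n) : xprod k m = yprod m.+1.
Proof. by apply: eq_vprod => j; rewrite ltnS. Qed.

Lemma yprod0 : yprod 0 = 1.
Proof. by rewrite /yprod /vprod big_pred0. Qed.

Lemma yprod_last t : (n <= t)%N -> yprod t = 0.
Proof.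
move=> nt; rewrite -[RHS](vprod_C k (fun j : 'I_n => (j < t)%N)).
have -> : vprod k (fun j : 'I_n => ~~ (j < t)%N) = 1.
  by rewrite /vprod big_pred0 // => j; rewrite (leq_trans (ltn_ord j) nt).
by rewrite mulr1.
Qed.

(** Hence the last summand is [R] itself and its representatives are unique; this is where equations
    in [R] are read off. *)
Lemma xprod_max : xprod k (ord_max : 'I_n) = 0.
Proof. by rewrite xprod_yprod yprod_last. Qed.

(** The quotient is taken modulo [xprod k j] rather than [xprod k l], which avoids a transport along
    [j = l]. *)
Definition single (l : 'I_n) (r : R) : V :=
  fun j => if j == l then qpi (xprod k j) r else 0.

Lemma scale_single l a r : a *: single l r = single l (a * r).
Proof.
apply: dirsum_ext => j; rewrite -[LHS]/(a *: single l r j) /single.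
by case: eqP => _; rewrite ?scaler0 // qpiZ.
Qed.

Lemma single_eq l r s : (exists c, r - s = c * xprod k l) -> single l r = single l s.
Proof.
move=> [c cE]; apply: dirsum_ext => j; rewrite /single; case: eqP => // ->.
by apply/qpi_eqP; exists c.
Qed.

Lemma single_xprod l r : xprod k l *: single l r = 0.
Proof.
rewrite scale_single; transitivity (single l 0).
  by apply: single_eq; exists r; rewrite subr0 mulrC.
by apply: dirsum_ext => j; rewrite /single; case: eqP.
Qed.

Lemma single_max_inj r : single ord_max r = 0 -> r = 0.
Proof.
move=> /(congr1 (fun v : V => v ord_max)); rewrite /single eqxx => /qpi_eqP[c].
by rewrite subr0 xprod_max mulr0.
Qed.

Lemma single_self l r : single l r l = qpi (xprod k l) r.
Proof. by rewrite /single eqxx. Qed.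

Lemma qrepr_single l r : exists c, qrepr (single l r l) = r + c * xprod k l.
Proof. by rewrite single_self; exact: qrepr_qpi. Qed.

Lemma qrepr_single_max r : qrepr (single ord_max r ord_max) = r.
Proof. by have [c ->] := qrepr_single ord_max r; rewrite xprod_max mulr0 addr0. Qed.

Lemma summands_sum (v : V) : v = \sum_l single l (qrepr (v l)).
Proof.
apply: dirsum_ext => j.
have -> : (\sum_l single l (qrepr (v l))) j = \sum_l (single l (qrepr (v l)) j).
  by elim/big_rec2: _ => [//|l x y _ <-].
rewrite (bigD1 j) //= big1 => [|l lj]; last by rewrite /single eq_sym (negbTE lj).
by rewrite addr0 /single eqxx qreprK.
Qed.

Lemma single1 l r : single l r = r *: single l 1.
Proof. by rewrite scale_single mulr1. Qed.

Lemma endo_single_ext (b b' : B) :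
  (forall l, (b : endo V) (single l 1) = (b' : endo V) (single l 1)) -> b = b'.
Proof.
move=> bb'; apply: endo_ext => v; rewrite [v]summands_sum !linear_sum.
by apply: eq_bigr => l _; rewrite single1 !linearZ_LR bb'.
Qed.

Lemma ringB_mulE (a b : B) (v : V) :
  ((a * b : B) : endo V) v = (a : endo V) ((b : endo V) v).
Proof. by []. Qed.

Definition bscal (r : R) : B := homothety V r.

Lemma bscalE r (v : V) : (bscal r : endo V) v = r *: v. Proof. by []. Qed.

Lemma bscal_central r (b : B) : bscal r * b = b * bscal r.
Proof. by apply: endo_ext => v; rewrite /= linearZ_LR. Qed.

Lemma bscalM r s : bscal (r * s) = bscal r * bscal s.
Proof. by apply: endo_ext => v; rewrite /= scalerA. Qed.
Lemma bscalD r s : bscal (r + s) = bscal r + bscal s.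
Proof. by apply: endo_ext => v; exact: scalerDl. Qed.
Lemma bscal1 : bscal 1 = 1.
Proof. by apply: endo_ext => v; exact: scale1r. Qed.
Lemma bscal0 : bscal 0 = 0.
Proof. by apply: endo_ext => v; exact: scale0r. Qed.

Lemma idemE l (v : V) : (idem k l : endo V) v = single l (qrepr (v l)).
Proof.
apply: dirsum_ext => j; rewrite -[LHS]/(if j == l then v j else 0) /single.
by case: eqP => // ->; rewrite qreprK.
Qed.

Lemma idem_single l l' r :
  (idem k l : endo V) (single l' r) = if l == l' then single l r else 0.
Proof.
apply: dirsum_ext => j.
rewrite -[LHS]/(if j == l then (if j == l' then qpi (xprod k j) r else 0) else 0).
have [-> | jl] := eqVneq j l; first by case: eqP => // _; rewrite /single eqxx.
by case: (l == l') => //; rewrite /single (negbTE jl).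
Qed.

Lemma idemK l : idem k l * idem k l = idem k l :> B.
Proof.
apply: endo_single_ext => j; rewrite ringB_mulE !idem_single.
by case: eqP => [_|_]; rewrite ?linear0 // idem_single eqxx.
Qed.

Lemma sum_idem : \sum_l idem k l = 1 :> B.
Proof.
apply: endo_ext => v; transitivity (\sum_l (idem k l : endo V) v).
  by elim/big_rec2: _ => [//|l x y _ <-].
by rewrite [RHS]summands_sum; apply: eq_bigr => l _; exact: idemE.
Qed.

Lemma projP_idem (m : 'I_n) (b : projP k m) : (val b : B) * idem k m = val b.
Proof. by have /asboolP[c ->] := valP b; rewrite -mulrA idemK. Qed.

(** Identifies [projP m] with Hom(R/(xprod m), V), that is, with the vectors of [V] killed by
    [xprod m]. [projP_ext] gives injectivity, [pval_xprod] and [projP_elt] the image. *)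
Definition pval (m : 'I_n) (b : projP k m) : V := ((val b : B) : endo V) (single m 1).

Lemma projP_ext (m : 'I_n) (b b' : projP k m) : pval b = pval b' -> b = b'.
Proof.
move=> e; apply: val_inj; apply: endo_single_ext => l.
rewrite -(projP_idem b) -(projP_idem b') !ringB_mulE.
by rewrite idem_single; case: eqP => // _; rewrite !linear0.
Qed.

Lemma pvalZ (m : 'I_n) (a : B) (b : projP k m) : pval (a *: b) = (a : endo V) (pval b).
Proof. by []. Qed.
Lemma pval0 (m : 'I_n) : pval (0 : projP k m) = 0.
Proof. by []. Qed.

Lemma pval_eq0 (m : 'I_n) (b : projP k m) : pval b = 0 -> b = 0.
Proof. by rewrite -(pval0 m) => /projP_ext. Qed.

Lemma pval_xprod (m : 'I_n) (b : projP k m) : xprod k m *: pval b = 0.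
Proof. by rewrite -linearZ_LR single_xprod linear0. Qed.

Lemma projP_elt (m : 'I_n) (v : V) : xprod k m *: v = 0 ->
  exists b : projP k m, pval b = v.
Proof.
move=> mv; pose f (w : V) : V := qrepr (w m) *: v.
have fl : linear f.
  move=> a x y; rewrite /f scalerA -scalerDl; apply/eqP; rewrite -subr_eq0 -scalerBl.
  have [c ->] : exists c, qrepr ((a *: x + y) m) - (a * qrepr (x m) + qrepr (y m)) = c * xprod k m.
    by apply/qpi_eqP; rewrite qreprK qpiD qpiZ !qreprK.
  by rewrite -scalerA mv scaler0.
have f1 : f (single m 1) = v.
  have [c cE] := qrepr_qpi (xprod k m) 1.
  by rewrite /f /single eqxx cE scalerDl scale1r -scalerA mv scaler0 addr0.
have fe : (mklin fl : B) * idem k m = mklin fl :> B.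
  apply: endo_ext => w; rewrite -[LHS]/(f ((idem k m : endo V) w)) idemE.
  rewrite -[RHS]/(f w) /f; apply/eqP; rewrite -subr_eq0 -scalerBl.
  have [c ->] : exists c, qrepr (single m (qrepr (w m)) m) - qrepr (w m) = c * xprod k m.
    by apply/qpi_eqP; rewrite qreprK /single eqxx.
  by rewrite -scalerA mv scaler0.
have fin : (mklin fl : B^o) \in in_leftideal (idem k m : B).
  by apply/asboolP; exists (mklin fl : B).
by exists (LeftIdeal fin); exact: f1.
Qed.

(** So under [pval] the map [alpha] is an inclusion of annihilators in [V]. *)
Lemma pval_alpha (j i : 'I_n) (ji : (j <= i)%N) (b : projP k j) :
  pval (alpha k ji b) = pval b.
Proof.
rewrite -[LHS]/((val b : endo V) ((transition k ji : endo V) (single i 1))).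
congr ((val b : endo V) _); apply: dirsum_ext => l.
rewrite -[LHS]/(if l == j then qproj (xprod k l) (single i 1 i) else 0).
have [c cE] := xprod_dvd k ji.
rewrite /single eqxx; have [->|//] := eqVneq l j.
by rewrite (qprojE _ cE).
Qed.

Lemma alpha_image (j i : 'I_n) (ji : (j <= i)%N) (b : projP k i) :
  xprod k j *: pval b = 0 -> exists a, b = alpha k ji a.
Proof.
move=> /projP_elt[a aE]; exists a.
by apply: projP_ext; rewrite pval_alpha.
Qed.

Lemma fgproj_projP (m : 'I_n) : fgproj (projP k m).
Proof. by apply: fgproj_leftideal; apply: idemK. Qed.

(** The idempotents add up to 1, so the regular module is a retract of a product of the modules
    [projP m]. *)
Lemma fgproj_ind_projP (C : lmodType B -> Prop) :
  (forall M N, retract M N -> C N -> C M) ->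
  (forall M N, C M -> C N -> C (M * N)%type) -> C (triv B) ->
  (forall m, C (projP k m)) -> forall P, fgproj P -> C P.
Proof.
move=> Cr Cp C0 CP; apply: fgproj_ind => //.
suff [N [CN [p [q qp]]]] : exists N, C N /\ exists (p : {linear B^o -> N}) (q : {linear N -> B^o}),
    forall b, q (p b) = \sum_(m <- enum 'I_n) (b : B) * idem k m.
  apply: Cr CN; exists p, q => b; rewrite qp -mulr_sumr.
  by rewrite big_enum /= sum_idem mulr1.
elim: (enum _) => [|m s [N [CN [p [q qp]]]]].
  by exists (triv B); split=> //; exists (lzero _ _), (lzero _ _) => b; rewrite big_nil.
exists (projP k m * N)%type; split; first exact: Cp.
exists (lpair (leftideal_proj (idem k m : B)) p), (lcase (leftideal_incl (idem k m : B)) q) => b.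
by rewrite big_cons -qp.
Qed.

End AuslanderElements.

(** * The functors [G_i] and [W_i] *)

Lemma linear_inverse (A : pzRingType) (U V : lmodType A) (f : {linear U -> V}) :
  (forall x, f x = 0 -> x = 0) -> (forall y, exists x, f x = y) ->
  exists g : {linear V -> U}, (forall x, g (f x) = x) /\ (forall y, f (g y) = y).
Proof.
move=> f0 fS; pose g y := projT1 (cid (fS y)).
have gE y : f (g y) = y by rewrite /g; case: cid.
have f_inj x y : f x = f y -> x = y.
  by move=> e; apply/eqP; rewrite -subr_eq0; apply/eqP/f0; rewrite linearB e subrr.
have gl : linear g by move=> a x y; apply: f_inj; rewrite linearP !gE.
by exists (mklin gl); split=> // x; apply: f_inj; rewrite gE.
Qed.

Lemma linear_factor (A : pzRingType) (U N M : lmodType A) (p : {linear U -> N})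
    (w : {linear U -> M}) :
  (forall y, exists x, p x = y) -> (forall x, p x = 0 -> w x = 0) ->
  exists v : {linear N -> M}, forall x, v (p x) = w x.
Proof.
move=> pS pw; pose v y := w (projT1 (cid (pS y))).
have vE x : v (p x) = w x.
  rewrite /v; case: cid => x' /= e.
  by apply/eqP; rewrite -subr_eq0 -linearB; apply/eqP/pw; rewrite linearB e subrr.
have vl : linear v.
  by move=> a x y; have [x' <-] := pS x; have [y' <-] := pS y; rewrite -linearP !vE linearP.
by exists (mklin vl).
Qed.

Section Annihilator.
Variables (A : pzRingType) (z : A) (zC : forall a, z * a = a * z).

Fact zscale_is_linear (M : lmodType A) : linear (fun x : M => z *: x).
Proof. by move=> a x y; rewrite scalerDr !scalerA zC. Qed.
Definition zscale (M : lmodType A) : {linear M -> M} := mklin (zscale_is_linear (M := M)).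

Fact annmap_subproof (M N : lmodType A) (f : {linear M -> N}) (x : kermod (zscale M)) :
  zscale N (lcomp f (kincl (zscale M)) x) = 0.
Proof. by rewrite /= -linearZ_LR; have /= -> := kinclP x; rewrite linear0. Qed.
Definition annmap (M N : lmodType A) (f : {linear M -> N}) :
  {linear kermod (zscale M) -> kermod (zscale N)} := kcor (annmap_subproof f).

Definition annfun : addfun A A.
Proof.
unshelve refine (@AddFun A A (fun M => kermod (zscale M)) annmap _ _ _).
- by move=> M x; apply: val_inj.
- by move=> M N P g f x; apply: val_inj.
- by move=> M N f g x; apply: val_inj.
Defined.

End Annihilator.

Section Corners.
Variables (k : comNzRingType) (n' : nat).
Let n := n'.+1.
Let R := ringR k n.
Let V := summands k n.
Let B := ringB k n.
Local Notation bscal := (@bscal k n').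
Local Notation yprod := (@yprod k n').
Local Notation single := (@single k n').
Local Notation idem := (@idem k n).

Lemma projP_single (m l : 'I_n) (b : projP k m) r :
  ((val b : B) : endo V) (single l r) = if m == l then r *: pval b else 0.
Proof.
rewrite -(projP_idem b) ringB_mulE idem_single; case: eqP => [_|_]; last exact: linear0.
by rewrite single1 linearZ_LR.
Qed.

Lemma pval_bscal (m : 'I_n) r (b : projP k m) : pval (bscal r *: b) = r *: pval b.
Proof. by []. Qed.

Lemma yprod_dvd t t' : (t <= t')%N -> exists c, yprod t' = c * yprod t.
Proof. by move=> tt'; apply: vprod_sub => j jt; apply: leq_trans tt'. Qed.

Lemma projP_killed (m : 'I_n) t (b : projP k m) : (m < t)%N -> bscal (yprod t) *: b = 0.
Proof.
move=> /yprod_dvd[c ->]; apply: pval_eq0.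
by rewrite pval_bscal -scalerA -xprod_yprod pval_xprod scaler0.
Qed.

Lemma yprodS (i : 'I_n) : yprod i.+1 = yprod i * var k i.
Proof.
rewrite /yprod -(vprod_ID k (fun j : 'I_n => (j < i.+1)%N) (fun j : 'I_n => (j < i)%N)).
congr (_ * _).
  by apply: eq_vprod => j; case: (ltnP j i) => ji; rewrite ?andbF ?andbT // ltnW.
rewrite -vprod1; apply: eq_vprod => j.
by rewrite ltnS -leqNgt -eqn_leq.
Qed.

Section Corner.
Variable i : 'I_n.
Let S : comPzRingType := qring (var k i).

Definition uprod : R := vprod k (fun j => j != i).
(* [ord_max] is the summand R itself. With [bscal (yprod i) * idem i] instead, [weta] on
   [projP i] would not be surjective unless [i] is [ord_max]. *)
Definition cg : B := bscal uprod * idem ord_max.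
Definition ca (s : S) : B := bscal (qrepr s).

Lemma var_uprod : var k i * uprod = 0.
Proof.
rewrite -[RHS](vprod_C k (fun j => j != i)) mulrC; congr (_ * _).
by rewrite -vprod1; apply: eq_vprod => j; rewrite negbK.
Qed.

Lemma bscal_cg r r' c : r - r' = c * var k i -> bscal r * cg = bscal r' * cg.
Proof.
move=> /eqP; rewrite subr_eq => /eqP ->; rewrite bscalD mulrDl /cg mulrA -bscalM -mulrA.
by rewrite var_uprod mulr0 bscal0 mul0r add0r.
Qed.

Lemma ca_qpi r : ca (qpi _ r) * cg = bscal r * cg.
Proof. by have [c cE] := qrepr_qpi (var k i) r; apply: (@bscal_cg _ _ c); rewrite cE addrC addKr. Qed.

Fact ca_central s b : ca s * b = b * ca s. Proof. exact: bscal_central. Qed.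
Fact caD s t : ca (s + t) * cg = (ca s + ca t) * cg.
Proof.
have [[{}s ->] [{}t ->]] := conj (qpi_surj s) (qpi_surj t).
by rewrite -qpiD mulrDl !ca_qpi bscalD mulrDl.
Qed.
Fact caM s t : ca (s * t) * cg = ca s * ca t * cg.
Proof.
have [[{}s ->] [{}t ->]] := conj (qpi_surj s) (qpi_surj t).
rewrite -qpiM -mulrA !ca_qpi [RHS]mulrA [_ * bscal t]ca_central -mulrA ca_qpi.
by rewrite [s * t]mulrC bscalM -mulrA.
Qed.
Fact ca1 : ca 1 * cg = cg.
Proof. by rewrite [ca 1 * _]ca_qpi bscal1 mul1r. Qed.

Definition cornerD : corner B S := Corner ca_central caD caM ca1.
Local Notation D := cornerD.

(** For [t <= i] the variables in [yprod t] all differ from [var i], so [yprod t] divides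
    [uprod]. *)
Lemma cg_killed (M : lmodType B) t (p : M) : (t <= i)%N ->
  bscal (yprod t) *: p = 0 -> cg *: p = 0.
Proof.
move=> ti yp; have [c cE] : exists c, uprod = c * yprod t.
  by apply: vprod_sub => j jt; rewrite -val_eqE neq_ltn (leq_trans jt ti).
rewrite /cg cE bscalM -mulrA [bscal (yprod t) * _]bscal_central mulrA.
by rewrite -scalerA yp scaler0.
Qed.

Lemma gmod_killed (M : lmodType B) t : (t <= i)%N ->
  (forall p : M, bscal (yprod t) *: p = 0) -> forall x : gmod D M, x = 0.
Proof.
move=> ti yM x; have [p ->] := gcls_surj x.
by apply/gcls_eq0; apply: cg_killed ti (yM p).
Qed.

Definition zprod (m : 'I_n) : R := vprod k (fun j : 'I_n => ~~ (j < m.+1)%N).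

Lemma xprod_zprod m : xprod k m * zprod m = 0.
Proof. by rewrite xprod_yprod; apply: vprod_C. Qed.

Lemma wgen_sig m : {b : projP k m | pval b = single ord_max (zprod m)}.
Proof.
apply: cid; apply: projP_elt; rewrite scale_single xprod_zprod.
by apply: dirsum_ext => j; rewrite /single; case: eqP.
Qed.
(* [wgen m] multiplies by the [var j] with [j > m], from R/(xprod m) to R; its class
   freely generates [gmod D (projP m)] over [S] when [i <= m]. *)
Definition wgen m : projP k m := sval (wgen_sig m).
Lemma pval_wgen m : pval (wgen m) = single ord_max (zprod m).
Proof. exact: svalP (wgen_sig m). Qed.

Lemma pval_cg m (b : projP k m) :
  pval (cg *: b) = single ord_max (uprod * qrepr (pval b ord_max)).
Proof. by rewrite pvalZ ringB_mulE bscalE idemE scale_single. Qed.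

(** The annihilator of [uprod] is generated by [var i], and for [i <= m] that variable does not
    occur in [zprod m]. *)
Lemma uz_prime (m : 'I_n) (r : R) : (i <= m)%N -> uprod * (zprod m * r) = 0 ->
  exists t, r = var k i * t.
Proof.
move=> im /vprod_ann[r' e]; apply: (@vprod_prime _ _ (fun j : 'I_n => ~~ (j < m.+1)%N) i _ r'); last first.
  rewrite [LHS]e; congr (_ * _); rewrite -vprod1.
  by apply: eq_vprod => j; rewrite negbK.
by rewrite negbK ltnS.
Qed.

(** Only the last entry of [pval b] survives multiplication by [cg]. It is killed by [xprod m],
    hence is a multiple of [zprod m]. *)
Lemma gcls_wgen m (b : projP k m) : exists s : S, gcls D b = s *: gcls D (wgen m).
Proof.
have [|r' e] := @vprod_ann _ _ (fun j : 'I_n => (j < m.+1)%N) (qrepr (pval b ord_max)).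
  apply: single_max_inj; rewrite -scale_single -idemE -linearZ_LR.
  by rewrite -[vprod _ _]/(yprod m.+1) -xprod_yprod pval_xprod linear0.
exists (qpi _ r'); rewrite -gclsZ; apply: gcls_eq.
rewrite -[LHS]/(cg *: b) -[RHS]/(cg *: (ca (qpi _ r') *: wgen m)).
rewrite scalerA -ca_central ca_qpi.
apply: projP_ext.
transitivity (r' *: pval (cg *: wgen m)); last by [].
 rewrite (pval_cg b) (pval_cg (wgen m)) pval_wgen.
rewrite scale_single e.
apply: (congr1 (single ord_max)).
rewrite qrepr_single_max.
by rewrite [RHS]mulrC -mulrA.
Qed.

Lemma wgen_regular (m : 'I_n) (s : S) : (i <= m)%N -> s *: gcls D (wgen m) = 0 -> s = 0.
Proof.
move=> im; rewrite -gclsZ => /gcls_eq0 e.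
have {}e : cg *: (ca s *: wgen m) = 0 by exact: e.
have {}e : qrepr s *: pval (cg *: wgen m) = 0.
  by rewrite scalerA -ca_central -scalerA in e; have := congr1 (@pval k n' m) e.
rewrite pval_cg pval_wgen qrepr_single_max scale_single in e.
have [|t tE] := @uz_prime m (qrepr s) im.
  by rewrite -(single_max_inj e) [RHS]mulrC -mulrA.
rewrite -[s]qreprK tE; apply/qpi_eqP; exists t.
by rewrite subr0 mulrC.
Qed.

Lemma gmod_projP (m : 'I_n) : (i <= m)%N -> exists (f : {linear S^o -> gmod D (projP k m)})
  (g : {linear gmod D (projP k m) -> S^o}), cancel f g /\ cancel g f.
Proof.
move=> im; have [||g [fg gf]] := linear_inverse (f := lscale (gcls D (wgen m))).
- by move=> s; apply: wgen_regular.
- by move=> y; have [b ->] := gcls_surj y; have [s ->] := gcls_wgen b; exists s.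
by exists (lscale (gcls D (wgen m))), g.
Qed.

Lemma fgproj_gmod (M : lmodType B) : fgproj M -> fgproj (gmod D M).
Proof.
move: M; apply: (fgproj_ind_projP (C := fun M => fgproj (gmod D M))) =>
  [M N MN|M N Mp Np||m].
- by apply: fgproj_retract; apply: (addfun_retract (gfun D)).
- apply: fgproj_retract (fgproj_pair Mp Np); exact: (addfun_pair (gfun D)).
- apply: fgproj_retract (fgproj_triv S); apply: retract_zero.
  by apply: (@addfun_eq0 _ _ (gfun D)) => x; apply: triv_eq0.
have [im|mi] := leqP i m.
  have [f [g [fg gf]]] := gmod_projP im.
  by apply: fgproj_retract (fgproj_regular S); exists g, f.
apply: fgproj_retract (fgproj_triv S); apply: retract_zero.
by apply: (gmod_killed (t := m.+1)) => // p; apply: projP_killed.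
Qed.

Lemma wmod_sum (Q : lmodType S) (w : wmod D Q) (I : Type) (r : seq I) (F : I -> B) :
  w (\sum_(j <- r) F j) = \sum_(j <- r) w (F j).
Proof. by elim/big_rec2: _ => [|j x y _ <-]; rewrite ?wfun0 // wfunD. Qed.

Lemma leftideal_elt (b : B) m : exists p : projP k m, val p = b * idem m :> B.
Proof. by exists (leftideal_proj (idem m : B) b). Qed.

(** Decompose [b] along the idempotents: the part in [projP m] has the same class as a multiple of
    [wgen m], and its class vanishes when [m < i]. *)
Lemma wmod_wgen_ext (Q : lmodType S) (v w : wmod D Q) :
  (forall m : 'I_n, (i <= m)%N -> v (val (wgen m)) = w (val (wgen m))) -> v = w.
Proof.
move=> vw; apply: wmod_ext => b; rewrite -[b]mulr1 -sum_idem mulr_sumr !wmod_sum.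
apply: eq_bigr => m _; have [p <-] := leftideal_elt b m.
have [im|mi] := leqP i m.
  have [s sE] := gcls_wgen p.
  have e : cgen D * (val p : B) = cgen D * (cact D s * (val (wgen m) : B)).
    rewrite -gclsZ in sE.
    by rewrite -!leftideal_valZ (gcls_val sE).
  by rewrite !(wfun_eq _ e) !wfunZ vw.
have e : cg * (val p : B) = 0.
  have : cg *: p = 0 by apply: (cg_killed (t := m.+1)) => //; apply: projP_killed.
  by move=> p0; rewrite -leftideal_valZ p0.
by rewrite !wfun_ker.
Qed.

(** The submodule killed by [yprod i] dies by [cg_killed]. Conversely, evaluating at each [wgen l]
    turns the vanishing into divisibility relations for the entries of [pval b]. *)
Lemma weta_projP_ker (b : projP k i) : weta D (projP k i) b = 0 <-> bscal (yprod i) *: b = 0.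
Proof.
split=> [b0|b0]; last first.
  apply: wmod_ext => b'; apply/gcls_eq0; apply: (cg_killed (t := i)) => //.
  by rewrite scalerA bscal_central -scalerA b0 scaler0.
apply: pval_eq0; rewrite pval_bscal; set v := pval b.
have vi : xprod k i *: v = 0 by exact: pval_xprod.
apply: dirsum_ext => l; rewrite -[LHS]/(yprod i *: v l) -[v l]qreprK -qpiZ.
(* For [l < i] there is nothing to extract: [xprod l] divides [yprod i]. *)
have [il|li] := leqP i l; last first.
  have [c ->] := yprod_dvd li; apply/qpi_eqP; exists (c * qrepr (v l)).
  by rewrite subr0 -xprod_yprod mulrAC.
set r := qrepr (v l).
have wv : ((val (wgen l) : B) : endo V) v = single ord_max (r * zprod l).
  rewrite -[wgen l in LHS]/(wgen l) -(projP_idem (wgen l)) ringB_mulE idemE.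
  by rewrite projP_single eqxx pval_wgen scale_single.
have ur : uprod * (r * zprod l) = 0.
  have /(congr1 (fun w : wmod D _ => w (val (wgen l)))) /gcls_eq0 e := b0.
  have {}e : pval (cg *: ((val (wgen l) : B) *: b)) = 0 by rewrite [_ *: (_ *: _)]e.
  apply: single_max_inj; rewrite -e pval_cg pvalZ wv.
  by rewrite qrepr_single_max.
have xr : xprod k i * (r * zprod l) = 0.
  have : qpi (xprod k l) (xprod k i * r) = 0.
    by rewrite qpiZ qreprK -[LHS]/((xprod k i *: v) l) vi.
  move/qpi_eqP => [c]; rewrite subr0 => e.
  by rewrite mulrA e -mulrA xprod_zprod mulr0.
(* [xr] makes [r * zprod l] a multiple of [zprod i], and [ur] makes the cofactor divisible by
   [var i]. As [yprod i * var i = xprod i] annihilates [zprod i], the product [yprod i * r] is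
   killed by [zprod l], hence is a multiple of [xprod l]. *)
have [r' r'E] : exists r', r * zprod l = zprod i * r'.
  by apply: (@vprod_ann _ _ (fun j : 'I_n => (j < i.+1)%N)); rewrite -xr xprod_yprod.
have [|t tE] := @uz_prime i r' (leqnn i); first by rewrite -r'E.
have yz : zprod l * (yprod i * r) = 0.
  rewrite mulrCA [zprod l * r]mulrC r'E tE [zprod i * _]mulrCA mulrA -yprodS.
  by rewrite -xprod_yprod mulrA xprod_zprod mul0r.
have [s sE] := vprod_ann yz; apply/qpi_eqP; exists s.
rewrite subr0 sE mulrC xprod_yprod; congr (_ * _).
by apply: eq_vprod => j; rewrite negbK.
Qed.

Lemma wgen_apply l (v : V) :
  ((val (wgen l) : B) : endo V) v = single ord_max (qrepr (v l) * zprod l).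
Proof.
rewrite -(projP_idem (wgen l)) ringB_mulE idemE.
by rewrite projP_single eqxx pval_wgen scale_single.
Qed.

(** [w] is given by the scalars [s l] with [w (wgen l) = s l *: gcls (wgen i)], for [i <= l]; a
    preimage is written down entry by entry. *)
Lemma weta_projP_surj (w : wmod D (gmod D (projP k i))) :
  exists b, weta D (projP k i) b = w.
Proof.
have sP (l : 'I_n) : exists s : S, w (val (wgen l)) = s *: gcls D (wgen i).
  by have [b ->] := gcls_surj (w (val (wgen l))); apply: gcls_wgen.
have [s sE] : exists s : 'I_n -> S, forall l, w (val (wgen l)) = s l *: gcls D (wgen i).
  by exists (fun l => projT1 (cid (sP l))) => l; case: cid.
(* Chosen so that [xprod i * vm l = xprod l], which puts [v] in the image of [pval], and
   [vm l * zprod l = zprod i], which gives the prescribed value on [wgen l]. *)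
pose vm (l : 'I_n) : R := vprod k (fun j => (j < l.+1)%N && ~~ (j < i.+1)%N).
pose v : V := fun j => if (i <= j)%N then qpi (xprod k j) (qrepr (s j) * vm j) else 0.
have [|b bE] := @projP_elt k n' i v.
  apply: dirsum_ext => l; rewrite -[LHS]/(xprod k i *: v l) /v.
  case: leqP => [il|_]; last exact: scaler0.
  rewrite -qpiZ; apply/qpi_eqP; exists (qrepr (s l)); rewrite subr0 mulrCA.
  congr (_ * _); rewrite !xprod_yprod /yprod.
  rewrite -(vprod_ID k (fun j : 'I_n => (j < l.+1)%N) (fun j : 'I_n => (j < i.+1)%N)).
  congr (_ * _); apply: eq_vprod => j.
  by case: (ltnP j i.+1) => ji; rewrite ?andbF ?andbT // (leq_trans ji).
exists b; apply: wmod_wgen_ext => l il.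
rewrite sE -[LHS]/(gcls D ((val (wgen l) : B) *: b)) -gclsZ; congr (gcls D _).
apply: projP_ext; rewrite pvalZ wgen_apply bE /v il.
have [c ->] := qrepr_qpi (xprod k l) (qrepr (s l) * vm l).
rewrite mulrDl -[c * _ * _]mulrA xprod_zprod mulr0 addr0.
transitivity (qrepr (s l) *: pval (wgen i)); last by [].
rewrite pval_wgen scale_single -mulrA; congr (single _ (_ * _)).
rewrite /zprod -(vprod_ID k (fun j : 'I_n => ~~ (j < i.+1)%N) (fun j : 'I_n => (j < l.+1)%N)).
congr (_ * _); apply: eq_vprod => j; first exact: andbC.
case: (ltnP j l.+1) => jl; rewrite ?andbF ?andbT //.
by rewrite -leqNgt (leq_trans _ jl).
Qed.

End Corner.
End Corners.

(** * The filtration by annihilators *)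

Section Filtration.
Variables (k : comNzRingType) (n' : nat).
Let n := n'.+1.
Let R := ringR k n.
Let V := summands k n.
Let B := ringB k n.
Local Notation yprod := (@yprod k n').
Local Notation bscal := (@bscal k n').

Definition filt (t : nat) : addfun B B := annfun (bscal_central (yprod t)).
Definition fincl t (M : lmodType B) : {linear filt t M -> M} :=
  kincl (zscale (bscal_central (yprod t)) M).

Lemma finclP t M (x : filt t M) : bscal (yprod t) *: fincl t M x = 0.
Proof. exact: kinclP x. Qed.

Lemma fincl_inj t M (x y : filt t M) : fincl t M x = fincl t M y -> x = y.
Proof. exact: kincl_inj. Qed.

Lemma fincl_ex t (M : lmodType B) (y : M) : bscal (yprod t) *: y = 0 ->
  exists x, fincl t M x = y.
Proof. exact: (@kincl_ex _ _ _ (zscale (bscal_central (yprod t)) M)). Qed.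

Lemma fincl_nat t (M N : lmodType B) (f : {linear M -> N}) x :
  fincl t N (fm (filt t) f x) = f (fincl t M x).
Proof. by []. Qed.

Fact fstep_subproof t t' (tt' : (t <= t')%N) (M : lmodType B) (x : filt t M) :
  zscale (bscal_central (yprod t')) M (fincl t M x) = 0.
Proof.
have [c ->] := @yprod_dvd k n' _ _ tt'.
by rewrite /= bscalM -scalerA; have /= -> := finclP x; rewrite scaler0.
Qed.
Definition fstep t t' (tt' : (t <= t')%N) (M : lmodType B) : {linear filt t M -> filt t' M} :=
  kcor (fstep_subproof tt' (M := M)).

Lemma fstepE t t' (tt' : (t <= t')%N) (M : lmodType B) x :
  fincl t' M (fstep tt' M x) = fincl t M x.
Proof. by []. Qed.

Lemma filt_all t (M : lmodType B) : (forall x : M, bscal (yprod t) *: x = 0) ->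
  exists g : {linear M -> filt t M}, cancel (fincl t M) g /\ cancel g (fincl t M).
Proof.
move=> yM; have [||g [fg gf]] := linear_inverse (f := fincl t M).
- by move=> x x0; apply: fincl_inj; rewrite x0 linear0.
- by move=> y; apply: fincl_ex.
by exists g.
Qed.

Lemma filt0 (M : lmodType B) (x : filt 0 M) : x = 0.
Proof. by apply: fincl_inj; have := finclP x; rewrite yprod0 bscal1 scale1r => ->. Qed.

(** Under [pval] both modules are the vectors killed by [xprod j = yprod j.+1], since [xprod j]
    divides [xprod m]. *)
Lemma filt_projP (j m : 'I_n) : (j <= m)%N ->
  exists (f : {linear projP k j -> filt j.+1 (projP k m)})
    (g : {linear filt j.+1 (projP k m) -> projP k j}),
  [/\ cancel f g, cancel g f & forall b, pval (fincl _ _ (f b)) = pval b].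
Proof.
move=> jm.
have aK b : zscale (bscal_central (yprod j.+1)) (projP k m) (alpha k jm b) = 0.
  rewrite -[LHS]/(bscal (yprod j.+1) *: alpha k jm b) -linearZ_LR projP_killed //.
  exact: linear0.
pose f := kcor aK.
have fE b : fincl j.+1 (projP k m) (f b) = alpha k jm b by [].
have [||g [fg gf]] := linear_inverse (f := f).
- move=> b b0; apply: (@alpha_inj k n j m jm).
  by rewrite -fE b0 !linear0.
- move=> y; have [|b bE] := @alpha_image k n' j m jm (fincl _ _ y).
    by rewrite xprod_yprod -pval_bscal finclP.
  by exists b; apply: fincl_inj; rewrite fE -bE.
by exists f, g; split=> // b; rewrite fE pval_alpha.
Qed.

Lemma fgproj_filt t (M : lmodType B) : fgproj M -> fgproj (filt t M).
Proof.
move: M; apply: (fgproj_ind_projP (C := fun M => fgproj (filt t M))) => [M N MN|M N Mp Np||m].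
- by apply: fgproj_retract; apply: addfun_retract.
- apply: fgproj_retract (fgproj_pair Mp Np); exact: addfun_pair.
- apply: fgproj_retract (fgproj_triv B); apply: retract_zero.
  by apply: addfun_eq0 => x; apply: triv_eq0.
have [mt|tm] := ltnP m t.
  have [g [fg gf]] := filt_all (fun x : projP k m => @projP_killed k n' m t x mt).
  by apply: fgproj_retract (fgproj_projP k m); exists (fincl t (projP k m)), g.
case: t tm => [_|t tm].
  by apply: fgproj_retract (fgproj_triv B); apply: retract_zero; apply: filt0.
have tn : (t < n)%N by rewrite (leq_trans tm) // ltnW.
have [f [g [fg gf _]]] := @filt_projP (Ordinal tn) m (ltnW tm).
by apply: fgproj_retract (fgproj_projP k (Ordinal tn)); exists g, f.
Qed.

(** Removes the case distinction in [Pbar]: for [i = 0] the kernel is zero because [yprod 0 = 1],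
    otherwise it is the image of [alpha]. *)
Lemma Pbar_quotient (i : 'I_n) : exists p : {linear projP k i -> Pbar k i},
  (forall y, exists x, p x = y) /\ (forall b, p b = 0 <-> bscal (yprod i) *: b = 0).
Proof.
case: i => [[|m] lt].
  exists (lid _); split=> [y|b]; first by exists y.
  by rewrite yprod0 bscal1 scale1r.
pose j : 'I_n := Ordinal (ltnW lt); pose i : 'I_n := Ordinal lt.
pose ji : (j <= i)%N := leqnSn m.
pose q : {linear projP k i -> coker (@alpha k n j i ji)} := coker_pi (@alpha k n j i ji).
exists q; split=> [y|b].
  by have [x ->] := coker_surj y; exists x.
have -> : yprod i = xprod k j by rewrite xprod_yprod.
split=> [b0|b0].
  have [a] : exists a, b - 0 = alpha k ji a.
    by apply/coker_eqP; rewrite -[LHS]/(q b) -[RHS]/(q 0) linear0.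
  rewrite subr0 => ->; rewrite -linearZ_LR xprod_yprod projP_killed ?linear0 //.
have [|a aE] := @alpha_image k n' j i ji b.
  by have := congr1 (@pval k n' i) b0.
rewrite -[RHS](linear0 q); apply/coker_eqP.
by exists a; rewrite subr0.
Qed.

Lemma Pbar_exact (i : 'I_n) : exists p : {linear projP k i -> Pbar k i},
  short_exact (fincl i (projP k i)) p.
Proof.
have [p [pS pK]] := Pbar_quotient i; exists p; split=> //.
- by move=> x x0; apply: fincl_inj; rewrite x0 linear0.
- by move=> x; apply/pK; exact: finclP.
- by move=> y /pK/fincl_ex[x <-]; exists x.
Qed.

Definition kres (i : 'I_n) : complex B := two_term (fincl i (projP k i)).

Lemma kres_perfect i : perfect (kres i).
Proof.
by apply: perfect_two_term; [apply: fgproj_filt|]; apply: fgproj_projP.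
Qed.

Lemma kres_resolution i : projective_resolution (kres i) (Pbar k i).
Proof.
have [p pE] := Pbar_exact i; apply: two_term_resolution pE.
  by have [] := fgproj_filt i (fgproj_projP k i).
by have [] := fgproj_projP k i.
Qed.

Lemma kres_hull i : inT (module_hull (Pbar k i)) (kres i).
Proof.
exists (kres_perfect i); apply: module_hull_resolution; exact: kres_resolution.
Qed.

Lemma weta_exact (i : 'I_n) :
  short_exact (fincl i (projP k i)) (weta (cornerD k i) (projP k i)).
Proof.
split.
- by move=> x x0; apply: fincl_inj; rewrite x0 linear0.
- by move=> x; apply/weta_projP_ker; exact: finclP.
- by move=> y /weta_projP_ker/fincl_ex[x <-]; exists x.
- exact: weta_projP_surj.
Qed.

Lemma conc_killed (U : lmodType B) t j (x : conc U j) :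
  (forall y : U, bscal (yprod t) *: y = 0) -> bscal (yprod t) *: x = 0.
Proof. by move=> Uy; case: j x => [[|j]|j] x; [exact: Uy|exact: triv_eq0..]. Qed.

Lemma filt_killed t (M : lmodType B) (x : filt t M) : bscal (yprod t) *: x = 0.
Proof. by apply: fincl_inj; rewrite linearZ_LR finclP linear0. Qed.

(** Outside degree 0 the terms lie in the part killed by [yprod i]; [projP i], in degree 0, is only
    killed from [yprod i.+1] on. *)
Lemma kres_killed i t j (x : kres i j) : (i <= t)%N -> (j != 0) || (i < t)%N ->
  bscal (yprod t) *: x = 0.
Proof.
move=> it jt; case: x => a b; congr pair.
  apply: (@conc_killed _ t (j + 1) a) => y.
  have [c ->] := @yprod_dvd k n' _ _ it.
  by rewrite bscalM -scalerA filt_killed scaler0.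
have [j0|j0] := eqVneq j 0.
  by apply: (@conc_killed _ t j b) => y; apply: projP_killed; move: jt; rewrite j0.
by rewrite (conc_eq0 b j0) scaler0.
Qed.

Section Hull.
Variable i : 'I_n.
Let T := module_hull (Pbar k i).
Let HT : triangulated T := module_hull_triangulated (Pbar k i).
Let HS : summand_closed T := @module_hull_summand_closed _ (Pbar k i).

Lemma fstep_hull (M : lmodType B) : fgproj M -> inT T (two_term (fstep (leqnSn i) M)).
Proof.
have tp (M' : lmodType B) : fgproj M' -> perfect (two_term (fstep (leqnSn i) M')).
  by move=> M'p; apply: perfect_two_term; apply: fgproj_filt.
(* The induction carries [fgproj M] along, because closure under retracts and products needs perfect
   two-term complexes. *)
move=> Mp; suff : fgproj M /\ inT T (two_term (fstep (leqnSn i) M)) by case.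
move: M Mp; apply: (fgproj_ind_projP
    (C := fun M => fgproj M /\ inT T (two_term (fstep (leqnSn i) M)))).
- move=> M N MN [Np NT]; have Mp := fgproj_retract MN Np; split=> //.
  have [s [r rs]] := MN.
  apply: (inT_two_term_retract HS (a := fm (filt i) s) (b := fm (filt i.+1) s)
    (a' := fm (filt i) r) (b' := fm (filt i.+1) r)) (tp _ Mp) NT => x.
  + by apply: fincl_inj.
  + by apply: fincl_inj.
  + by apply: fincl_inj; rewrite !fincl_nat rs.
  + by apply: fincl_inj; rewrite !fincl_nat rs.
- move=> M N [Mp MT] [Np NT]; have MNp := fgproj_pair Mp Np; split=> //.
  have wp : perfect (two_term (lpair (lcomp (fstep (leqnSn i) M) (lfst _ _))
      (lcomp (fstep (leqnSn i) N) (lsnd _ _)))).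
    by apply: perfect_two_term; apply: fgproj_pair; apply: fgproj_filt.
  have H := inT_two_term_pair HT MT NT wp.
  apply: (inT_two_term_retract HS _ _ (@addfun_pairK _ _ (filt i) M N)
    (@addfun_pairK _ _ (filt i.+1) M N)) (tp _ MNp) H => x.
  + by congr pair; apply: fincl_inj.
  + by apply: fincl_inj.
- have z t (x : filt t (triv B)) : x = 0 by apply: addfun_eq0 => y; apply: triv_eq0.
  split; first exact: fgproj_triv.
  apply: (inT_acyclic HT); first exact/tp/fgproj_triv.
  apply: two_term_acyclic => [x _|y]; first exact: z.
  by exists 0; rewrite linear0 [RHS]z.
move=> m; have mp := fgproj_projP k m; split=> //.
have s0 x : fstep (leqnSn i) (projP k m) x = 0 -> x = 0.
  by move=> /(congr1 (fincl _ _)); rewrite fstepE linear0 => x0; apply: fincl_inj; rewrite x0 linear0.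
have [im|mi] := leqP i m; last first.
  apply: (inT_acyclic HT); first exact: tp.
  apply: (two_term_acyclic s0) => y.
  have [|x xE] := @fincl_ex i (projP k m) (fincl _ _ y); first exact: projP_killed.
  by exists x; apply: fincl_inj; rewrite fstepE.
(* For [i <= m] the two-term complex is itself a resolution of [Pbar i]: [filt i.+1] of [projP m] is
   a copy of [projP i], and [gk] matches the parts killed by [yprod i]. *)
have [f [g [fg gf fE]]] := filt_projP im; have [p [p0 pc pe pS]] := Pbar_exact i.
have tpm := tp _ mp; exists tpm; apply: module_hull_resolution.
apply: (two_term_resolution (p := lcomp p g)).
- by have [] := fgproj_filt i mp.
- by have [] := fgproj_filt i.+1 mp.
have gk y : bscal (yprod i) *: fincl _ _ y = 0 <-> bscal (yprod i) *: g y = 0.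
  split=> [y0|gy0].
    have y0' : bscal (yprod i) *: y = 0 by apply: fincl_inj; rewrite linearZ_LR y0 linear0.
    by rewrite -linearZ_LR y0' linear0.
  by rewrite -(gf y) -(linearZ_LR (fincl _ _)) -(linearZ_LR f) gy0 !linear0.
split.
- exact: s0.
- move=> x; have [|z zE] := @fincl_ex i (projP k i) (g (fstep (leqnSn i) (projP k m) x)).
    by apply/gk; rewrite fstepE finclP.
  by rewrite /= -zE pc.
- move=> y /= /pe[x xE].
  have [|z zE] := @fincl_ex i (projP k m) (fincl _ _ y).
    by apply/gk; rewrite xE finclP.
  by exists z; apply: fincl_inj; rewrite fstepE zE.
- by move=> z; have [b <-] := pS z; exists (f b); rewrite /= fg.
Qed.

End Hull.
End Filtration.

(** * Orthogonality, generation and equivalences *)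

Section Components.
Variables (k : comNzRingType) (n' : nat).
Let n := n'.+1.
Let V := summands k n.
Let B := ringB k n.
Local Notation yprod := (@yprod k n').
Local Notation bscal := (@bscal k n').
Local Notation single := (@single k n').

Lemma kres_gmod0 (i j : 'I_n) (p : int) : (j <= i)%N -> (p != 0) || (j < i)%N ->
  forall x : gmod (cornerD k i) (kres k j p), x = 0.
Proof.
move=> ji pj; apply: (gmod_killed (t := i)) => // x.
exact: kres_killed.
Qed.

Lemma kres_unit (i : 'I_n) : qis (corner_unit (cornerD k i) (kres k i)).
Proof.
have [u0 wu we wS] := weta_exact k i.
have K0 (p : int) : p != 0 -> forall x : kres k i p, cdiff (kres k i) p x = 0 -> x = 0.
  move=> p0 [a b]; rewrite two_termE => /(congr1 snd) ab.
  congr pair; last exact: conc_eq0.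
  exact: (conc_lin_inj u0 ab).
have W0 (p : int) : p != 0 -> forall y : wmod (cornerD k i) (gmod (cornerD k i) (kres k i p)), y = 0.
  move=> p0; apply: (@addfun_eq0 _ _ (dualfun (cornerD k i))).
  by apply: kres_gmod0; rewrite ?p0.
pose U := filt k n' i (projP k i).
(* The degree 0 term is [projP i] times a zero module; [pr] and [inj] carry [weta_exact] over to
   it. *)
pose pr : {linear kres k i 0 -> projP k i} := lsnd (conc U (0 + 1)) (conc (projP k i) 0).
pose inj : {linear projP k i -> kres k i 0} :=
  lpair (lzero (projP k i) (conc U (0 + 1))) (lid (projP k i)).
have injpr x : inj (pr x) = x.
  by case: x => a b; congr pair; apply/esym/conc_eq0.
pose WG := addfun_comp (dualfun (cornerD k i)) (gfun (cornerD k i)).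
split=> p.
  move=> x dx [y xy]; have [p0|p0] := eqVneq (p + 1) 0; last first.
    by exists 0; rewrite linear0; apply: K0 dx.
  have ep : p = -1 by apply/eqP; rewrite -addr_eq0 p0.
  (* The target vanishes in degree -1, so [xy] now says that the unit kills [x]. *)
  subst p; rewrite (W0 (-1) isT y) linear0 in xy.
  have wx : weta (cornerD k i) (projP k i) (pr x) = 0.
    have := weta_nat (cornerD k i) pr x.
    rewrite -[weta _ (kres k i 0) x]/(corner_unit (cornerD k i) (kres k i) (-1 + 1) x) xy.
    by rewrite linear0.
  have [z zE] := we _ wx.
  exists (z, 0); rewrite two_termE -[LHS]injpr.
  by congr pair; rewrite zE.
move=> y dy; have [p0|p0] := eqVneq (p + 1) 0; last first.
  by exists 0, 0; rewrite !linear0 addr0 (W0 _ p0 y).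
have ep : p = -1 by apply/eqP; rewrite -addr_eq0 p0.
subst p; have [b bE] := wS (fm WG pr y).
exists (inj b), 0; split.
  by rewrite two_termE; congr pair; exact: linear0.
rewrite linear0 addr0 -[RHS]/(weta (cornerD k i) (kres k i 0) (inj b)) weta_nat bE.
rewrite -[LHS](@fm_id _ _ WG) -(@fm_comp _ _ WG).
by apply: (@fm_ext _ _ WG) => x; apply/esym/injpr.
Qed.

Lemma hull_unit (i : 'I_n) (X : perf B) : module_hull (Pbar k i) X ->
  qis (corner_unit (cornerD k i) X).
Proof.
have [Ht Hs] := corner_unit_thick (cornerD k i).
move=> XT; apply: (XT (fun X : perf B => qis (corner_unit (cornerD k i) X)) Ht Hs) => Y YR.
have [_ H _ _] := Ht.
apply: (H (Perf (kres_perfect k i)) Y _ (kres_unit i)).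
exact: resolution_unique (kres_resolution k i) YR.
Qed.

Lemma hull_acyclic (i j : 'I_n) (X : perf B) : (j < i)%N -> module_hull (Pbar k j) X ->
  acyclic (fcx (gfun (cornerD k i)) X).
Proof.
move=> ji XT; have Ht := acyclic_triangulated (gfun (cornerD k i)).
apply: (XT (fun X : perf B => acyclic (fcx (gfun (cornerD k i)) X)) Ht
  (@acyclic_summand_closed _ _ _)) => Y YR.
have [_ H _ _] := Ht; apply: (H (Perf (kres_perfect k j)) Y).
  exact: resolution_unique (kres_resolution k j) YR.
move=> p x _; exists 0; rewrite linear0.
by apply: kres_gmod0; rewrite ?ji ?orbT ?(ltnW ji).
Qed.

Lemma hull_orthogonal (i j : 'I_n) (X Y : perf B) : (j < i)%N ->
  module_hull (Pbar k j) X -> module_hull (Pbar k i) Y -> Hom_vanish X Y.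
Proof.
move=> ji; move: X Y; apply: Hom_vanish_triangulated.
- exact: module_hull_triangulated.
- exact: module_hull_triangulated.
move=> X Y f XT YT; apply: (corner_hom_null (D := cornerD k i)).
- exact: fgproj_gmod.
- exact: hull_acyclic ji XT.
- exact: hull_unit.
Qed.

Lemma hulls_generate (T : perf B -> Prop) : triangulated T ->
  (forall (i : 'I_n) (X : perf B), module_hull (Pbar k i) X -> T X) -> forall X, T X.
Proof.
move=> HT HP; apply: (triangulated_all HT) => P Pp.
have Fp t := fgproj_filt t Pp.
(* The filtration runs from [filt 0 P], which is zero, to [filt n P], which is all of [P] because
   [yprod n = 0]. *)
suff H : forall t, (t <= n)%N -> inT T (conc (filt k n' t P)).
  apply: (inT_qis HT (f := conc_map (fincl n P)) _ _ (H n (leqnn n))).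
    exact: perfect_conc.
  apply: bijective_qis => j.
    by apply: conc_lin_inj => x x0; apply: fincl_inj; rewrite x0 linear0.
  apply: conc_lin_surj => y; apply: fincl_ex.
  by rewrite yprod_last // bscal0 scale0r.
elim=> [_|t IH tn].
  apply: (inT_acyclic HT (perfect_conc (Fp 0%N))) => j x _; exists 0.
  rewrite linear0; move: (j + 1) x => l x.
  rewrite -[LHS]conc_lin_id -[RHS](conc_lin_zero (filt k n' 0 P) x).
  by apply: conc_lin_ext => y; rewrite [y]filt0 !linear0.
have [q Tq] := fstep_hull (Ordinal tn) Pp.
apply: (inT_target HT (f := conc_map (fstep (leqnSn t) P)) (perfect_conc (Fp _))
  (IH (ltnW tn))).
by exists q; apply: HP Tq.
Qed.

Section Equivalence.
Variable i : 'I_n.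
Let S : comPzRingType := qring (var k i).
Let D := cornerD k i.
Let T := module_hull (Pbar k i).

(** For [Q = S] use that [S] is [G (projP i)]: by [weta_exact], the complex [kres i] then resolves
    [W S]. *)
Lemma hull_resolved (Q : lmodType S) : fgproj Q -> resolved_in T (wmod D Q).
Proof.
have HT := module_hull_triangulated (Pbar k i).
have HS := @module_hull_summand_closed _ (Pbar k i).
move: Q; apply: (fgproj_ind (C := fun Q => resolved_in T (wmod D Q))) => [M N MN|M N MT NT||].
- by apply: resolved_in_retract => //; apply: (addfun_retract (dualfun D)).
- apply: (resolved_in_retract HS (M := wmod D (M * N)%type)
    (N := (wmod D M * wmod D N)%type)).
    exact: (addfun_pair (dualfun D)).
  exact: resolved_in_pair.
- apply: (resolved_in_retract HS (M := wmod D (triv S)) _ (resolved_in_triv HT)).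
  apply: retract_zero.
  by apply: (addfun_eq0 (F := dualfun D)) => x; apply: triv_eq0.
have [f [g [fg gf]]] := @gmod_projP k n' i i (leqnn i).
apply: (resolved_in_retract HS (N := wmod D (gmod D (projP k i)))).
  by apply: (addfun_retract (dualfun D)); exists f, g.
exists (filt k n' i (projP k i)), (projP k i), (fincl i (projP k i)), (weta D (projP k i)).
split; [exact/fgproj_filt/fgproj_projP|exact: fgproj_projP|exact: weta_exact|].
exact: kres_hull.
Qed.

Lemma qrepr_max0 (c r s : ringR k n) : r - s = c * xprod k (ord_max : 'I_n) -> r = s.
Proof. by rewrite xprod_max mulr0 => /eqP; rewrite subr_eq0 => /eqP. Qed.

Lemma qreprD_max (x y : qring (xprod k (ord_max : 'I_n))) :
  qrepr (x + y) = qrepr x + qrepr y.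
Proof.
have [c] : exists c, qrepr (x + y) - (qrepr x + qrepr y) = c * xprod k (ord_max : 'I_n).
  by apply/qpi_eqP; rewrite qpiD !qreprK.
exact: qrepr_max0.
Qed.

Lemma qreprZ_max r (x : qring (xprod k (ord_max : 'I_n))) :
  qrepr (r *: x) = r * qrepr x.
Proof.
have [c] : exists c, qrepr (r *: x) - r * qrepr x = c * xprod k (ord_max : 'I_n).
  by apply/qpi_eqP; rewrite qpiZ !qreprK.
exact: qrepr_max0.
Qed.

(** The matrix entry of [b] from the last summand to itself, an element of [R], reduced modulo
    [var i]. *)
Definition kap_fun (b : B) : S^o := qpi _ (qrepr ((b : endo V) (single ord_max 1) ord_max)).

Fact kap_funD a b : kap_fun (a + b) = kap_fun a + kap_fun b.
Proof. by rewrite /kap_fun -[RHS]qpiD -qreprD_max. Qed.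
Fact kap_funZ s b : kap_fun (cact D s * b) = s *: kap_fun b.
Proof.
rewrite /kap_fun -[RHS]/(s * qpi _ _) -{2}[s]qreprK -qpiM -qreprZ_max.
by [].
Qed.
Fact kap_fun_ker b : cgen D * b = 0 -> kap_fun b = 0.
Proof.
move=> cb; set v := (b : endo V) (single ord_max 1).
have ub : single ord_max (uprod k i * qrepr (v ord_max)) = 0.
  rewrite -scale_single -idemE.
  by rewrite -[LHS]/(((cgen D * b : B) : endo V) (single ord_max 1)) cb.
have [r' r'E] := vprod_ann (single_max_inj ub).
rewrite /kap_fun -/v r'E; apply/qpi_eqP; exists r'; rewrite subr0 mulrC; congr (_ * _).
by rewrite -vprod1; apply: eq_vprod => j; rewrite negbK.
Qed.
Definition kap : wmod D (S^o) := Wmod kap_funD kap_funZ kap_fun_ker.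

Lemma kap1 : kap 1 = 1.
Proof. by rewrite -[LHS]/(qpi _ (qrepr (single ord_max 1 ord_max))) qrepr_single_max. Qed.

Lemma hull_equivalent : perf_equivalent
  (fun c : k => qpi (var k i) (cst n c) : S)
  (fun c : k => homothety (summands k n) (cst n c)) T.
Proof.
apply: (corner_equivalence (D := D) _ _ _ _ _ _ _ kap1).
- exact: module_hull_triangulated.
- exact: fgproj_gmod.
- exact: hull_unit.
- exact: hull_resolved.
- by move=> c s; apply: mulrC.
- by move=> c b; apply: bscal_central.
- by move=> c; apply: ca_qpi.
Qed.

End Equivalence.
End Components.

(** * Extensions between the modules [Pbar i] *)

Section Ext.
Variables (k : comNzRingType) (n' : nat) (i : 'I_n'.+1).
Let n := n'.+1.
Let V := summands k n.
Let B := ringB k n.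
Local Notation yprod := (@yprod k n').
Local Notation bscal := (@bscal k n').
Local Notation single := (@single k n').
Let N := Pbar k i.

(** The unit of [projP i] factors through an injection of [N] into [W (G (projP i))], and by
    adjunction a map from [M] into this module comes from a map out of [G M = 0]. *)
Lemma Pbar_hom0 (M : lmodType B) (f : {linear M -> N}) : fgproj M ->
  (forall x : gmod (cornerD k i) M, x = 0) -> forall x, f x = 0.
Proof.
move=> Mp M0; have [p [p0 pp pe pS]] := Pbar_exact k i.
have [w0 wp we wS] := weta_exact k i.
have [|v vE] := linear_factor (p := p) (w := weta (cornerD k i) (projP k i)) pS.
  by move=> b /pe[z ->]; apply: wp.
have [g gE] := weta_adjoint (lcomp v f) Mp.
move=> x; have [b bE] := pS (f x).
have /we[z zE] : weta (cornerD k i) (projP k i) b = 0.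
  rewrite -vE bE -[LHS]/(lcomp v f x) gE; apply: wmod_ext => b'.
  by rewrite -[LHS]/(g (gcls (cornerD k i) (b' *: x))) (M0 (gcls _ _)) linear0.
by rewrite -bE zE pp.
Qed.

(** Compare [X] with [kres i], whose terms outside degree 0 have no nonzero map to [N]. A cocycle
    thus vanishes on the image of [kres i], and the homotopy between [g u] and the identity displays
    it as a coboundary. *)
Lemma Pbar_Ext_vanish (m : int) : m != 0 -> Ext_vanish N N m.
Proof.
move=> m0 X XR f [fl fd]; pose F := mklin fl.
have [u [g [[h hE] _]]] := resolution_unique XR (kres_resolution k i).
have jn : - m - 1 + 1 != 0 by rewrite subrK oppr_eq0.
have z0 := Pbar_hom0 (lcomp F (g (- m - 1 + 1))) (proj2 (kres_perfect k i) _)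
  (kres_gmod0 (leqnn i) (introT orP (or_introl jn))).
exists (lopp (lcomp F (h (- m - 1 + 1)))) => x.
have := congr1 F (hE _ x); rewrite linearB linearD.
rewrite -[F (chmap_comp g u _ x)]/(lcomp F (g (- m - 1 + 1)) (u _ x)) z0.
rewrite -[F (cdiff _ _ _)]/(f (cdiff _ _ _)) fd => e.
rewrite -[LHS]/(F x) -[RHS]/(- F (h (- m - 1 + 1) (cdiff X (- m - 1 + 1) x))).
by rewrite -[F x]/(F (chmap_id X _ x)); abel using e.
Qed.

Lemma projP_unit_ex : exists e : projP k i, pval e = single i 1.
Proof. by apply: projP_elt; apply: single_xprod. Qed.

(** [x] is the class of the idempotent. As [x] generates [N] and [idem i *: N] consists of the
    [R]-multiples of [x], an endomorphism of [N] is a scalar, unique modulo [var i]. *)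
Lemma Pbar_generator : exists x : N,
  [/\ forall y, exists b : B, y = b *: x,
      idem k i *: x = x,
      forall y, exists r, idem k i *: y = bscal r *: x &
      forall r, bscal r *: x = 0 <-> exists t, r = t * var k i].
Proof.
have [p [pS pK]] := Pbar_quotient k i; have [e eE] := projP_unit_ex.
have pZ (b : B) x : p (b *: x) = b *: p x by exact: linearZ_LR.
exists (p e); split=> [y||y|r].
- have [b <-] := pS y; exists (val b : B); rewrite -pZ; congr (p _).
  by apply: projP_ext; rewrite pvalZ eE.
- rewrite -pZ; congr (p _); apply: projP_ext.
  by rewrite pvalZ eE idem_single eqxx.
- have [b <-] := pS y; exists (qrepr (pval b i)); rewrite -!pZ; congr (p _).
  by apply: projP_ext; rewrite pvalZ idemE pval_bscal eE scale_single mulr1.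
rewrite -pZ pK scalerA -bscalM; split=> [r0|[t ->]].
  have /(congr1 (@pval k n' i)) := r0; rewrite pval_bscal eE scale_single mulr1.
  move/(congr1 (fun v : V => v i)); rewrite single_self => /qpi_eqP[c].
  rewrite subr0 xprod_yprod yprodS => yr.
  (* [yprod i * r] is a multiple of [yprod i * var i]. After subtraction the difference is killed by
     [yprod i], hence is a multiple of the complementary product, in which [var i] occurs. *)
  have [|r' r'E] := @vprod_ann k n (fun j : 'I_n => (j < i)%N) (r - c * var k i).
    by rewrite mulrBr yr mulrCA subrr.
  have [d dE] : exists d, vprod k (fun j : 'I_n => ~~ (j < i)%N) = d * vprod k (fun j => j == i).
    by apply: vprod_sub => j /eqP ->; rewrite ltnn.
  exists (c + d * r'); rewrite mulrDl mulrAC -vprod1 -dE -r'E vprod1.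
  by rewrite addrC subrK.
apply: pval_eq0; rewrite pval_bscal eE scale_single.
rewrite -[RHS](single_xprod i t) scale_single; congr (single _ _).
by rewrite mulr1 mulrCA -yprodS -xprod_yprod mulrC.
Qed.

(** A cocycle is read off from its value at a lift [x0] of the generator [x]. That value lies in
    [idem i *: N] because [idem i *: x0 - x0] is a boundary. *)
Lemma Pbar_Ext0 : Ext_iso (@homothety (ringR k n) V) N N 0 (qring (var k i)).
Proof.
move=> X [Xp [eps [X0 Xe Xm Xs]]].
have [x [xgen xe xs xK]] := Pbar_generator.
have [x0 x0E] := Xs x.
have xq r r' : bscal r *: x = bscal r' *: x <-> qpi (var k i) r = qpi (var k i) r'.
  have -> : (bscal r *: x = bscal r' *: x) <-> bscal (r - r') *: x = 0.
    rewrite (_ : bscal (r - r') = bscal r - bscal r'); last first.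
      by apply: endo_ext => v; exact: scalerBl.
    by rewrite scalerBl; split=> [->|/eqP]; rewrite ?subrr // subr_eq0 => /eqP.
  by rewrite xK; split=> [/qpi_eqP|/qpi_eqP].
(* [psi0] has to be total; the value 0 off the [R]-multiples of [x] is a default that [fx0] keeps
   cocycles away from. *)
pose psi0 (y : N) : qring (var k i) :=
  if pselect (exists s, y = bscal (qrepr s) *: x) is left h then projT1 (cid h) else 0.
have psi0E r : psi0 (bscal r *: x) = qpi (var k i) r.
  rewrite /psi0; case: pselect => [h|[]]; last first.
    by exists (qpi (var k i) r); apply/xq; rewrite qreprK.
  by case: cid => s /= /xq ->; rewrite qreprK.
have fx0 f : @cocycle B X N (- 0 - 1) f -> exists r, f x0 = bscal r *: x.
  move=> [fl fd]; pose F := mklin fl.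
  have [y yE] : exists y, idem k i *: x0 - x0 = cdiff X (-1) y.
    by apply/Xm; rewrite linearB linearZ_LR x0E xe subrr.
  have [r rE] := xs (f x0); exists r; rewrite -rE.
  have := fd y; rewrite -[cdiff X _ y]/(cdiff X (-1) y) -yE -[f _]/(F _).
  by rewrite linearB linearZ_LR => /eqP; rewrite subr_eq0 => /eqP ->.
exists (fun f => psi0 (f x0)); split.
- move=> r f g /fx0[a ->] /fx0[b ->].
  rewrite !psi0E scalerA -[homothety V r]/(bscal r) -bscalM -scalerDl -bscalD psi0E.
  by rewrite qpiD qpiZ.
- move=> s; exists (fun z => bscal (qrepr s) *: eps z).
    split=> [a y z|y]; last by rewrite (iffRL (Xm _)) ?scaler0 //; exists y.
    by rewrite linearP scalerDr !scalerA bscal_central.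
  by rewrite x0E psi0E qreprK.
move=> f fc; have [fl fd] := fc; have [r fr] := fx0 f fc; pose F := mklin fl; split.
  rewrite fr psi0E => r0; exists (lzero _ _) => z.
  have f0 : f x0 = 0.
    rewrite fr; have /xq -> : qpi (var k i) r = qpi (var k i) 0 by rewrite r0.
    by rewrite bscal0 scale0r.
  have [b bE] := xgen (eps z).
  have [y yE] : exists y, z - b *: x0 = cdiff X (-1) y.
    by apply/Xm; rewrite linearB linearZ_LR x0E bE subrr.
  have := fd y; rewrite -[cdiff X _ y]/(cdiff X (-1) y) -yE -[f _]/(F _).
  by rewrite linearB linearZ_LR -[F x0]/(f x0) f0 scaler0 subr0.
(* Coboundaries factor through the term of degree 1, which is zero. *)
move=> [g gE]; rewrite gE (X0 1 isT (cdiff X _ x0)) linear0.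
by have := psi0E 0; rewrite bscal0 scale0r.
Qed.

End Ext.

Theorem proposition4p1p2 (k : comNzRingType) (n : nat) (hn : (0 < n)%N) :
  [/\ (forall i : 'I_n,
         Ext_iso (@homothety (ringR k n) (summands k n)) (Pbar k i) (Pbar k i) 0
           (qring (var k i)) /\
         (forall m : int, m != 0 -> Ext_vanish (Pbar k i) (Pbar k i) m)),
      (forall i : 'I_n,
         exists X : perf (ringB k n), projective_resolution X (Pbar k i)),
      semiorthogonal_decomposition
        (fun a : 'I_n => module_hull (Pbar k (rev_ord a))) &
      (forall i : 'I_n,
         perf_equivalent
           (fun c : k => qpi (var k i) (cst n c))
           (fun c : k => homothety (summands k n) (cst n c))
           (module_hull (Pbar k i)))].
Proof.
(* The successor form supplies [ord_max], the index of the summand [R]. *)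
case: n hn => [//|n' _]; split.
- by move=> i; split; [exact: Pbar_Ext0|exact: Pbar_Ext_vanish].
- by move=> i; exists (Perf (kres_perfect k i)); exact: kres_resolution.
- split.
  + by move=> a; apply: module_hull_triangulated.
  (* Reversal turns [a < b] into [rev_ord b < rev_ord a], the order in which the hulls are
     orthogonal. *)
  + move=> a b ab X Y; apply: hull_orthogonal.
    by have := ltn_ord b; rewrite /=; lia.
  + move=> X T HT H; apply: (hulls_generate HT) => i Y iY.
    by apply: H; exists (rev_ord i); rewrite rev_ordK.
- by move=> i; exact: hull_equivalent.
Qed.
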